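(* Let $E=\mathbb R^2$, $G=I_2(m)$ a dihedral group, $\tau$ an irreducible representation of $G$, and $c$ real-valued and close enough to $c=0$ such that $M_c(\tau)$ is irreducible and unitarisable. Then the space $K_c(\tau)=M_c(\tau)\otimes\mathbb S$ has the $\mathfrak u(2|1)$-decomposition $$K_c(\tau)=\bigoplus_{l=0}^1\ \bigoplus_{k\in\mathbb Z_{\ge0}}\mathcal M_c(\tau)_k^l\otimes L_{\mathfrak u(2|1)}\big(k+1-N_c(\tau),\,(-1)^l(k-N_c(\tau)),\,l-\tfrac12\big).$$ The space $\mathcal M_c(\tau)_k^l$ is an irreducible module for the centraliser algebra $\mathrm{Cent}_{H_c(G,E)\otimes\mathcal C}(\mathfrak u(2|1))$ only when $\tau$ is one-dimensional.
   Context: $E=\mathbb R^2$ has orthonormal basis $\xi,\eta$ and dual basis $x,y$ of $E^*$. $G=I_2(m)$ is the dihedral group of order $2m$ generated by the reflections $s_1,\dots,s_m$, where $s_j$ is the reflection in the unit vector $\alpha_j=\sin(\pi j/m)\xi-\cos(\pi j/m)\eta$; put $a_j=\sin(\pi j/m)x-\cos(\pi j/m)y$. $c$ is a conjugation-invariant function on the reflections. $H_c(G,E)$ is the quotient of $T(E_{\mathbb C}\oplus E_{\mathbb C}^* )\rtimes G$ (where $gX=(g\cdot X)g$) by the relations that elements of $E$ commute, elements of $E^*$ commute, and $[\xi',x']=\langle x',\xi'\rangle-2\sum_{j=1}^mc(s_j)\langle x',\alpha_j\rangle\langle a_j,\xi'\rangle s_j$. Put $z=x+iy$, $\bar z=x-iy$,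 $\zeta=\frac12(\xi-i\eta)$, $\bar\zeta=\frac12(\xi+i\eta)$, $\sigma=\sum_jc(s_j)s_j$, $E_+=\frac12z\bar z$, $E_-=-2\zeta\bar\zeta$, $H=z\zeta+\bar z\bar\zeta+1-\sigma$. $\mathcal C$ is the complex Clifford algebra with generators $e_1,e_2$, $\{e_j,e_k\}=2\delta_{jk}$; $f=\frac12(e_1-ie_2)$, $f^\dagger=\frac12(e_1+ie_2)$. The spinor space $\mathbb S=\mathbb S^0\oplus\mathbb S^1$ has basis $1\in\mathbb S^0$, $f^\dagger\in\mathbb S^1$, with $f^\dagger$ acting by exterior multiplication and $f$ by the Grassmann derivative ($f\cdot1=0$, $f\cdot f^\dagger=1$). In the tensor product algebra $H_c(G,E)\otimes\mathcal C$, $\mathfrak u(2|1)$ is the Lie superalgebra with odd part spanned by $F_+=\bar zf^\dagger$, $\bar F_+=zf$, $F_-=2\zeta f^\dagger$, $\bar F_-=2\bar\zeta f$, and even part spanned by $E_\pm$, $H$, $Z_2=f^\dagger f-\frac12$, $Z_1=\bar z\bar\zeta-z\zeta+2\sigma Z_2$. $L_{\mathfrak u(2|1)}(\lambda,\nu,\gamma)$ is the irreducible lowest weight representation of $\mathfrak u(2|1)$ of $(H,Z_1,Z_2)$-lowest weight $(\lambda,\nu,\gamma)$ (lowest weight vectors are annihilated by $E_-,F_-,\bar F_-$). $M_c(\tau)\cong\mathbb C[E]\otimes V(\tau)$ is the standard module of $H_c(G,E)$, induced from $V(\tau)$ with $E$ acting by zero on $V(\tau)$; $N_c(\tau)$ is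 the scalar by which $\sigma$ acts on $V(\tau)$. $\mathcal M_c(\tau)_k^l$ is the subspace of $K_c(\tau)$ of elements of polynomial degree $k$ and spinor degree $l$ lying in $\ker F_-\cap\ker\bar F_-$. For real $c$, $\ast$ is the conjugate-linear anti-involution of $H_c(G,E)$ with $\xi^*=x$, $x^*=\xi$, $\eta^*=y$, $y^*=\eta$, $s_j^*=s_j$; $M_c(\tau)$ is unitarisable if its Hermitian form $\beta$ with $\beta(hp,q)=\beta(p,h^*q)$, restricting to a $G$-invariant inner product on $V(\tau)$, is positive definite. *)

(* Defs.v *)
From HB Require Import structures.
From mathcomp Require Import all_boot all_order all_algebra all_fingroup.
From mathcomp Require Import mxrepresentation generic_quotient complex.
From mathcomp Require Import ring lra.
From mathcomp Require Import boolp classical_sets reals trigo.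

Set Implicit Arguments.
Unset Strict Implicit.
Unset Printing Implicit Defensive.

Import Order.TTheory GRing.Theory Num.Theory.

Local Open Scope ring_scope.
Local Open Scope complex_scope.
Local Open Scope quotient_scope.
Local Open Scope classical_set_scope.

(* Over a commutative ring K: noncommutative polynomial expressions in the
   generators X, modulo the smallest congruence which contains the relations r
   and makes the quotient a unital associative K-algebra.  The quotient is
   only known to be a [pzRingType] (a presented algebra may be zero), hence it
   cannot be an [algType]; the K-action is the [lmodType K] structure, and
   [palg_cst] is the (central) structure map from K. *)

Inductive aterm (K X : Type) : Type :=
| AVar of X
| ACst of K
| AAdd of aterm K X & aterm K X
| AMul of aterm K X & aterm K X.

Arguments AVar {K X}.
Arguments ACst {K X}.
Arguments AAdd {K X}.
Arguments AMul {K X}.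

Declare Scope aterm_scope.
Delimit Scope aterm_scope with AT.
Bind Scope aterm_scope with aterm.
Notation "t + u" := (AAdd t u) : aterm_scope.
Notation "t * u" := (AMul t u) : aterm_scope.

Inductive acong (K : comPzRingType) (X : Type)
    (r : aterm K X -> aterm K X -> Prop) : aterm K X -> aterm K X -> Prop :=
| ac_rel t u : r t u -> acong r t u
| ac_refl t : acong r t t
| ac_sym t u : acong r t u -> acong r u t
| ac_trans t u v : acong r t u -> acong r u v -> acong r t v
| ac_add t t' u u' : acong r t t' -> acong r u u' -> acong r (t + u) (t' + u')
| ac_mul t t' u u' : acong r t t' -> acong r u u' -> acong r (t * u) (t' * u')
| ac_addA t u v : acong r (t + (u + v)) (t + u + v)
| ac_addC t u : acong r (t + u) (u + t)
| ac_add0 t : acong r (ACst 0 + t) t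
| ac_addN t : acong r (ACst (-1) * t + t) (ACst 0)
| ac_mulA t u v : acong r (t * (u * v)) (t * u * v)
| ac_mul1l t : acong r (ACst 1 * t) t
| ac_mul1r t : acong r (t * ACst 1) t
| ac_mulDl t u v : acong r ((t + u) * v) (t * v + u * v)
| ac_mulDr t u v : acong r (t * (u + v)) (t * u + t * v)
| ac_cstD (a b : K) : acong r (ACst (a + b)%R) (ACst a + ACst b)
| ac_cstM (a b : K) : acong r (ACst (a * b)%R) (ACst a * ACst b)
| ac_cstC (a : K) t : acong r (ACst a * t) (t * ACst a).

Section PresentedAlgebra.
Variables (K : comPzRingType) (X : Type).
Variable r : aterm K X -> aterm K X -> Prop.

Let T := {classic aterm K X}.

Definition acong_rel : rel T := fun t u => `[< acong r t u >].

Lemma acong_equiv : equiv_class_of acong_rel.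
Proof.
split=> [t|t u|u t v].
- by apply/asboolP; apply: ac_refl.
- by apply/asboolP/asboolP; apply: ac_sym.
- by move=> /asboolP tu /asboolP uv; apply/asboolP/(ac_trans tu uv).
Qed.

Definition acong_eqrel : equiv_rel T := EquivRelPack acong_equiv.

Definition palg : Type := {eq_quot acong_eqrel}.

HB.instance Definition _ := Choice.on palg.

Definition palg_of (t : aterm K X) : palg := \pi_({eq_quot acong_eqrel}) (t : T).
Definition palg_repr (a : palg) : aterm K X := repr (a : {eq_quot acong_eqrel}).

Lemma palg_reprK a : palg_of (palg_repr a) = a.
Proof. exact: reprK. Qed.

Lemma palg_ofP t u : palg_of t = palg_of u <-> acong r t u.
Proof.
split=> [/eqP|tu]; first by rewrite /palg_of eqquotE => /asboolP.
by apply/eqP; rewrite /palg_of eqquotE; apply/asboolP.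
Qed.

Lemma acong_repr t : acong r (palg_repr (palg_of t)) t.
Proof. by apply/palg_ofP; rewrite palg_reprK. Qed.

Let add a b := palg_of (palg_repr a + palg_repr b)%AT.
Let mul a b := palg_of (palg_repr a * palg_repr b)%AT.
Let opp a := palg_of (ACst (-1) * palg_repr a)%AT.

Let addE t u : add (palg_of t) (palg_of u) = palg_of (t + u)%AT.
Proof. by apply/palg_ofP/ac_add; apply: acong_repr. Qed.

Let mulE t u : mul (palg_of t) (palg_of u) = palg_of (t * u)%AT.
Proof. by apply/palg_ofP/ac_mul; apply: acong_repr. Qed.

Let oppE t : opp (palg_of t) = palg_of (ACst (-1) * t)%AT.
Proof. by apply/palg_ofP/ac_mul; [apply: ac_refl | apply: acong_repr]. Qed.

Let ind (P : palg -> Prop) : (forall t, P (palg_of t)) -> forall a, P a.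
Proof. by move=> h a; rewrite -(palg_reprK a). Qed.

Let addA : associative add.
Proof. by do 3![elim/ind => ?]; rewrite !addE; apply/palg_ofP/ac_addA. Qed.
Let addC : commutative add.
Proof. by do 2![elim/ind => ?]; rewrite !addE; apply/palg_ofP/ac_addC. Qed.
Let add0 : left_id (palg_of (ACst 0)) add.
Proof. by elim/ind => ?; rewrite addE; apply/palg_ofP/ac_add0. Qed.
Let addN : left_inverse (palg_of (ACst 0)) opp add.
Proof. by elim/ind => ?; rewrite oppE addE; apply/palg_ofP/ac_addN. Qed.
Let mulA : associative mul.
Proof. by do 3![elim/ind => ?]; rewrite !mulE; apply/palg_ofP/ac_mulA. Qed.
Let one_mul : left_id (palg_of (ACst 1)) mul.
Proof. by elim/ind => ?; rewrite mulE; apply/palg_ofP/ac_mul1l. Qed.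
Let mul_one : right_id (palg_of (ACst 1)) mul.
Proof. by elim/ind => ?; rewrite mulE; apply/palg_ofP/ac_mul1r. Qed.
Let mulDl : left_distributive mul add.
Proof.
by do 3![elim/ind => ?]; rewrite !(addE, mulE); apply/palg_ofP/ac_mulDl.
Qed.
Let mulDr : right_distributive mul add.
Proof.
by do 3![elim/ind => ?]; rewrite !(addE, mulE); apply/palg_ofP/ac_mulDr.
Qed.

HB.instance Definition _ := GRing.isPzRing.Build palg
  addA addC add0 addN mulA one_mul mul_one mulDl mulDr.

Lemma palg_ofD t u : palg_of (t + u)%AT = palg_of t + palg_of u.
Proof. by rewrite -addE. Qed.

Lemma palg_ofM t u : palg_of (t * u)%AT = palg_of t * palg_of u.
Proof. by rewrite -mulE. Qed.

Definition palg_gen (x : X) : palg := palg_of (AVar x).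
Definition palg_cst (k : K) : palg := palg_of (ACst k).

Lemma palg_cstD : {morph palg_cst : a b / a + b}.
Proof. by move=> a b; rewrite -palg_ofD; apply/palg_ofP/ac_cstD. Qed.

Lemma palg_cstM : {morph palg_cst : a b / a * b}.
Proof. by move=> a b; rewrite -palg_ofM; apply/palg_ofP/ac_cstM. Qed.

Lemma palg_cst1 : palg_cst 1 = 1. Proof. by []. Qed.

Lemma palg_cst0 : palg_cst 0 = 0. Proof. by []. Qed.

Lemma palg_cstC k a : palg_cst k * a = a * palg_cst k.
Proof. by elim/ind: a => t; rewrite -!palg_ofM; apply/palg_ofP/ac_cstC. Qed.

Let scale k a := palg_cst k * a.
Let scaleA a b v : scale a (scale b v) = scale (a * b) v.
Proof. by rewrite /scale palg_cstM mulrA. Qed.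
Let scale1 : left_id 1 scale.
Proof. by move=> a; rewrite /scale palg_cst1 mul1r. Qed.
Let scaleDr : right_distributive scale +%R.
Proof. by move=> k a b; rewrite /scale mulrDr. Qed.
Let scaleDl v : {morph scale^~ v : a b / a + b}.
Proof. by move=> a b; rewrite /scale palg_cstD mulrDl. Qed.

HB.instance Definition _ := GRing.Zmodule_isLmodule.Build K palg
  scaleA scale1 scaleDr scaleDl.

Lemma palg_scaleE k (a : palg) : k *: a = palg_cst k * a.
Proof. by []. Qed.

Section Lift.
Variables (B : pzRingType) (h : {rmorphism K -> B}) (f : X -> B).
Hypothesis hC : forall k b, h k * b = b * h k.

Fixpoint aeval (t : aterm K X) : B :=
  match t with
  | AVar x => f x
  | ACst k => h k
  | AAdd t u => aeval t + aeval u
  | AMul t u => aeval t * aeval u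
  end.

Hypothesis hr : forall t u, r t u -> aeval t = aeval u.

Lemma aeval_acong t u : acong r t u -> aeval t = aeval u.
Proof.
elim=> //= {t u}.
- by move=> t u v _ -> _ ->.
- by move=> t t' u u' _ -> _ ->.
- by move=> t t' u u' _ -> _ ->.
- by move=> *; rewrite addrA.
- by move=> *; rewrite addrC.
- by move=> *; rewrite rmorph0 add0r.
- by move=> *; rewrite rmorphN rmorph1 mulN1r addNr rmorph0.
- by move=> *; rewrite mulrA.
- by move=> *; rewrite rmorph1 mul1r.
- by move=> *; rewrite rmorph1 mulr1.
- by move=> *; rewrite mulrDl.
- by move=> *; rewrite mulrDr.
- by move=> *; rewrite rmorphD.
- by move=> *; rewrite rmorphM.
Qed.

Definition palg_lift (a : palg) : B := aeval (palg_repr a).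

Lemma palg_lift_of t : palg_lift (palg_of t) = aeval t.
Proof. exact/aeval_acong/acong_repr. Qed.

Lemma palg_liftD : {morph palg_lift : a b / a + b}.
Proof.
by do 2![elim/ind => ?]; rewrite -palg_ofD !palg_lift_of.
Qed.

Lemma palg_liftM : {morph palg_lift : a b / a * b}.
Proof.
by do 2![elim/ind => ?]; rewrite -palg_ofM !palg_lift_of.
Qed.

Lemma palg_lift1 : palg_lift 1 = 1.
Proof. by rewrite palg_lift_of /= rmorph1. Qed.

Lemma palg_lift_cst k : palg_lift (palg_cst k) = h k.
Proof. exact: palg_lift_of. Qed.

Lemma palg_lift_gen x : palg_lift (palg_gen x) = f x.
Proof. exact: palg_lift_of. Qed.
End Lift.

End PresentedAlgebra.

Arguments palg {K X} r.

(* Over a ring A: A-linear expressions in the generators X, modulo the smallest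
   congruence which contains the relations r and makes the quotient a left
   A-module. *)

Inductive mterm (A X : Type) : Type :=
| MVar of X
| MZero
| MAdd of mterm A X & mterm A X
| MScale of A & mterm A X.

Arguments MVar {A X}.
Arguments MZero {A X}.
Arguments MAdd {A X}.
Arguments MScale {A X}.

Declare Scope mterm_scope.
Delimit Scope mterm_scope with MT.
Bind Scope mterm_scope with mterm.
Notation "t + u" := (MAdd t u) : mterm_scope.
Notation "a *: t" := (MScale a%R t) : mterm_scope.

Inductive mcong (A : pzRingType) (X : Type)
    (r : mterm A X -> mterm A X -> Prop) : mterm A X -> mterm A X -> Prop :=
| mc_rel t u : r t u -> mcong r t u
| mc_refl t : mcong r t t
| mc_sym t u : mcong r t u -> mcong r u t
| mc_trans t u v : mcong r t u -> mcong r u v -> mcong r t v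
| mc_add t t' u u' : mcong r t t' -> mcong r u u' -> mcong r (t + u) (t' + u')
| mc_scale a t t' : mcong r t t' -> mcong r (a *: t) (a *: t')
| mc_addA t u v : mcong r (t + (u + v)) (t + u + v)
| mc_addC t u : mcong r (t + u) (u + t)
| mc_add0 t : mcong r (MZero + t) t
| mc_addN t : mcong r ((-1) *: t + t) MZero
| mc_scaleA a b t : mcong r (a *: (b *: t)) ((a * b) *: t)
| mc_scale1 t : mcong r (1 *: t) t
| mc_scaleDr a t u : mcong r (a *: (t + u)) (a *: t + a *: u)
| mc_scaleDl a b t : mcong r ((a + b) *: t) (a *: t + b *: t).

Section PresentedModule.
Variables (A : pzRingType) (X : Type).
Variable r : mterm A X -> mterm A X -> Prop.

Let T := {classic mterm A X}.

Definition mcong_rel : rel T := fun t u => `[< mcong r t u >].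

Lemma mcong_equiv : equiv_class_of mcong_rel.
Proof.
split=> [t|t u|u t v].
- by apply/asboolP; apply: mc_refl.
- by apply/asboolP/asboolP; apply: mc_sym.
- by move=> /asboolP tu /asboolP uv; apply/asboolP/(mc_trans tu uv).
Qed.

Definition mcong_eqrel : equiv_rel T := EquivRelPack mcong_equiv.

Definition pmod : Type := {eq_quot mcong_eqrel}.

HB.instance Definition _ := Choice.on pmod.

Definition pmod_of (t : mterm A X) : pmod := \pi_({eq_quot mcong_eqrel}) (t : T).
Definition pmod_repr (a : pmod) : mterm A X := repr (a : {eq_quot mcong_eqrel}).

Lemma pmod_reprK a : pmod_of (pmod_repr a) = a.
Proof. exact: reprK. Qed.

Lemma pmod_ofP t u : pmod_of t = pmod_of u <-> mcong r t u.
Proof.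
split=> [/eqP|tu]; first by rewrite /pmod_of eqquotE => /asboolP.
by apply/eqP; rewrite /pmod_of eqquotE; apply/asboolP.
Qed.

Lemma mcong_repr t : mcong r (pmod_repr (pmod_of t)) t.
Proof. by apply/pmod_ofP; rewrite pmod_reprK. Qed.

Let add p q := pmod_of (pmod_repr p + pmod_repr q)%MT.
Let scale a p := pmod_of (a *: pmod_repr p)%MT.

Let addE t u : add (pmod_of t) (pmod_of u) = pmod_of (t + u)%MT.
Proof. by apply/pmod_ofP/mc_add; apply: mcong_repr. Qed.

Let scaleE a t : scale a (pmod_of t) = pmod_of (a *: t)%MT.
Proof. by apply/pmod_ofP/mc_scale; apply: mcong_repr. Qed.

Let ind (P : pmod -> Prop) : (forall t, P (pmod_of t)) -> forall p, P p.
Proof. by move=> h a; rewrite -(pmod_reprK a). Qed.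

Let addA : associative add.
Proof. by do 3![elim/ind => ?]; rewrite !addE; apply/pmod_ofP/mc_addA. Qed.
Let addC : commutative add.
Proof. by do 2![elim/ind => ?]; rewrite !addE; apply/pmod_ofP/mc_addC. Qed.
Let add0 : left_id (pmod_of MZero) add.
Proof. by elim/ind => ?; rewrite addE; apply/pmod_ofP/mc_add0. Qed.
Let addN : left_inverse (pmod_of MZero) (scale (-1)) add.
Proof. by elim/ind => ?; rewrite scaleE addE; apply/pmod_ofP/mc_addN. Qed.

HB.instance Definition _ := GRing.isZmodule.Build pmod addA addC add0 addN.

Let scaleA a b p : scale a (scale b p) = scale (a * b) p.
Proof. by elim/ind: p => ?; rewrite !scaleE; apply/pmod_ofP/mc_scaleA. Qed.
Let scale1 : left_id 1 scale.
Proof. by elim/ind => ?; rewrite scaleE; apply/pmod_ofP/mc_scale1. Qed.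
Let scaleDr : right_distributive scale +%R.
Proof.
move=> a; elim/ind => t; elim/ind => u.
rewrite -[pmod_of t + _]/(add _ _) -[RHS]/(add _ _) addE !scaleE addE.
exact/pmod_ofP/mc_scaleDr.
Qed.
Let scaleDl p : {morph scale^~ p : a b / a + b}.
Proof.
elim/ind: p => t a b; rewrite -[RHS]/(add _ _) !scaleE addE.
exact/pmod_ofP/mc_scaleDl.
Qed.

HB.instance Definition _ := GRing.Zmodule_isLmodule.Build A pmod
  scaleA scale1 scaleDr scaleDl.

Lemma pmod_ofD t u : pmod_of (t + u)%MT = pmod_of t + pmod_of u.
Proof. by rewrite -addE. Qed.

Lemma pmod_ofZ a t : pmod_of (a *: t)%MT = a *: pmod_of t.
Proof. by rewrite -scaleE. Qed.

Lemma pmod_of0 : pmod_of MZero = 0. Proof. by []. Qed.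

Definition pmod_gen (x : X) : pmod := pmod_of (MVar x).
End PresentedModule.

Arguments pmod {A X} r.

(* For 0 < m, the pair (k, b) stands for the rotation through 2 pi k / m,
   preceded, when b holds, by the reflection diag(1, -1); see [dih_mx]. *)
Definition dihedral (m : nat) : Type := ('I_m.-1.+1 * bool)%type.

HB.instance Definition _ (m : nat) := Finite.on (dihedral m).

Section DihedralGroup.
Variable m : nat.

Let mul (g h : dihedral m) : dihedral m :=
  (if g.2 then g.1 - h.1 else g.1 + h.1, g.2 (+) h.2).
Let one : dihedral m := (0, false).
Let inv (g : dihedral m) : dihedral m := (if g.2 then g.1 else - g.1, g.2).

Let mulA : associative mul.
Proof.
by move=> [x [|]] [y [|]] [z [|]]; rewrite /mul /= ?addrA ?opprD ?addrA ?opprK.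
Qed.
Let mul1 : left_id one mul.
Proof. by move=> [x b]; rewrite /mul /= add0r. Qed.
Let mulV : left_inverse one inv mul.
Proof. by move=> [x [|]]; rewrite /mul /inv /= ?subrr ?addNr. Qed.

HB.instance Definition _ := Finite_isGroup.Build (dihedral m) mulA mul1 mulV.

Lemma dihM1 (g h : dihedral m) :
  (g * h)%g.1 = if g.2 then g.1 - h.1 else g.1 + h.1.
Proof. by []. Qed.

Lemma dihM2 (g h : dihedral m) : (g * h)%g.2 = g.2 (+) h.2.
Proof. by []. Qed.
End DihedralGroup.

(* The reflections are s_1, ..., s_m. *)
Definition refl (m j : nat) : dihedral m := (inZp j, true).

Section DihedralAction.
Variables (R : realType) (m : nat).

Definition rot_mx (t : R) : 'M[R]_2 :=
  \matrix_(i, j) (if i == j then cos t else if (i < j)%N then - sin t else sin t).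

Definition flip_mx : 'M[R]_2 := diag_mx (\row_j (-1) ^+ j).

Definition dih_mx (g : dihedral m) : 'M[R]_2 :=
  rot_mx (pi *+ 2 * g.1%:R / m%:R) *m (if g.2 then flip_mx else 1%:M).

Definition alpha (j : nat) : 'cV[R]_2 :=
  \col_i (if i == 0 then sin (pi * j%:R / m%:R) else - cos (pi * j%:R / m%:R)).

Let angle (n : nat) : R := pi *+ 2 * n%:R / m%:R.

Lemma mx2P (A B : 'M[R]_2) :
  A 0 0 = B 0 0 -> A 0 1 = B 0 1 -> A 1 0 = B 1 0 -> A 1 1 = B 1 1 -> A = B.
Proof.
move=> h00 h01 h10 h11; apply/matrixP => i j.
have o2 (k : 'I_2) : k = 0 \/ k = 1.
  by case: k => [[|[|//]] ?]; [left|right]; apply: val_inj.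
by case: (o2 i) => ->; case: (o2 j) => ->.
Qed.

Lemma rot_mxD a b : rot_mx (a + b) = rot_mx a *m rot_mx b.
Proof.
by apply: mx2P; rewrite !mxE !big_ord_recl big_ord0 !mxE /= ?cosD ?sinD; ring.
Qed.

Lemma rot_mx0 : rot_mx 0 = 1%:M.
Proof. by apply: mx2P; rewrite !mxE /= ?cos0 ?sin0 ?oppr0. Qed.

Lemma flip_rot_mx a : flip_mx *m rot_mx a = rot_mx (- a) *m flip_mx.
Proof.
apply: mx2P; rewrite !mxE ?big_ord_recl ?big_ord0 ?mxE /= ?cosN ?sinN
  ?expr0 ?expr1 ?mulr1n ?mulr0n ?(mulN1r, mulrN1, mulr1, mul1r, mul0r, mulr0);
  ring.
Qed.

Lemma flip_mxK : flip_mx *m flip_mx = 1%:M.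
Proof.
apply: mx2P; rewrite !mxE ?big_ord_recl ?big_ord0 ?mxE /=
  ?expr0 ?expr1 ?mulr1n ?mulr0n ?(mulN1r, mulrN1, mulr1, mul1r, mul0r, mulr0);
  ring.
Qed.

Hypothesis m_gt0 : (0 < m)%N.

Let m_neq0 : m%:R != 0 :> R.
Proof. by rewrite pnatr_eq0 -lt0n. Qed.

Let rot_angleD2pi a n : rot_mx (a + pi *+ 2 *+ n) = rot_mx a.
Proof.
elim: n => [|n IHn]; first by rewrite mulr0n addr0.
rewrite mulrSr addrA -[RHS]IHn; set b := a + _.
by apply: mx2P; rewrite !mxE /= ?cosD2pi ?sinD2pi.
Qed.

Let rot_angle_mod n : rot_mx (angle (n %% m)) = rot_mx (angle n).
Proof.
rewrite -(rot_angleD2pi (angle (n %% m)) (n %/ m)); congr rot_mx.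
rewrite {3}(divn_eq n m) /angle natrD natrM -[_ *+ (n %/ m)]mulr_natr.
by field.
Qed.

Let rot_angle_opp (k : 'I_m.-1.+1) :
  rot_mx (angle (- k : 'I_m.-1.+1)) = rot_mx (- angle k).
Proof.
have -> : angle (- k : 'I_m.-1.+1) = angle ((m - k) %% m)%N.
  by rewrite /=; congr (angle ((_ - _) %% _)); exact: prednK.
have km : (k <= m)%N by rewrite ltnW // -[X in (_ < X)%N](prednK m_gt0).
rewrite rot_angle_mod -(rot_angleD2pi (- angle k) 1); congr rot_mx.
by rewrite /angle natrB //; field.
Qed.

Let rot_angle_add (k l : 'I_m.-1.+1) :
  rot_mx (angle ((k + l)%R : 'I_m.-1.+1)) = rot_mx (angle k + angle l).
Proof.
have -> : angle ((k + l)%R : 'I_m.-1.+1) = angle ((k + l) %% m)%N.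
  by rewrite /=; congr (angle (_ %% _)); exact: prednK.
by rewrite rot_angle_mod; congr rot_mx; rewrite /angle natrD; field.
Qed.

Lemma dih_mx1 : dih_mx 1%g = 1%:M.
Proof. by rewrite /dih_mx /= mulr0 mul0r rot_mx0 mulmx1. Qed.

Lemma dih_mxM g h : dih_mx (g * h)%g = dih_mx g *m dih_mx h.
Proof.
rewrite /dih_mx dihM1 dihM2; case: g h => [k b] [l d].
case: b; cbn [fst snd addb negb]; rewrite -!/(angle _); last first.
  by rewrite rot_angle_add rot_mxD mulmx1 !mulmxA.
rewrite rot_angle_add !rot_mxD rot_angle_opp.
rewrite -!mulmxA (mulmxA flip_mx) flip_rot_mx -!mulmxA; case: d => /=.
  by rewrite flip_mxK.
by rewrite !mulmx1.
Qed.

(* s_j acts on E as the reflection in the unit vector alpha_j. *)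
Lemma dih_mx_refl j :
  dih_mx (refl m j) = 1%:M - 2%:R *: (alpha j *m (alpha j)^T).
Proof.
rewrite /dih_mx /= -!/(angle _) prednK // rot_angle_mod.
have -> : angle j = (pi * j%:R / m%:R) *+ 2.
  by rewrite /angle; field.
set t := _ / _; apply: mx2P; rewrite !mxE !big_ord_recl !big_ord0 !mxE /= -!/t;
  rewrite ?expr0 ?expr1 ?mulr1n ?mulr0n ?sin_mulr2n ?cos_mulr2n;
  rewrite ?(mulN1r, mulrN1, mulr1, mul1r, mul0r, mulr0, mulrNN) -?expr2 ?sin2cos2;
  ring.
Qed.

Lemma dih_mx_inj : injective dih_mx.
Proof.
have h1 g : dih_mx g = 1%:M -> g = 1%g.
  case: g => k [|]; rewrite /dih_mx /= -!/(angle _) => /matrixP e.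
    have := e 0 0; have := e 1 1.
    rewrite !mxE !big_ord_recl !big_ord0 !mxE /=.
    rewrite ?expr0 ?expr1 ?mulr1n ?mulr0n => h h'.
    by exfalso; have := @ltr01 R; lra.
  have := e 0 0; rewrite mulmx1 !mxE /=.
  have -> : angle k = (pi * k%:R / m%:R) *+ 2 by rewrite /angle; field.
  set t := _ / _; rewrite cos_mulr2n cos2sin2 => ct.
  have st : sin t = 0.
    by apply/eqP; rewrite -sqrf_eq0; apply/eqP; lra.
  case: (posnP k) => [k0|k_gt0]; first by congr pair; apply: val_inj.
  have km : (k < m)%N by rewrite -[X in (_ < X)%N](prednK m_gt0).
  suff : 0 < sin t by rewrite st ltxx.
  have mR : 0 < m%:R :> R by rewrite ltr0n.
  have kR : 0 < k%:R :> R by rewrite ltr0n.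
  rewrite sin_gt0_pi // divr_gt0 ?mulr_gt0 ?pi_gt0 //=.
  by rewrite ltr_pdivrMr // ltr_pM2l ?pi_gt0 // ltr_nat.
move=> g h e; suff gh : (g^-1 * h)%g = 1%g by rewrite -[h](mulKVg g) gh mulg1.
by apply: h1; rewrite dih_mxM -e -dih_mxM mulVg dih_mx1.
Qed.

Lemma dihedral_gen :
  <<[set refl m (val j).+1 | j : 'I_m]%SET>>%g = [set: dihedral m]%SET.
Proof.
apply/eqP; rewrite finset.eqEsubset finset.subsetT; apply/fintype.subsetP => -[k b] _.
have s (l : 'I_m.-1.+1) : ((l, true) : dihedral m)
    \in <<[set refl m (val j).+1 | j : 'I_m]%SET>>%g.
  apply: mem_gen; apply/imsetP.
  case: (posnP l) => [l0|l_gt0].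
    have hm : (m.-1 < m)%N by rewrite prednK.
    exists (Ordinal hm) => //; congr pair; apply: val_inj => /=.
    by rewrite modnn.
  have hl : (l.-1 < m)%N.
    by rewrite -[X in (_ < X)%N](prednK m_gt0) (leq_ltn_trans (leq_pred _)).
  exists (Ordinal hl) => //; congr pair; apply: val_inj => /=.
  by rewrite (prednK l_gt0) modn_small.
case: b => //.
rewrite (_ : (k, false) = ((k, true) : dihedral m) * (0, true) :> dihedral m)%g.
  exact: groupM.
by rewrite -[RHS]/((k - 0, true (+) true) : dihedral m) subr0.
Qed.
End DihedralAction.

(* The deformation parameter c is a function on G of which only the values at
   the reflections matter. *)
Section Cherednik.
Variables (R : realType) (m : nat).
Local Notation C := R[i].
Local Notation G := (dihedral m).

(* The matrices of G on column vectors: coordinates of E_C in the basis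
   (xi, eta). *)
Definition gmx (g : G) : 'M[C]_2 := map_mx (real_complex R) (dih_mx R g).
Definition alphaC (j : nat) : 'cV[C]_2 := map_mx (real_complex R) (alpha R m j).

(* Row vectors: coordinates of E_C^* in the dual basis (x, y). *)
Definition pairing (a : 'rV[C]_2) (u : 'cV[C]_2) : C := (a *m u) 0 0.

Inductive cherednik_gen : Type :=
| GenG of G
| GenE of 'cV[C]_2
| GenEd of 'rV[C]_2.

Local Notation g_ g := (AVar (GenG g)).
Local Notation e_ u := (AVar (GenE u)).
Local Notation d_ a := (AVar (GenEd a)).

(* The first four groups of relations present T(E_C + E_C^* ) x| G; the form a_j
   has the coordinates of alpha_j. *)
Inductive cherednik_rel (c : G -> C) :
    aterm C cherednik_gen -> aterm C cherednik_gen -> Prop :=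
| CrG1 : cherednik_rel c (g_ 1%g) (ACst 1)
| CrGM (g h : G) : cherednik_rel c (g_ (g * h)%g) (g_ g * g_ h)
| CrE (k : C) (u v : 'cV[C]_2) :
    cherednik_rel c (e_ (k *: u + v)) (ACst k * e_ u + e_ v)
| CrEd (k : C) (a b : 'rV[C]_2) :
    cherednik_rel c (d_ (k *: a + b)) (ACst k * d_ a + d_ b)
| CrGE (g : G) (u : 'cV[C]_2) :
    cherednik_rel c (g_ g * e_ u) (e_ (gmx g *m u) * g_ g)
| CrGEd (g : G) (a : 'rV[C]_2) :
    cherednik_rel c (g_ g * d_ a) (d_ (a *m gmx g^-1%g) * g_ g)
| CrEE (u v : 'cV[C]_2) : cherednik_rel c (e_ u * e_ v) (e_ v * e_ u)
| CrEdEd (a b : 'rV[C]_2) : cherednik_rel c (d_ a * d_ b) (d_ b * d_ a)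
| CrEEd (u : 'cV[C]_2) (a : 'rV[C]_2) :
    cherednik_rel c (e_ u * d_ a + ACst (-1) * (d_ a * e_ u))
      (ACst (pairing a u) + ACst (- 2%:R) *
        \big[AAdd/ACst 0]_(1 <= j < m.+1)
          (ACst (c (refl m j) * pairing a (alphaC j) * pairing (alphaC j)^T u)%R *
           g_ (refl m j))%AT).

Definition cherednik (c : G -> C) := palg (cherednik_rel c).

Section Elements.
Variable c : G -> C.
Local Notation Hc := (cherednik c).

HB.instance Definition _ := GRing.PzRing.on Hc.
HB.instance Definition _ := GRing.Lmodule.on Hc.

Definition hG (g : G) : Hc := palg_gen (cherednik_rel c) (GenG g).
Definition hE (u : 'cV[C]_2) : Hc := palg_gen (cherednik_rel c) (GenE u).
Definition hEd (a : 'rV[C]_2) : Hc := palg_gen (cherednik_rel c) (GenEd a).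

Definition h_xi : Hc := hE (delta_mx 0 0).
Definition h_eta : Hc := hE (delta_mx 1 0).
Definition h_x : Hc := hEd (delta_mx 0 0).
Definition h_y : Hc := hEd (delta_mx 0 1).

Definition h_z : Hc := h_x + 'i%C *: h_y.
Definition h_zb : Hc := h_x - 'i%C *: h_y.
Definition h_zeta : Hc := 2%:R^-1 *: (h_xi - 'i%C *: h_eta).
Definition h_zetab : Hc := 2%:R^-1 *: (h_xi + 'i%C *: h_eta).
Definition h_sigma : Hc :=
  \sum_(1 <= j < m.+1) c (refl m j) *: hG (refl m j).
End Elements.
End Cherednik.

Section Clifford.
Variable R : realType.
Local Notation C := R[i].
Local Notation e_ j := (AVar j).

(* The generators e_1 and e_2 have the indices 0 and 1. *)
Inductive clifford_rel : aterm C 'I_2 -> aterm C 'I_2 -> Prop :=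
| ClR (j k : 'I_2) :
    clifford_rel (e_ j * e_ k + e_ k * e_ j) (ACst (2 * (j == k)%:R)%R).

Definition clifford := palg clifford_rel.

HB.instance Definition _ := GRing.PzRing.on clifford.
HB.instance Definition _ := GRing.Lmodule.on clifford.

Definition cl_e (j : 'I_2) : clifford := palg_gen clifford_rel j.
Definition cl_f : clifford := 2%:R^-1 *: (cl_e 0 - 'i%C *: cl_e 1).
Definition cl_fd : clifford := 2%:R^-1 *: (cl_e 0 + 'i%C *: cl_e 1).

(* Column vectors of coordinates in the basis (1, f^dagger): exterior
   multiplication by f^dagger and the Grassmann derivative. *)
Definition spin_fd : 'M[C]_2 := delta_mx 1 0.
Definition spin_f : 'M[C]_2 := delta_mx 0 1.

Definition spin_e (j : 'I_2) : 'M[C]_2 :=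
  if j == 0 then spin_f + spin_fd else 'i%C *: (spin_f - spin_fd).

Lemma spin_ff : spin_f *m spin_f = 0.
Proof. by rewrite mul_delta_mx_0. Qed.

Lemma spin_fdfd : spin_fd *m spin_fd = 0.
Proof. by rewrite mul_delta_mx_0. Qed.

Lemma spin_ffd : spin_f *m spin_fd + spin_fd *m spin_f = 1%:M.
Proof.
rewrite !mul_delta_mx; apply/matrixP => i j; rewrite !mxE.
by case: i j => [[|[|//]] ?] [[|[|//]] ?]; rewrite /= ?addr0 ?add0r.
Qed.

Let sqi : 'i%C * 'i%C = -1 :> C.
Proof. by rewrite -expr2 sqr_i. Qed.

Lemma spin_rel t u : clifford_rel t u ->
  aeval (@scalar_mx C 2) spin_e t = aeval (@scalar_mx C 2) spin_e u.
Proof.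
case=> j k /=.
have e00 : (spin_f + spin_fd) * (spin_f + spin_fd) = 1%:M.
  by rewrite -mulmxE mulmxDl !mulmxDr spin_ff spin_fdfd add0r addr0 spin_ffd.
have e11 : ('i%C *: (spin_f - spin_fd)) * ('i%C *: (spin_f - spin_fd)) = 1%:M.
  rewrite -mulmxE -scalemxAl -scalemxAr scalerA sqi mulmxDl !mulmxDr.
  rewrite !mulmxN !mulNmx spin_ff spin_fdfd ?(add0r, addr0, oppr0) -opprD.
  by rewrite spin_ffd scaleN1r opprK.
have e01 : (spin_f + spin_fd) * ('i%C *: (spin_f - spin_fd))
    + 'i%C *: (spin_f - spin_fd) * (spin_f + spin_fd) = 0.
  rewrite -!mulmxE -scalemxAr -scalemxAl -scalerDr.
  rewrite !mulmxDl !mulmxDr !mulmxN !mulNmx spin_ff spin_fdfd.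
  rewrite ?(add0r, addr0, oppr0).
  by rewrite addrACA addNr addrN addr0 scaler0.
have o2 (l : 'I_2) : l = 0 \/ l = 1.
  by case: l => [[|[|//]] ?]; [left|right]; apply: val_inj.
case: (o2 j) => ->; case: (o2 k) => ->; rewrite /spin_e /=.
- by rewrite e00 mulr1 -raddfD.
- by rewrite e01 mulr0 raddf0.
- by rewrite addrC e01 mulr0 raddf0.
- by rewrite e11 mulr1 -raddfD.
Qed.

Lemma scalar_mx_comm (k : C) (A : 'M[C]_2) : k%:M * A = A * k%:M.
Proof. by rewrite -!mulmxE scalar_mxC. Qed.

Definition spin_rep : clifford -> 'M[C]_2 :=
  @palg_lift C 'I_2 clifford_rel 'M[C]_2 (@scalar_mx C 2) spin_e.

Definition spinor : Type := 'cV[C]_2.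
HB.instance Definition _ := GRing.Zmodule.on spinor.

Let spin_act (a : clifford) (s : spinor) : spinor := spin_rep a *m s.

Let spin_actA a b s : spin_act a (spin_act b s) = spin_act (a * b) s.
Proof.
rewrite /spin_act mulmxA; congr (_ *m _).
by rewrite /spin_rep palg_liftM //; [exact: scalar_mx_comm | exact: spin_rel].
Qed.
Let spin_act1 : left_id 1 spin_act.
Proof.
move=> s; rewrite /spin_act /spin_rep palg_lift1 ?mul1mx //.
- exact: scalar_mx_comm.
- exact: spin_rel.
Qed.
Let spin_actDr : right_distributive spin_act +%R.
Proof. by move=> a s t; rewrite /spin_act mulmxDr. Qed.
Let spin_actDl s : {morph spin_act^~ s : a b / a + b}.
Proof.
move=> a b; rewrite /spin_act /spin_rep palg_liftD ?mulmxDl //.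
- exact: scalar_mx_comm.
- exact: spin_rel.
Qed.

HB.instance Definition _ := GRing.Zmodule_isLmodule.Build clifford spinor
  spin_actA spin_act1 spin_actDr spin_actDl.

(* The basis: 1 in S^0 and f^dagger in S^1. *)
Definition spin_basis (l : bool) : spinor := delta_mx (inord l) 0.

Lemma spin_repD : {morph spin_rep : a b / a + b}.
Proof.
by move=> a b; rewrite /spin_rep palg_liftD //;
  [exact: scalar_mx_comm | exact: spin_rel].
Qed.

Lemma spin_repZ k a : spin_rep (k *: a) = k *: spin_rep a.
Proof.
rewrite palg_scaleE /spin_rep palg_liftM ?palg_lift_cst //;
  try exact: scalar_mx_comm; try exact: spin_rel.
by rewrite -mulmxE mul_scalar_mx.
Qed.

Lemma spin_rep_e j : spin_rep (cl_e j) = spin_e j.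
Proof.
by rewrite /spin_rep palg_lift_gen //;
  [exact: scalar_mx_comm | exact: spin_rel].
Qed.

Let spin_e0 : spin_e 0 = spin_f + spin_fd. Proof. by []. Qed.
Let spin_e1 : spin_e 1 = 'i%C *: (spin_f - spin_fd). Proof. by []. Qed.

Lemma cl_fE (s : spinor) : cl_f *: s = spin_f *m s.
Proof.
rewrite -[LHS]/(spin_rep cl_f *m s) /cl_f -scaleNr.
rewrite !(spin_repZ, spin_repD, spin_rep_e) spin_e0 spin_e1.
rewrite (scalerA (- _)) mulNr sqi opprK.
rewrite scale1r addrACA subrr addr0 -mulr2n -[spin_f *+ 2]scaler_nat scalerA.
by rewrite mulVf ?scale1r // pnatr_eq0.
Qed.

Lemma cl_fdE (s : spinor) : cl_fd *: s = spin_fd *m s.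
Proof.
rewrite -[LHS]/(spin_rep cl_fd *m s) /cl_fd.
rewrite !(spin_repZ, spin_repD, spin_rep_e) spin_e0 spin_e1.
rewrite scalerA sqi scaleN1r.
rewrite opprB [spin_f + _]addrC addrACA subrr addr0.
by rewrite -mulr2n -[spin_fd *+ 2]scaler_nat scalerA mulVf ?scale1r // pnatr_eq0.
Qed.
End Clifford.

Section TensorAlgebra.
Variables (K : comPzRingType) (X Y : Type).
Variables (r : aterm K X -> aterm K X -> Prop).
Variables (s : aterm K Y -> aterm K Y -> Prop).
Local Notation A := (palg r).
Local Notation B := (palg s).
Local Notation l_ a := (AVar (inl a)).
Local Notation r_ b := (AVar (inr b)).

(* A (x) B is generated by two commuting homomorphic images of A and of B. *)
Inductive tensor_rel : aterm K (A + B) -> aterm K (A + B) -> Prop :=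
| TrLlin (k : K) (a a' : A) :
    tensor_rel (l_ (k *: a + a')) (ACst k * l_ a + l_ a')
| TrL1 : tensor_rel (l_ 1) (ACst 1)
| TrLM (a a' : A) : tensor_rel (l_ (a * a')) (l_ a * l_ a')
| TrRlin (k : K) (b b' : B) :
    tensor_rel (r_ (k *: b + b')) (ACst k * r_ b + r_ b')
| TrR1 : tensor_rel (r_ 1) (ACst 1)
| TrRM (b b' : B) : tensor_rel (r_ (b * b')) (r_ b * r_ b')
| TrLR (a : A) (b : B) : tensor_rel (l_ a * r_ b) (r_ b * l_ a).

Definition tensor_alg := palg tensor_rel.

HB.instance Definition _ := GRing.PzRing.on tensor_alg.
HB.instance Definition _ := GRing.Lmodule.on tensor_alg.

Definition tensl (a : A) : tensor_alg := palg_gen tensor_rel (inl a).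
Definition tensr (b : B) : tensor_alg := palg_gen tensor_rel (inr b).
End TensorAlgebra.

Arguments tensor_rel {K X Y} r s.
Arguments tensor_alg {K X Y} r s.
Arguments tensl {K X Y} r s.
Arguments tensr {K X Y} r s.

(* Every set B used below contains the scalars, so that these are linear
   subspaces. *)
Definition stable_subspace (A : pzRingType) (M : lmodType A) (B : set A)
    (N : set M) : Prop :=
  [/\ N 0, forall u v, N u -> N v -> N (u + v)
    & forall b u, B b -> N u -> N (b *: u)].

Definition irreducible_under (A : pzRingType) (M : lmodType A) (B : set A)
    (W : set M) : Prop :=
  [/\ stable_subspace B W, exists2 w, W w & w <> 0
    & forall N : set M, stable_subspace B N -> N `<=` W ->
        N = [set 0] \/ N = W].

Definition lspan (K : pzRingType) (V : lmodType K) (s : seq V) : set V :=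
  [set v | exists k : nat -> K, v = \sum_(i < size s) k i *: s`_i].

Section StandardModule.
Variables (R : realType) (m : nat).
Local Notation C := R[i].
Local Notation G := (dihedral m).
Variables (c : G -> C) (d : nat).
Variable tau : mx_representation C [set: G]%G d.
Local Notation Hc := (cherednik c).

(* V(tau) is the space of row vectors, on which [tau] acts from the right; the
   inverse turns this into a left action. *)
Definition rep_act (g : G) (v : 'rV[C]_d) : 'rV[C]_d := v *m tau g^-1%g.

(* N is the scalar N_c(tau) by which sigma acts on V(tau). *)
Definition sigma_scalar (N : C) : Prop :=
  forall v : 'rV[C]_d,
    \sum_(1 <= j < m.+1) c (refl m j) *: rep_act (refl m j) v = N *: v.

(* H_c (x)_{S(E) x| G} V(tau), where E acts by zero on V(tau). *)
Inductive standard_rel : mterm Hc 'rV[C]_d -> mterm Hc 'rV[C]_d -> Prop :=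
| SrV (k : C) (v w : 'rV[C]_d) :
    standard_rel (MVar (k *: v + w)) (palg_cst (cherednik_rel c) k *: MVar v + MVar w)
| SrG (g : G) (v : 'rV[C]_d) :
    standard_rel (hG c g *: MVar v) (MVar (rep_act g v))
| SrE (u : 'cV[C]_2) (v : 'rV[C]_d) :
    standard_rel (hE c u *: MVar v) MZero.

Definition stdmod := pmod standard_rel.

HB.instance Definition _ := GRing.Lmodule.on stdmod.

Definition std_gen (v : 'rV[C]_d) : stdmod := pmod_gen standard_rel v.

(* Elements of polynomial degree k in C[E] (x) V(tau). *)
Fixpoint std_deg (k : nat) : set stdmod :=
  match k with
  | 0 => [set p | exists v, p = std_gen v]
  | k'.+1 => [set p | exists p1 p2, [/\ std_deg k' p1, std_deg k' p2
               & p = h_x c *: p1 + h_y c *: p2]]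
  end.

Definition cherednik_star (star : Hc -> Hc) : Prop :=
  [/\ forall (k : C) h h', star (k *: h + h') = k^*%C *: star h + star h',
      forall h h', star (h * h') = star h' * star h,
      involutive star,
      [/\ star (h_xi c) = h_x c, star (h_x c) = h_xi c,
          star (h_eta c) = h_y c & star (h_y c) = h_eta c]
    & forall j : nat, star (hG c (refl m j)) = hG c (refl m j)].

Definition unitarisable : Prop :=
  exists star, cherednik_star star /\
  exists beta : stdmod -> stdmod -> C,
  [/\ forall (k : C) p p' q,
        beta (palg_cst (cherednik_rel c) k *: p + p') q = k * beta p q + beta p' q,
      forall p q, beta q p = (beta p q)^*%C,
      forall h p q, beta (h *: p) q = beta p (star h *: q),
      (forall g v w, beta (std_gen (rep_act g v)) (std_gen (rep_act g w))
                     = beta (std_gen v) (std_gen w)) /\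
      (forall v, v != 0 -> 0 < beta (std_gen v) (std_gen v))
    & forall p, p != 0 -> 0 < beta p p].
End StandardModule.

Section U21.
Variables (R : realType) (m : nat).
Local Notation C := R[i].
Variable c : dihedral m -> C.

Definition HC := tensor_alg (cherednik_rel c) (@clifford_rel R).

HB.instance Definition _ := GRing.PzRing.on HC.
HB.instance Definition _ := GRing.Lmodule.on HC.

Definition HCcst (k : C) : HC :=
  palg_cst (tensor_rel (cherednik_rel c) (@clifford_rel R)) k.

Local Notation inH h := (tensl (cherednik_rel c) (@clifford_rel R) h : HC).
Local Notation inC a := (tensr (cherednik_rel c) (@clifford_rel R) a : HC).
Local Notation z := (h_z c).
Local Notation zb := (h_zb c).
Local Notation zeta := (h_zeta c).
Local Notation zetab := (h_zetab c).
Local Notation sigma := (h_sigma c).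
Local Notation f := (cl_f R).
Local Notation fd := (cl_fd R).

Definition u_Ep : HC := inH (2%:R^-1 *: (z * zb)).
Definition u_Em : HC := inH (- 2%:R *: (zeta * zetab)).
Definition u_H : HC := inH (z * zeta + zb * zetab + 1 - sigma).
Definition u_Z2 : HC := inC (fd * f - 2%:R^-1 *: (1 : clifford R)).
Definition u_Z1 : HC :=
  inH (zb * zetab - z * zeta) + 2%:R *: (inH sigma * u_Z2).

Definition u_Fp : HC := inH zb * inC fd.
Definition u_Fbp : HC := inH z * inC f.
Definition u_Fm : HC := inH (2%:R *: zeta) * inC fd.
Definition u_Fbm : HC := inH (2%:R *: zetab) * inC f.

(* Even part: false; odd part: true. *)
Definition u21_part (p : bool) : set HC :=
  if p then lspan [:: u_Fp; u_Fbp; u_Fm; u_Fbm]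
  else lspan [:: u_Ep; u_Em; u_H; u_Z1; u_Z2].

Definition u21 : set HC :=
  [set X | exists X0 X1, [/\ u21_part false X0, u21_part true X1 & X = X0 + X1]].

Definition sbracket (p q : bool) (X Y : HC) : HC :=
  X * Y - (-1) ^+ (p && q) * (Y * X).

(* A representation of the Lie superalgebra u(2|1); only the values of
   [rho] on [u21] are relevant. *)
Record u21_rep : Type := U21Rep {
  rep_space : lmodType C;
  rep_part : bool -> set rep_space;
  rho : HC -> rep_space -> rep_space;
  rep_part0 : forall p, rep_part p 0;
  rep_part_lin : forall p k v w,
    rep_part p v -> rep_part p w -> rep_part p (k *: v + w);
  rep_part_sum : forall w, exists w0 w1,
    [/\ rep_part false w0, rep_part true w1 & w = w0 + w1];
  rep_part_dir : forall w, rep_part false w -> rep_part true w -> w = 0;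
  rho_linr : forall X, u21 X ->
    forall k v w, rho X (k *: v + w) = k *: rho X v + rho X w;
  rho_linl : forall k X Y w, u21 X -> u21 Y ->
    rho (k *: X + Y) w = k *: rho X w + rho Y w;
  rho_part : forall p q X w,
    u21_part p X -> rep_part q w -> rep_part (p (+) q) (rho X w);
  rho_bracket : forall p q X Y w, u21_part p X -> u21_part q Y ->
    rho (sbracket p q X Y) w
    = rho X (rho Y w) - (-1) ^+ (p && q) *: rho Y (rho X w)
}.

Definition u21_subrep (L : u21_rep) (N : set (rep_space L)) : Prop :=
  [/\ N 0,
      forall k v w, N v -> N w -> N (k *: v + w),
      forall w0 w1, rep_part false w0 -> rep_part true w1 -> N (w0 + w1) ->
        N w0 /\ N w1
    & forall X w, u21 X -> N w -> N (rho X w)].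

Definition lowest_weight_vector (L : u21_rep) (lambda nu gamma : C)
    (v : rep_space L) : Prop :=
  [/\ v <> 0,
      [/\ rho u_Em v = 0, rho u_Fm v = 0 & rho u_Fbm v = 0]
    & [/\ rho u_H v = lambda *: v, rho u_Z1 v = nu *: v
        & rho u_Z2 v = gamma *: v]].

(* These properties determine L_{u(2|1)}(lambda, nu, gamma) up to isomorphism. *)
Definition is_irr_lowest_weight (lambda nu gamma : C) (L : u21_rep) : Prop :=
  (exists v, lowest_weight_vector (L := L) lambda nu gamma v) /\
  (forall N : set (rep_space L), u21_subrep N -> N = [set 0] \/ N = setT).

(* An element that commutes with Z_2 is even for the Clifford grading, so this is
   also the supercentraliser. *)
Definition u21_centraliser : set HC :=
  [set a | forall X, u21 X -> a * X = X * a].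
End U21.

Arguments u21_part {R m} c p _.
Arguments u21 {R m} c _.
Arguments u21_centraliser {R m} c _.

Section Kmodule.
Variables (R : realType) (m : nat).
Local Notation C := R[i].
Local Notation G := (dihedral m).
Variables (c : G -> C) (d : nat).
Variable tau : mx_representation C [set: G]%G d.
Local Notation M := (stdmod c tau).
Local Notation S := (spinor R).
Local Notation A := (HC c).
Local Notation inH h := (tensl (cherednik_rel c) (@clifford_rel R) h : A).
Local Notation inC a := (tensr (cherednik_rel c) (@clifford_rel R) a : A).

(* The H_c (x) Cliff-module generated by symbols p (x) s, bilinear over C, on
   which h (x) a acts as p (x) s |-> h p (x) a s; its underlying vector space is
   the tensor product. *)
Inductive kmod_rel : mterm A (M * S) -> mterm A (M * S) -> Prop :=
| KrL (k : C) (p p' : M) (s : S) :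
    kmod_rel (MVar (palg_cst (cherednik_rel c) k *: p + p', s))
             (HCcst c k *: MVar (p, s) + MVar (p', s))
| KrR (k : C) (p : M) (s s' : S) :
    kmod_rel (MVar (p, palg_cst (@clifford_rel R) k *: s + s'))
             (HCcst c k *: MVar (p, s) + MVar (p, s'))
| KrH (h : cherednik c) (p : M) (s : S) :
    kmod_rel (inH h *: MVar (p, s)) (MVar (h *: p, s))
| KrC (a : clifford R) (p : M) (s : S) :
    kmod_rel (inC a *: MVar (p, s)) (MVar (p, a *: s)).

Definition kmod := pmod kmod_rel.

HB.instance Definition _ := GRing.Lmodule.on kmod.

Definition ktens (p : M) (s : S) : kmod := pmod_gen kmod_rel (p, s).

(* M_c(tau) (x) S^l. *)
Definition kmod_part (l : bool) : set kmod :=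
  [set u | exists p, u = ktens p (spin_basis R l)].

Definition kmod_deg (l : bool) (k : nat) : set kmod :=
  [set u | exists2 p, std_deg k p & u = ktens p (spin_basis R l)].

(* The space written M_c(tau)_k^l. *)
Definition monogenics (l : bool) (k : nat) : set kmod :=
  [set u | [/\ kmod_deg l k u, u_Fm c *: u = 0 & u_Fbm c *: u = 0]].

Section Decomposition.
Variable L : bool -> nat -> u21_rep c.

(* The pure tensors of the direct sum over l and k of
   M_c(tau)_k^l (x) L l k. *)
Record dsum_gen : Type := DsumGen {
  dg_l : bool;
  dg_k : nat;
  dg_m : {u : kmod | monogenics dg_l dg_k u};
  dg_w : rep_space (L dg_l dg_k)
}.

Inductive dsum_rel : mterm C dsum_gen -> mterm C dsum_gen -> Prop :=
| DrL l k (a : C) (u v w : {u : kmod | monogenics l k u})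
      (x : rep_space (L l k)) :
    sval w = HCcst c a *: sval u + sval v ->
    dsum_rel (MVar (DsumGen w x))
             (a *: MVar (DsumGen u x) + MVar (DsumGen v x))
| DrR l k (a : C) (u : {u : kmod | monogenics l k u})
      (x y : rep_space (L l k)) :
    dsum_rel (MVar (DsumGen u (a *: x + y)))
             (a *: MVar (DsumGen u x) + MVar (DsumGen u y)).

Definition dsum := pmod dsum_rel.

HB.instance Definition _ := GRing.Lmodule.on dsum.

Definition dtens l k (u : {u : kmod | monogenics l k u})
    (x : rep_space (L l k)) : dsum := pmod_gen dsum_rel (DsumGen u x).

(* An isomorphism of representations of u(2|1), with
   M_c(tau)_k^l as the multiplicity space on which u(2|1) acts trivially,
   preserving the parities. *)
Definition u21_iso (Phi : dsum -> kmod) : Prop :=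
  [/\ forall (a : C) u v, Phi (a *: u + v) = HCcst c a *: Phi u + Phi v,
      bijective Phi,
      forall l k (u : {u : kmod | monogenics l k u}) x (X : A), u21 c X ->
        Phi (dtens u (rho X x)) = X *: Phi (dtens u x)
    & forall l k (u : {u : kmod | monogenics l k u}) x p, rep_part p x ->
        kmod_part p (Phi (dtens u x))].
End Decomposition.
End Kmodule.

Arguments monogenics {R m c d} tau l k _.

(* Main.v *)
From HB Require Import structures.
Require Import Defs.
From mathcomp Require Import all_boot all_order all_algebra all_fingroup.
From mathcomp Require Import mxrepresentation complex.
From mathcomp Require Import boolp classical_sets reals.
From mathcomp Require Import ring lra zify functions trigo.

Set Implicit Arguments.
Unset Strict Implicit.
Unset Printing Implicit Defensive.

Import Order.TTheory GRing.Theory Num.Theory.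

Local Open Scope ring_scope.
Local Open Scope complex_scope.
Local Open Scope classical_set_scope.

(** Write z_b, b : bool, for the coordinates z and zbar, t_b for the dual operators zeta
    and zetabar, E for z zbar, and M for the standard module.

    As a vector space M is C[z, zbar] (x) V(tau). To see this, the Cherednik algebra is made to
    act from the right on the linear maps from C[z, zbar] (x) V(tau) to V(tau), with the Dunkl
    operators defined by recursion on the monomials ([gen_op_rel]); the maps which read off one
    coefficient then give coordinates on M ([mcoord], [stdmod_coord]).

    For v in V(tau) the norm of z v is 2 (1 - N) times the norm of v, so that unitarity gives
    N < 1 ([unitary_N_lt1]) and the eigenvalue k + 1 - N of H on M_k is positive. On the kernel
    of t_b in M_k the operator t_(~~ b) z_(~~ b) is this eigenvalue, whence
    M_k = ker t_b + z_b M_(k-1) ([deg_decomp]). On spinors of degree l the monogenics are the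
    kernel of t_l. The u(2|1)-module generated by a monogenic p consists of the vectors
    P(E) p + Q(E) z_(~~ l) p, where the second term has the other spinor degree, and the action
    on the pairs (P, Q) does not depend on p. This is the representation [lw_rep]; it is
    irreducible because the product of the two lowering operators lowers the degree of P by
    exactly one ([lw_irr]). The resulting map [Phi] from the direct sum is surjective by
    iteration of the decomposition of M_k ([Phi_surj]), and injective because on each spinor
    component the operator z_s t_s + i H has different eigenvalues on the different summands
    ([eigenval_inj], [Phi_ker]).

    An element of the centraliser acts on M (x) S^l as some element h of the Cherednik algebra
    which commutes, on M, with E and with an angular operator L, which is Z_1 up to sign. Such
    an h commutes with all rotations ([rot_commutes]). Indeed E t_b is a combination of H and L
    with coefficients in C[z, zbar] x| G, so E^n h is a polynomial in H and L with such
    coefficients on the left; since h commutes with E it does not involve H. If it also commutes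
    with L, then its leading coefficient commutes with every rotation g, so that Ad g - 1 lowers
    the degree in L ([fil_rot]); hence Ad g is unipotent on it, and trivial because g has finite
    order. The coefficients are unique because the commutator with z^m + zbar^m lowers the degree
    by one and multiplies the leading coefficient by an injective operator ([nul_top]).

    Consequently, if the centraliser acts irreducibly on the monogenics of some degree, then the
    rotations act there by scalars, and by comparison of coordinates they act by scalars on
    V(tau). An eigenvector of one reflection then spans a subrepresentation of V(tau), which
    has to be everything ([irreducible_dim1]). *)

(** * Identities in abelian groups *)

(** Identities that hold in every abelian group are decided by comparing the integer coefficients
    of the atoms. *)
Inductive zexp := ZAtom of nat | ZAdd of zexp & zexp | ZOpp of zexp | ZZero.

Section ZmodReflection.
Variable V : zmodType.

Fixpoint zeval (env : seq V) (e : zexp) : V :=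
  match e with
  | ZAtom n => nth 0 env n
  | ZAdd a b => zeval env a + zeval env b
  | ZOpp a => - zeval env a
  | ZZero => 0
  end.

Fixpoint zcoef (n : nat) (e : zexp) : int :=
  match e with
  | ZAtom k => (k == n)%:Z
  | ZAdd a b => zcoef n a + zcoef n b
  | ZOpp a => - zcoef n a
  | ZZero => 0
  end.

Fixpoint zbound (e : zexp) : nat :=
  match e with
  | ZAtom k => k.+1
  | ZAdd a b => maxn (zbound a) (zbound b)
  | ZOpp a => zbound a
  | ZZero => 0
  end.

Lemma zeval_coef env e B : (zbound e <= B)%N ->
  zeval env e = \sum_(n < B) nth 0 env n *~ zcoef n e.
Proof.
elim: e => [k|a IHa b IHb|a IHa|] /= hB.
- rewrite (bigD1 (Ordinal hB)) //= eqxx mulr1z big1 ?addr0 // => i.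
  by rewrite -val_eqE eq_sym /= => /negPf ->; rewrite mulr0z.
- move: hB; rewrite geq_max => /andP[ha hb].
  by rewrite (IHa ha) (IHb hb) -big_split; apply: eq_bigr => i _; rewrite mulrzDr.
- by rewrite (IHa hB) -sumrN; apply: eq_bigr => i _; rewrite mulrNz.
- by rewrite big1 // => i _; rewrite mulr0z.
Qed.

Lemma zmod_reflect env e1 e2 :
  (let B := maxn (zbound e1) (zbound e2) in
   all (fun n => zcoef n e1 == zcoef n e2) (iota 0 B)) ->
  zeval env e1 = zeval env e2.
Proof.
set B := maxn _ _ => /= /allP h.
rewrite !(@zeval_coef _ _ B) ?leq_maxl ?leq_maxr //.
apply: eq_bigr => i _; congr (_ *~ _); apply/eqP/h.
by rewrite mem_iota add0n /=.
Qed.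
End ZmodReflection.

(* Two copies of an atom may carry different but convertible structures, hence
   the comparison below the operations rather than of the whole terms. *)
Ltac zhead x := lazymatch x with ?f _ => zhead f | _ => x end.
Ltac zsame x y :=
  first [ constr_eq x y
  | lazymatch x with
    | (?a * ?b)%R => lazymatch y with (?a' * ?b')%R => zsame a a'; zsame b b' end
    | (?a *: ?b)%R => lazymatch y with (?a' *: ?b')%R => zsame a a'; zsame b b' end
    | (?a + ?b)%R => lazymatch y with (?a' + ?b')%R => zsame a a'; zsame b b' end
    | (- ?a)%R => lazymatch y with (- ?a')%R => zsame a a' end
    | (?a ^+ ?n)%R => lazymatch y with (?a' ^+ ?n')%R => zsame a a'; zsame n n' end
    | 1%R => lazymatch y with 1%R => idtac end
    | _ => let hx := zhead x in let hy := zhead y in constr_eq hx hy; unify x y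
    end ].
Ltac zlookup x env :=
  match env with
  | ?y :: _ => let _ := match goal with _ => zsame x y end in constr:(0%N)
  | _ :: ?r => let n := zlookup x r in constr:(S n)
  end.
Ltac zinsert x env :=
  match env with
  | _ => let _ := zlookup x env in env
  | _ => constr:(x :: env)
  end.
Ltac zatoms e env :=
  lazymatch e with
  | (?a + ?b)%R => let env := zatoms a env in zatoms b env
  | (- ?a)%R => zatoms a env
  | 0%R => env
  | _ => zinsert e env
  end.
Ltac zreify e env :=
  lazymatch e with
  | (?a + ?b)%R => let a' := zreify a env in let b' := zreify b env in constr:(ZAdd a' b')
  | (- ?a)%R => let a' := zreify a env in constr:(ZOpp a')
  | 0%R => constr:(ZZero)
  | _ => let n := zlookup e env in constr:(ZAtom n)
  end.
Ltac zmod_ring :=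
  lazymatch goal with
  | |- @eq ?T ?l ?r =>
    let env := zatoms l (@nil T) in
    let env := zatoms r env in
    let l' := zreify l env in
    let r' := zreify r env in
    apply: (@zmod_reflect _ env l' r'); vm_compute; reflexivity
  end.

(** * The coordinates z and zbar *)

Lemma ord2P (i : 'I_2) : i = 0 \/ i = 1.
Proof. by case: i => [[|[|//]] ?]; [left|right]; apply: val_inj. Qed.

Section Phases.
Variables (R : realType) (m : nat).
Local Notation C := R[i].
Local Notation G := (dihedral m).

(** The functionals z, for b = false, and zbar, for b = true. *)
Definition zrow (b : bool) : 'rV[C]_2 :=
  \row_j (if j == 0 then 1 else (-1) ^+ b * 'i).
Definition zcol (b : bool) : 'cV[C]_2 :=
  \col_j (2^-1 * (if j == 0 then 1 else - ((-1) ^+ b * 'i))).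
(** The root of unity in z_b g = phase b g z_(b + g.2). It is locked, as the matrix entries in
    it would otherwise be exposed by rewriting. *)
Definition phase : bool -> G -> C :=
  locked (fun b g => gmx R g 0 0 + (-1) ^+ b * 'i * gmx R g 1 0).
Lemma phaseE b g : phase b g = gmx R g 0 0 + (-1) ^+ b * 'i * gmx R g 1 0.
Proof. by rewrite /phase -lock. Qed.

Lemma iM : 'i * 'i = -1 :> C.
Proof. by rewrite -expr2 sqr_i. Qed.

Lemma pairingE (a : 'rV[C]_2) (u : 'cV[C]_2) :
  pairing a u = a 0 0 * u 0 0 + a 0 1 * u 1 0.
Proof.
by rewrite /pairing mxE !big_ord_recl big_ord0 addr0; congr (_ * _ + a _ _ * u _ _);
  apply: val_inj.
Qed.

Lemma gmx01 (g : G) : gmx R g 0 1 = - ((-1) ^+ g.2 * gmx R g 1 0).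
Proof.
rewrite mxE [in RHS]mxE /dih_mx; case: g.2; rewrite ?mulmx1.
  rewrite ![(_ *m _) _ _]mxE !big_ord_recl !big_ord0 !mxE /= !expr0 !expr1.
  by apply/eqP; rewrite eq_complex /=; apply/andP; split; apply/eqP; ring.
rewrite !mxE /=.
by apply/eqP; rewrite eq_complex /=; apply/andP; split; apply/eqP; ring.
Qed.

Lemma gmx11 (g : G) : gmx R g 1 1 = (-1) ^+ g.2 * gmx R g 0 0.
Proof.
rewrite mxE [in RHS]mxE /dih_mx; case: g.2; rewrite ?mulmx1.
  rewrite ![(_ *m _) _ _]mxE !big_ord_recl !big_ord0 !mxE /= !expr0 !expr1.
  by apply/eqP; rewrite eq_complex /=; apply/andP; split; apply/eqP; ring.
rewrite !mxE /=.
by apply/eqP; rewrite eq_complex /=; apply/andP; split; apply/eqP; ring.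
Qed.

Lemma zrow_gmx b (g : G) :
  zrow b *m gmx R g = phase b g *: zrow (b (+) g.2).
Proof.
have i2 := iM.
apply/rowP => j; rewrite mxE !big_ord_recl big_ord0 addr0 ![zrow _ _ _]mxE.
rewrite [RHS]mxE [zrow _ _ _]mxE /=.
rewrite (_ : lift ord0 ord0 = 1 :> 'I_2); last exact: val_inj.
rewrite (_ : ord0 = 0 :> 'I_2); last exact: val_inj.
rewrite phaseE; case: (ord2P j) => -> /=; first by rewrite mulr1 mul1r.
rewrite gmx01 gmx11 signr_addb mul1r; set x := _ 0 0; set y := _ 1 0.
rewrite [RHS](_ : _ = (-1) ^+ b * (-1) ^+ g.2 * 'i * x +
  (-1) ^+ g.2 * (((-1) ^+ b) ^+ 2 * ('i * 'i)) * y); last by ring.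
by rewrite sqrr_sign i2; ring.
Qed.

Lemma zrow_zcol b b' : pairing (zrow b) (zcol b') = (b == b')%:R.
Proof.
have i2 := iM; rewrite pairingE !mxE /= .
rewrite [X in _ + X](_ : _ = - (2^-1 * ((-1) ^+ b * (-1) ^+ b') * ('i * 'i))); last by ring.
rewrite i2 -signr_addb; case: b b' => [] [] /=; rewrite ?expr0 ?expr1; by field.
Qed.

Lemma zcol_complete (u : 'cV[C]_2) :
  u = \sum_b pairing (zrow b) u *: zcol b.
Proof.
have i2 := iM; apply/colP => j; rewrite big_bool !mxE !pairingE !mxE /= expr0 expr1.
case: (ord2P j) => -> /=; first by field.
rewrite [RHS](_ : _ = - ('i * 'i) * u 1 0); last by field.
by rewrite i2; ring.
Qed.

Lemma zrow_complete (a : 'rV[C]_2) :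
  a = \sum_b pairing a (zcol b) *: zrow b.
Proof.
have i2 := iM; apply/rowP => j; rewrite big_bool !mxE !pairingE !mxE /= expr0 expr1.
case: (ord2P j) => -> /=; first by field.
rewrite [RHS](_ : _ = - ('i * 'i) * a 0 1); last by field.
by rewrite i2; ring.
Qed.

Lemma gmx_zcol b (g : G) :
  gmx R g *m zcol b = phase (b (+) g.2) g *: zcol (b (+) g.2).
Proof.
rewrite [LHS]zcol_complete (bigD1 (b (+) g.2)) //= big1 ?addr0 => [|b' nb].
  rewrite /pairing mulmxA zrow_gmx -scalemxAl mxE -/(pairing _ _) zrow_zcol.
  by rewrite -addbA addbb addbF eqxx mulr1.
rewrite /pairing mulmxA zrow_gmx -scalemxAl mxE -/(pairing _ _) zrow_zcol.
case: eqP => [e|]; last by rewrite mulr0 scale0r.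
by move: nb; rewrite -e -addbA addbb addbF eqxx.
Qed.

Hypothesis m_gt0 : (0 < m)%N.

Lemma gmxM (g h : G) : gmx R (g * h)%g = gmx R g *m gmx R h.
Proof. by rewrite /gmx dih_mxM // map_mxM. Qed.

Lemma gmx1 : gmx R (1%g : G) = 1%:M.
Proof. by rewrite /gmx dih_mx1 map_mx1. Qed.

Lemma phaseM b (g h : G) : phase b (g * h)%g = phase b g * phase (b (+) g.2) h.
Proof.
have := zrow_gmx b (g * h)%g.
rewrite gmxM mulmxA zrow_gmx -scalemxAl zrow_gmx scalerA => /rowP/(_ 0).
by rewrite !mxE /= !mulr1 => ->.
Qed.

Lemma phase1 b : phase b (1%g : G) = 1.
Proof.
by have /rowP/(_ 0) := zrow_gmx b (1%g : G); rewrite gmx1 mulmx1 !mxE /= mulr1 => <-.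
Qed.

Lemma phaseV b (g : G) : phase b g * phase (b (+) g.2) g^-1%g = 1.
Proof. by rewrite -phaseM mulgV phase1. Qed.

(** From s x = x - 2 (x, alpha) alpha for the reflection s in the unit vector alpha. *)
Lemma alpha_pairing (a : 'rV[C]_2) (u : 'cV[C]_2) j :
  2 * (pairing a (alphaC R m j) * pairing (alphaC R m j)^T u) =
  pairing a u - pairing a (gmx R (refl m j) *m u).
Proof.
have -> : gmx R (refl m j) = 1%:M - 2 *: (alphaC R m j *m (alphaC R m j)^T).
  by rewrite /gmx dih_mx_refl // map_mxB map_mxZ map_mx1 map_mxM rmorph_nat map_trmx.
set al := alphaC R m j; rewrite mulmxBl mul1mx -scalemxAl.
have pB (w : 'cV[C]_2) : pairing a (u - 2 *: w) = pairing a u - 2 * pairing a w.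
  by rewrite !pairingE !mxE; ring.
rewrite pB opprB addrC subrK; congr (_ * _); rewrite [RHS]/pairing !mulmxA -mulmxA.
by rewrite [RHS]mxE big_ord1.
Qed.

Lemma refl_decomp (g : G) : g.2 -> exists j : nat, g = refl m j.
Proof.
case: g => k [] //= _; exists k; congr pair; apply: val_inj => /=.
by rewrite modn_small.
Qed.

(** The index m of the last reflection is 0 in the cyclic group. *)
Lemma big_refl (V : nmodType) (F : G -> V) :
  \sum_(1 <= j < m.+1) F (refl m j) = \sum_(g : G | g.2) F g.
Proof.
have cyc n (f : nat -> V) : (0 < n)%N -> f n = f 0%N ->
    \sum_(1 <= j < n.+1) f j = \sum_(j < n.-1.+1) f j.
  case: n => // n _ fn; rewrite big_nat_recr //= big_ord_recl -fn addrC.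
  by rewrite big_add1 big_mkord.
rewrite (cyc _ (fun j => F (refl m j))) //; last first.
  by congr (F (_, _)); apply: val_inj; rewrite /= prednK // modnn mod0n.
rewrite [RHS](eq_bigl (fun p : G => p.2 == true)); last by case=> k [].
rewrite [RHS](reindex_onto (fun k : 'I_m.-1.+1 => (k, true) : G) (fun g => g.1)) /=.
  rewrite [RHS](eq_bigl xpredT) => [|k]; last by rewrite !eqxx.
  by apply: eq_bigr => k _; congr (F (_, _)); apply: val_inj; rewrite /= modn_small.
by case=> k [].
Qed.
End Phases.

(** * Relations of the Cherednik algebra *)

Lemma palg_scaleAl (K : comPzRingType) X (r : aterm K X -> aterm K X -> Prop)
  (k : K) (a b : palg r) : (k *: a) * b = k *: (a * b).
Proof. by rewrite !palg_scaleE mulrA. Qed.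

Lemma palg_scaleAr (K : comPzRingType) X (r : aterm K X -> aterm K X -> Prop)
  (k : K) (a b : palg r) : a * (k *: b) = k *: (a * b).
Proof. by rewrite !palg_scaleE mulrA -palg_cstC mulrA. Qed.

Section Relations.
Variables (R : realType) (m : nat) (c : dihedral m -> R[i]).
Local Notation G := (dihedral m).
Local Notation Hc := (cherednik c).
Local Notation z b := (hEd c (zrow R b)).
Local Notation t b := (hE c (zcol R b)).
Local Notation sg := (h_sigma c).

(** The commutator of t_(~~ b) with z_b; see [t_z_diff]. *)
Definition sigma_tw (b : bool) : Hc :=
  \sum_(g : G | g.2) (c g * phase R b g) *: hG c g.

Lemma hE_lin k u v : hE c (k *: u + v) = k *: hE c u + hE c v.
Proof.
rewrite palg_scaleE -palg_ofM -palg_ofD.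
exact/palg_ofP/ac_rel/CrE.
Qed.

Lemma hEd_lin k u v : hEd c (k *: u + v) = k *: hEd c u + hEd c v.
Proof.
rewrite palg_scaleE -palg_ofM -palg_ofD.
exact/palg_ofP/ac_rel/CrEd.
Qed.

Lemma hE0 : hE c 0 = 0.
Proof.
have := hE_lin 1 0 0; rewrite !scale1r addr0 => e.
by apply: (addrI (hE c 0)); rewrite -e addr0.
Qed.

Lemma hEd0 : hEd c 0 = 0.
Proof.
have := hEd_lin 1 0 0; rewrite !scale1r addr0 => e.
by apply: (addrI (hEd c 0)); rewrite -e addr0.
Qed.

Lemma hEZ k u : hE c (k *: u) = k *: hE c u.
Proof. by rewrite -[k *: u]addr0 hE_lin hE0 addr0. Qed.
Lemma hEdZ k u : hEd c (k *: u) = k *: hEd c u.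
Proof. by rewrite -[k *: u]addr0 hEd_lin hEd0 addr0. Qed.
Lemma hED u v : hE c (u + v) = hE c u + hE c v.
Proof. by rewrite -[u]scale1r hE_lin !scale1r. Qed.
Lemma hEdD u v : hEd c (u + v) = hEd c u + hEd c v.
Proof. by rewrite -[u]scale1r hEd_lin !scale1r. Qed.

Lemma hG1 : hG c 1%g = 1.
Proof. by rewrite /hG /palg_gen -palg_cst1; apply/palg_ofP/ac_rel/CrG1. Qed.
Lemma hGM g h : hG c (g * h)%g = hG c g * hG c h.
Proof. by rewrite -palg_ofM; apply/palg_ofP/ac_rel/CrGM. Qed.
Lemma hGVK g : hG c g^-1%g * hG c g = 1.
Proof. by rewrite -hGM mulVg hG1. Qed.
Lemma hGKV g : hG c g * hG c g^-1%g = 1.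
Proof. by rewrite -hGM mulgV hG1. Qed.

Lemma hE_bool u : hE c u = \sum_b pairing (zrow R b) u *: t b.
Proof. by rewrite {1}[u]zcol_complete !big_bool hED !hEZ. Qed.
Lemma hEd_bool a : hEd c a = \sum_b pairing a (zcol R b) *: z b.
Proof. by rewrite {1}[a]zrow_complete !big_bool hEdD !hEdZ. Qed.

Lemma z_comm b b' : z b * z b' = z b' * z b.
Proof. by rewrite -!palg_ofM; apply/palg_ofP/ac_rel/CrEdEd. Qed.
Lemma t_comm b b' : t b * t b' = t b' * t b.
Proof. by rewrite -!palg_ofM; apply/palg_ofP/ac_rel/CrEE. Qed.

Hypothesis m_gt0 : (0 < m)%N.

Lemma h_sigmaE : sg = \sum_(g : G | g.2) c g *: hG c g.
Proof. by rewrite /h_sigma (big_refl m_gt0 (fun g => c g *: hG c g)). Qed.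

Lemma hG_z g b : hG c g * z b = phase R b g^-1%g *: (z (b (+) g.2) * hG c g).
Proof.
rewrite -palg_scaleAl -hEdZ -[g.2]/(g^-1%g.2) -zrow_gmx -!palg_ofM.
exact/palg_ofP/ac_rel/CrGEd.
Qed.

Lemma hG_t g b :
  hG c g * t b = phase R (b (+) g.2) g *: (t (b (+) g.2) * hG c g).
Proof.
rewrite -palg_scaleAl -hEZ -gmx_zcol -!palg_ofM.
exact/palg_ofP/ac_rel/CrGE.
Qed.

Lemma hE_hEd u a : hE c u * hEd c a - hEd c a * hE c u =
  pairing a u *: (1 : Hc) -
  \sum_(g : G | g.2) (c g * (pairing a u - pairing a (gmx R g *m u))) *: hG c g.
Proof.
transitivity (palg_of (cherednik_rel c) (AVar (GenE m u) * AVar (GenEd m a)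
   + ACst (-1) * (AVar (GenEd m a) * AVar (GenE m u)))%AT).
  by rewrite palg_ofD !palg_ofM -[X in _ = _ + X]palg_scaleE scaleN1r.
have /palg_ofP -> := ac_rel (CrEEd c u a).
rewrite palg_ofD palg_ofM palg_scaleE mulr1; congr (_ + _).
rewrite -[LHS]palg_scaleE.
rewrite (big_morph (palg_of (cherednik_rel c)) (@palg_ofD _ _ _) (erefl _)).
rewrite scaleNr scaler_sumr; congr (- _).
rewrite -(big_refl m_gt0 (fun g => (c g * (pairing a u - pairing a (gmx R g *m u))) *: hG c g)).
apply: eq_bigr => j _; rewrite palg_ofM -palg_scaleE scalerA; congr (_ *: _).
by rewrite -alpha_pairing //; ring.
Qed.

Lemma t_z_same b : t b * z b = z b * t b + 1 - sg.
Proof.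
rewrite -addrA; apply/eqP; rewrite addrC -subr_eq; apply/eqP.
rewrite hE_hEd zrow_zcol eqxx scale1r h_sigmaE; congr (_ - _).
apply: eq_bigr => g g2; rewrite gmx_zcol g2 /pairing -scalemxAr mxE.
by rewrite -/(pairing _ _) zrow_zcol; case: b; rewrite /= mulr0 subr0 mulr1.
Qed.

Lemma t_z_diff b : t b * z (~~ b) = z (~~ b) * t b + sigma_tw (~~ b).
Proof.
apply/eqP; rewrite addrC -subr_eq; apply/eqP.
rewrite hE_hEd zrow_zcol (_ : ~~ b == b = false); last by case: b.
rewrite scale0r sub0r -sumrN; apply: eq_bigr => g g2.
rewrite gmx_zcol g2 addbT /pairing -scalemxAr mxE -/(pairing _ _) zrow_zcol eqxx.
by rewrite -scaleNr mulr0n mulr1n mulr1 sub0r mulrN opprK.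
Qed.

Lemma sg_z b : sg * z b = z (~~ b) * sigma_tw b.
Proof.
rewrite h_sigmaE /sigma_tw mulr_suml mulr_sumr; apply: eq_bigr => g g2.
rewrite palg_scaleAl palg_scaleAr hG_z scalerA g2 addbT.
by case: g g2 => k [].
Qed.

Hypothesis c_conj : forall (j : nat) (g : G), c (refl m j ^ g)%g = c (refl m j).

Lemma hG_sg g : hG c g * sg = sg * hG c g.
Proof.
rewrite h_sigmaE mulr_suml mulr_sumr.
rewrite [RHS](reindex_inj (inj_comp (mulgI _) (mulIg _) : injective (fun x => g * (x * g^-1))%g)).
apply: eq_big => [x|x x2].
  by rewrite !dihM2; case: g x => ? [] [? []].
rewrite palg_scaleAl palg_scaleAr -!hGM !mulgA mulgKV; congr (_ *: _).
have [j ->] := refl_decomp x2.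
by rewrite -(c_conj j g^-1%g) conjgE invgK mulgA.
Qed.
End Relations.

(** * Endomorphism rings *)

Section Linop.
Variables (K : comPzRingType) (U V : lmodType K).

Definition linop (F : U -> V) := forall (k : K) f g, F (k *: f + g) = k *: F f + F g.

Lemma linopD F : linop F -> {morph F : x y / x + y}.
Proof. by move=> h f g; rewrite -[f]scale1r h !scale1r. Qed.

Lemma linop0 F : linop F -> F 0 = 0.
Proof.
move=> h; have := linopD h 0 0; rewrite addr0 => e.
by apply: (addrI (F 0)); rewrite -e addr0.
Qed.

Lemma linopZ F k f : linop F -> F (k *: f) = k *: F f.
Proof. by move=> h; rewrite -[k *: f]addr0 h (linop0 h) addr0. Qed.

Lemma linopN F f : linop F -> F (- f) = - F f.
Proof. by move=> h; rewrite -scaleN1r linopZ // scaleN1r. Qed.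

Lemma linopB F f g : linop F -> F (f - g) = F f - F g.
Proof. by move=> h; rewrite linopD // linopN. Qed.

Lemma linop_sum F I (s : seq I) (P : pred I) (f : I -> U) : linop F ->
  F (\sum_(i <- s | P i) f i) = \sum_(i <- s | P i) F (f i).
Proof. by move=> h; apply: (big_morph F (linopD h) (linop0 h)). Qed.
End Linop.

Section Endo.
Variables (K : comPzRingType) (W : lmodType K).

Record endo := Endo {
  endo_fun :> W -> W;
  endo_lin : linop endo_fun }.

HB.instance Definition _ := gen_eqMixin endo.
HB.instance Definition _ := gen_choiceMixin endo.

Lemma endoP (f g : endo) : (forall x, f x = g x) -> f = g.
Proof.
case: f g => [f hf] [g hg] /= fg.
have e : f = g by apply/funext.
by move: hf; rewrite e => hf; congr Endo; exact: Prop_irrelevance.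
Qed.

Let add_proof (f g : endo) : linop (fun x => f x + g x).
Proof. by move=> k x y; rewrite !endo_lin scalerDr addrACA. Qed.
Let opp_proof (f : endo) : linop (fun x => - f x).
Proof. by move=> k x y; rewrite endo_lin opprD scalerN. Qed.
Let zero_proof : linop (fun x : W => 0 : W).
Proof. by move=> k x y; rewrite scaler0 addr0. Qed.
Let one_proof : linop (fun x : W => x).
Proof. by []. Qed.
Let mul_proof (f g : endo) : linop (fun x => f (g x)).
Proof. by move=> k x y; rewrite !endo_lin. Qed.

Let add f g := Endo (add_proof f g).
Let opp f := Endo (opp_proof f).
Let zero := Endo zero_proof.
Let one := Endo one_proof.
Let mul f g := Endo (mul_proof f g).

Let addA : associative add.
Proof. by move=> f g h; apply: endoP => x /=; rewrite addrA. Qed.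
Let addC : commutative add.
Proof. by move=> f g; apply: endoP => x /=; rewrite addrC. Qed.
Let add0 : left_id zero add.
Proof. by move=> f; apply: endoP => x /=; rewrite add0r. Qed.
Let addN : left_inverse zero opp add.
Proof. by move=> f; apply: endoP => x /=; rewrite addNr. Qed.
Let mulA : associative mul. Proof. by move=> f g h; apply: endoP. Qed.
Let mul1 : left_id one mul. Proof. by move=> f; apply: endoP. Qed.
Let mulr1 : right_id one mul. Proof. by move=> f; apply: endoP. Qed.
Let mulDl : left_distributive mul add.
Proof. by move=> f g h; apply: endoP. Qed.
Let mulDr : right_distributive mul add.
Proof. by move=> f g h; apply: endoP => x /=; rewrite (linopD (endo_lin f)). Qed.

HB.instance Definition _ := GRing.isPzRing.Build endo
  addA addC add0 addN mulA mul1 mulr1 mulDl mulDr.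

Lemma endoD (f g : endo) x : (f + g) x = f x + g x. Proof. by []. Qed.
Lemma endoM (f g : endo) x : (f * g) x = f (g x). Proof. by []. Qed.
Let scale_proof (k : K) : linop (fun x : W => k *: x).
Proof. by move=> l x y; rewrite scalerDr !scalerA mulrC. Qed.
Definition endo_scale k : endo := Endo (scale_proof k).

Let scale_add : nmod_morphism endo_scale.
Proof.
by split=> [|a b]; apply: endoP => x /=; rewrite ?scale0r // scalerDl.
Qed.
Let scale_mul : monoid_morphism endo_scale.
Proof. by split=> [|a b]; apply: endoP => x /=; rewrite ?scale1r // scalerA. Qed.
HB.instance Definition _ := GRing.isNmodMorphism.Build K endo endo_scale scale_add.
HB.instance Definition _ := GRing.isMonoidMorphism.Build K endo endo_scale scale_mul.

(** For actions from the right. *)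
Definition endo_opscale (k : K) : endo^c := endo_scale k.
Let opscale_mul : monoid_morphism endo_opscale.
Proof. by split=> [|a b]; apply: endoP => x /=; rewrite ?scale1r // scalerA mulrC. Qed.
HB.instance Definition _ := GRing.isNmodMorphism.Build K endo^c endo_opscale scale_add.
HB.instance Definition _ := GRing.isMonoidMorphism.Build K endo^c endo_opscale opscale_mul.

Lemma endo_scale_central k (x : endo) : endo_scale k * x = x * endo_scale k.
Proof. by apply: endoP => w; rewrite !endoM /= (linopZ _ _ (endo_lin x)). Qed.
Lemma endo_opscale_central k (x : endo^c) : endo_opscale k * x = x * endo_opscale k.
Proof. by apply: endoP => w; rewrite [RHS]/= [LHS]/= (linopZ _ _ (endo_lin x)). Qed.

Lemma endo_opM (x y : endo^c) w : (x * y : endo^c) w = y (x w).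
Proof. by []. Qed.
Lemma endo_opD (x y : endo^c) w : (x + y : endo^c) w = x w + y w.
Proof. by []. Qed.
End Endo.

(** * Dunkl operators on power series *)

Lemma scaler_swap (K : comPzRingType) (V : lmodType K) (k l : K) (v : V) :
  k *: (l *: v) = l *: (k *: v).
Proof. by rewrite !scalerA mulrC. Qed.

Section Series.
Variables (C : comPzRingType) (d : nat).
(** The linear maps from C[z, zbar] (x) V to V, where V is the space of row vectors: f sends
    z^i zbar^j v to v *m sev f i j. The algebra acts on them from the right, by precomposition. *)
Record series := Series { sev : nat -> nat -> 'M[C]_d }.
HB.instance Definition _ := gen_eqMixin series.
HB.instance Definition _ := gen_choiceMixin series.

Lemma seriesP (f g : series) : (forall i j, sev f i j = sev g i j) -> f = g.
Proof.
case: f g => [f] [g] /= h; congr Series.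
by apply/funext => i; apply/funext => j.
Qed.

Let sadd f g := Series (fun i j => sev f i j + sev g i j).
Let sopp f := Series (fun i j => - sev f i j).
Let szero := Series (fun _ _ => 0).
Let sscale (k : C) f := Series (fun i j => k *: sev f i j).

Let saddA : associative sadd.
Proof. by move=> f g h; apply: seriesP => i j /=; rewrite addrA. Qed.
Let saddC : commutative sadd.
Proof. by move=> f g; apply: seriesP => i j /=; rewrite addrC. Qed.
Let sadd0 : left_id szero sadd.
Proof. by move=> f; apply: seriesP => i j /=; rewrite add0r. Qed.
Let saddN : left_inverse szero sopp sadd.
Proof. by move=> f; apply: seriesP => i j /=; rewrite addNr. Qed.
HB.instance Definition _ := GRing.isZmodule.Build series saddA saddC sadd0 saddN.

Let sscaleA a b f : sscale a (sscale b f) = sscale (a * b) f.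
Proof. by apply: seriesP => i j /=; rewrite scalerA. Qed.
Let sscale1 : left_id 1 sscale.
Proof. by move=> f; apply: seriesP => i j /=; rewrite scale1r. Qed.
Let sscaleDr : right_distributive sscale +%R.
Proof. by move=> a f g; apply: seriesP => i j /=; rewrite scalerDr. Qed.
Let sscaleDl f : {morph sscale^~ f : a b / a + b}.
Proof. by move=> a b; apply: seriesP => i j /=; rewrite scalerDl. Qed.
HB.instance Definition _ := GRing.Zmodule_isLmodule.Build C series
  sscaleA sscale1 sscaleDr sscaleDl.

Lemma seriesD (f g : series) i j : sev (f + g) i j = sev f i j + sev g i j.
Proof. by []. Qed.
Lemma seriesN (f : series) i j : sev (- f) i j = - sev f i j. Proof. by []. Qed.
Lemma seriesZ k (f : series) i j : sev (k *: f) i j = k *: sev f i j.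
Proof. by []. Qed.
Lemma series0 i j : sev 0 i j = 0. Proof. by []. Qed.
Definition seriesE := (seriesD, seriesN, seriesZ, series0).
End Series.

Section Model.
Variables (R : realType) (m : nat) (c : dihedral m -> R[i]).
Local Notation C := R[i].
Local Notation G := (dihedral m).
Variables (d : nat) (tau : mx_representation C [set: G]%G d).
Hypothesis m_gt0 : (0 < m)%N.
Hypothesis c_conj : forall (j : nat) (g : G), c (refl m j ^ g)%g = c (refl m j).

Local Notation series := (series C d).
Local Notation ph := (phase R).

Definition Zop (b : bool) (f : series) : series :=
  Series (fun i j => if b then sev f i j.+1 else sev f i.+1 j).
Definition Gop : G -> series -> series := locked (fun g f =>
  Series (fun i j => (ph false g^-1%g ^+ i * ph true g^-1%g ^+ j) *:
    (tau g^-1%g *m (if g.2 then sev f j i else sev f i j)))).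
Lemma GopE g f i j : sev (Gop g f) i j =
  (ph false g^-1%g ^+ i * ph true g^-1%g ^+ j) *:
    (tau g^-1%g *m (if g.2 then sev f j i else sev f i j)).
Proof. by rewrite /Gop -lock. Qed.

Definition Sop : series -> series :=
  locked (fun f => \sum_(g : G | g.2) c g *: Gop g f).
Lemma SopE f : Sop f = \sum_(g : G | g.2) c g *: Gop g f.
Proof. by rewrite /Sop -lock. Qed.

Definition Stw : bool -> series -> series :=
  locked (fun b f => \sum_(g : G | g.2) (c g * ph b g) *: Gop g f).
Lemma StwE b f : Stw b f = \sum_(g : G | g.2) (c g * ph b g) *: Gop g f.
Proof. by rewrite /Stw -lock. Qed.

(** Precomposition with t_false is determined on the monomials by the commutators of t_false
    with z and zbar, moving first z and then zbar to the left, and by its vanishing on V. *)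
Fixpoint T0 (j : nat) (f : series) : 'M[C]_d :=
  if j is j'.+1 then T0 j' (Zop true f) + sev (Stw true f) 0%N j' else 0.
Fixpoint T1 (i j : nat) (f : series) : 'M[C]_d :=
  if i is i'.+1 then T1 i' j (Zop false f) + sev f i' j - sev (Sop f) i' j
  else T0 j f.
Definition Tf (f : series) : series := Series (fun i j => T1 i j f).
(** The reflection which exchanges z and zbar; it carries one Dunkl operator to the other. *)
Definition s0 : G := (0, true).
Definition Top (b : bool) (f : series) : series :=
  if b then Gop s0 (Tf (Gop s0 f)) else Tf f.

Lemma Zop_lin b : linop (Zop b).
Proof. by move=> k f g; apply: seriesP => i j; case: b. Qed.

Lemma Gop_lin g : linop (Gop g).
Proof.
move=> k f h; apply: seriesP => i j; rewrite !seriesE !GopE.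
by case: g.2; rewrite !seriesE mulmxDr -scalemxAr scalerDr !scalerA mulrC.
Qed.

Lemma lincomb_lin (I : finType) (P : pred I) (a : I -> C) (F : I -> series -> series) :
  (forall i, linop (F i)) -> linop (fun f => \sum_(i | P i) a i *: F i f).
Proof.
move=> h k f g; rewrite scaler_sumr -big_split; apply: eq_bigr => i _ /=.
by rewrite h scalerDr scaler_swap.
Qed.

Lemma Sop_lin : linop Sop.
Proof. by move=> k f g; rewrite !SopE; apply: lincomb_lin; apply: Gop_lin. Qed.

Lemma Stw_lin b : linop (Stw b).
Proof. by move=> k f g; rewrite !StwE; apply: lincomb_lin; apply: Gop_lin. Qed.

Lemma T0_lin j k f g : T0 j (k *: f + g) = k *: T0 j f + T0 j g.
Proof.
elim: j f g => [|j IH] f g /=; first by rewrite scaler0 addr0.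
by rewrite Zop_lin IH Stw_lin !seriesE scalerDr addrACA.
Qed.

Lemma T1_lin i j k f g : T1 i j (k *: f + g) = k *: T1 i j f + T1 i j g.
Proof.
elim: i f g => [|i IH] f g /=; first exact: T0_lin.
rewrite Zop_lin IH Sop_lin !seriesE scalerBr !scalerDr opprD.
by rewrite [RHS]addrACA [X in _ = X + _]addrACA.
Qed.

Lemma Tf_lin : linop Tf.
Proof. by move=> k f g; apply: seriesP => i j; apply: T1_lin. Qed.

Lemma Top_lin b : linop (Top b).
Proof.
by case: b => k f g; rewrite /Top ?(Gop_lin, Tf_lin).
Qed.

Lemma Gop1 f : Gop 1%g f = f.
Proof.
apply: seriesP => i j; rewrite GopE invg1 !phase1 // !expr1n mulr1 scale1r.
by rewrite repr_mx1 mul1mx.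
Qed.

Lemma GopM g h f : Gop (g * h)%g f = Gop h (Gop g f).
Proof.
apply: seriesP => i j; rewrite !GopE.
rewrite invMg !phaseM // repr_mxM ?in_setT //.
have -> : (h^-1%g).2 = h.2 by [].
by rewrite dihM2 -mulmxA !exprMn; case: h.2; case: g.2 => /=;
 rewrite -scalemxAr scalerA; congr (_ *: _); ring.
Qed.

Lemma Zop_Gop b g f :
  Zop b (Gop g f) = ph b g^-1%g *: Gop g (Zop (b (+) g.2) f).
Proof.
apply: seriesP => i j; rewrite seriesZ /Zop GopE.
by case: b; rewrite /= GopE /=; case: g.2; rewrite scalerA exprS; congr (_ *: _); ring.
Qed.

Lemma Zop_comm b b' f : Zop b (Zop b' f) = Zop b' (Zop b f).
Proof. by apply: seriesP => i j; case: b b' => [] []. Qed.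

Lemma invg_refl (g : G) : g.2 -> g^-1%g = g.
Proof. by case: g => k []. Qed.

Lemma Zop_Sop b f : Zop b (Sop f) = Stw b (Zop (~~ b) f).
Proof.
rewrite SopE StwE (linop_sum _ _ _ (Zop_lin b)); apply: eq_bigr => g g2.
by rewrite (linopZ _ _ (Zop_lin b)) Zop_Gop g2 addbT scalerA invg_refl.
Qed.

Lemma phase_reflK b (g : G) : g.2 -> ph b g * ph (~~ b) g = 1.
Proof. by move=> g2; rewrite -(phaseV R m_gt0 b g) g2 addbT invg_refl. Qed.

Lemma Zop_Stw b f : Zop (~~ b) (Stw b f) = Sop (Zop b f).
Proof.
rewrite SopE StwE (linop_sum _ _ _ (Zop_lin _)); apply: eq_bigr => g g2.
rewrite (linopZ _ _ (Zop_lin _)) Zop_Gop g2 addbT negbK scalerA invg_refl //.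
by rewrite -mulrA phase_reflK // mulr1.
Qed.

Lemma c_conjg (x g : G) : x.2 -> c (g * x * g^-1)%g = c x.
Proof.
by move=> /(refl_decomp) [j ->]; rewrite -(c_conj j g^-1%g) conjgE invgK mulgA.
Qed.

(** Conjugation permutes the reflections. *)
Lemma sum_conj (V : nmodType) (F : G -> V) (g : G) :
  \sum_(x : G | x.2) F x = \sum_(x : G | x.2) F (g * x * g^-1)%g.
Proof.
rewrite [LHS](reindex_inj (inj_comp (mulIg g^-1%g) (mulgI g) : injective (fun x => g * x * g^-1)%g)).
by apply: eq_bigl => x; rewrite !dihM2; case: g x => ? [] [? []].
Qed.

Lemma Sop_Gop g f : Sop (Gop g f) = Gop g (Sop f).
Proof.
rewrite !SopE (linop_sum _ _ _ (Gop_lin g)) [LHS](sum_conj _ g^-1%g).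
apply: eq_bigr => x x2; rewrite (linopZ _ _ (Gop_lin g)).
rewrite -[Gop _ (Gop g f)]GopM -[Gop g (Gop _ f)]GopM (c_conjg g^-1%g x2) invgK.
by rewrite !mulgA mulgV mul1g.
Qed.

Lemma Stw_Gop b g f : Stw b (Gop g f) =
  (ph b g^-1%g * ph (~~ (b (+) g.2)) g) *: Gop g (Stw (b (+) g.2) f).
Proof.
rewrite !StwE (linop_sum _ _ _ (Gop_lin g)) scaler_sumr [LHS](sum_conj _ g^-1%g).
apply: eq_bigr => x x2; rewrite (linopZ _ _ (Gop_lin g)) scalerA.
rewrite -[Gop _ (Gop g f)]GopM -[Gop g (Gop _ f)]GopM (c_conjg g^-1%g x2) invgK.
rewrite !mulgA mulgV mul1g !phaseM //.
rewrite dihM2 x2 addbT -[g^-1%g.2]/(g.2) -addNb; congr (_ *: _).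
by case: (b) => /=; case: g.2 => /=; ring.
Qed.

Lemma phase_s0 b : ph b s0 = 1.
Proof.

have e : dih_mx R s0 = flip_mx R by rewrite /dih_mx /= mulr0 mul0r rot_mx0 mul1mx.
by rewrite phaseE /gmx e !mxE /= expr0 mulr0 addr0.
Qed.


Lemma s0K f : Gop s0 (Gop s0 f) = f.
Proof. 
have e : (s0 * s0)%g = 1%g by rewrite -[LHS]/((0 - 0, false) : G) subr0.
by rewrite -GopM e Gop1.
Qed.

Lemma s0_Zop b f : Zop b (Gop s0 f) = Gop s0 (Zop (~~ b) f).
Proof. by rewrite Zop_Gop phase_s0 scale1r addbT. Qed.

Lemma Zop_Top_same b f : Zop b (Top b f) = Top b (Zop b f) + f - Sop f.
Proof.
case: b; last by apply: seriesP => i j.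
have e g : Zop false (Tf g) = Tf (Zop false g) + g - Sop g by apply: seriesP.
rewrite /Top s0_Zop e (linopB _ _ (Gop_lin s0)) (linopD (Gop_lin s0)).
by rewrite -!Sop_Gop !s0K s0_Zop.
Qed.

(** The recursion gives the commutator with zbar on the powers of zbar only; on the other
    monomials it follows by induction on the exponent of z. *)
Lemma Zop_Top_diff b f : Zop (~~ b) (Top b f) = Top b (Zop (~~ b) f) + Stw (~~ b) f.
Proof.
have e g : Zop true (Tf g) = Tf (Zop true g) + Stw true g.
  apply: seriesP => i j; rewrite seriesD /=; elim: i g => [|i IH] g //=.
  have h1 : sev (Sop g) i j.+1 = sev (Stw true (Zop false g)) i j :=
    congr1 (fun h => sev h i j) (Zop_Sop true g).
  have h2 : sev (Stw true g) i.+1 j = sev (Sop (Zop true g)) i j :=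
    congr1 (fun h => sev h i j) (Zop_Stw true g).
  by rewrite IH (Zop_comm true) h1 h2 subrK addrAC addrK.
case: b => //; rewrite /Top /= (s0_Zop false) e (linopD (Gop_lin s0)) (s0_Zop true).
congr (_ + _).
by rewrite Stw_Gop !phase_s0 mulr1 scale1r s0K.
Qed.

Lemma Tf_Gop_rot (g : G) f : ~~ g.2 -> Tf (Gop g f) = ph false g *: Gop g (Tf f).
Proof.
move=> g2; have gz b h : Zop b (Gop g h) = ph b g^-1%g *: Gop g (Zop b h).
  by rewrite Zop_Gop (negPf g2) addbF.
have w1 : ph false g^-1%g * ph false g = 1.
  by rewrite mulrC -[RHS](phaseV R m_gt0 false g) (negPf g2).
apply: seriesP => i j; rewrite seriesZ [LHS]/=.
have s1 (h : series) i' j' : sev h i' j'.+1 = sev (Zop true h) i' j' by [].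
have s2 (h : series) i' j' : sev h i'.+1 j' = sev (Zop false h) i' j' by [].
elim: i f => [|i IH] f /=.
  elim: j f => [|j IHj] f /=.
    by rewrite GopE (negPf g2) /= mulmx0 !scaler0.
  rewrite gz (linopZ _ _ (T0_lin j : linop (T0 j))) IHj Stw_Gop (negPf g2) addbF.
  rewrite (s1 (Gop _ _)) gz (Zop_Top_diff false) (linopD (Gop_lin g)) !seriesE.
  by rewrite !scalerDr !scalerA; congr (_ *: _ + _ *: _); ring.
rewrite gz (linopZ _ _ (T1_lin i j : linop (T1 i j))) IH Sop_Gop (s2 (Gop _ _)) gz.
rewrite (Zop_Top_same false) (linopB _ _ (Gop_lin g)) (linopD (Gop_lin g)).
by rewrite !seriesE !scalerA w1 [ph false g * _]mulrC w1 !scale1r.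
Qed.

Lemma Top_s0 b f : Top b (Gop s0 f) = Gop s0 (Top (~~ b) f).
Proof. by case: b; rewrite /Top /= !s0K. Qed.

Lemma Top_Gop b g f :
  Top b (Gop g f) = ph (b (+) g.2) g *: Gop g (Top (b (+) g.2) f).
Proof.
have rot b' (h : G) f' : ~~ h.2 -> Top b' (Gop h f') = ph b' h *: Gop h (Top b' f').
  case: b' => h2; last exact: Tf_Gop_rot.
  set h' := (s0 * h * s0)%g.
  have h'2 : ~~ h'.2 by rewrite !dihM2; case: h.2 h2.
  have ss : (s0 * s0)%g = 1%g by rewrite -[LHS]/((0 - 0, false) : G) subr0.
  rewrite /Top -GopM.
  have -> : (h * s0)%g = (s0 * h')%g by rewrite /h' !mulgA ss mul1g.
  rewrite GopM Tf_Gop_rot // (linopZ _ _ (Gop_lin s0)) -!GopM; congr (_ *: _).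
    by rewrite /h' !phaseM // phase_s0 !dihM2 mul1r (negPf h2) phase_s0 mulr1.
  by congr Gop; rewrite /h' -!mulgA ss mulg1.
case g2 : g.2; last by rewrite addbF rot ?g2.
have ss : (s0 * s0)%g = 1%g by rewrite -[LHS]/((0 - 0, false) : G) subr0.
pose r := (g * s0)%g; have r2 : ~~ r.2 by rewrite /r dihM2 g2.
have -> : g = (r * s0)%g by rewrite /r -mulgA ss mulg1.
rewrite GopM Top_s0 rot // (linopZ _ _ (Gop_lin s0)) -GopM addbT; congr (_ *: _).
by rewrite phaseM // phase_s0 mulr1.
Qed.

Lemma Top_Stw b f : Top b (Stw b f) = Sop (Top (~~ b) f).
Proof.
rewrite StwE SopE (linop_sum _ _ _ (Top_lin b)); apply: eq_bigr => g g2.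
rewrite (linopZ _ _ (Top_lin b)) Top_Gop g2 addbT scalerA.
by rewrite -mulrA phase_reflK // mulr1.
Qed.

Lemma Top_Sop b f : Top b (Sop f) = Stw (~~ b) (Top (~~ b) f).
Proof.
rewrite StwE SopE (linop_sum _ _ _ (Top_lin b)); apply: eq_bigr => g g2.
by rewrite (linopZ _ _ (Top_lin b)) Top_Gop g2 addbT scalerA.
Qed.

Lemma Top0 b f : sev (Top b f) 0 0 = 0.
Proof. by case: b => //=; rewrite GopE /= mulmx0 scaler0. Qed.

(** The commutator of the two Dunkl operators commutes with the coordinates and vanishes on V. *)
Lemma Top_comm f : Top false (Top true f) = Top true (Top false f).
Proof.
have ZD b h : Zop b (Top b (Top (~~ b) h)) - Zop b (Top (~~ b) (Top b h)) =
    Top b (Top (~~ b) (Zop b h)) - Top (~~ b) (Top b (Zop b h)).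
  have e := Zop_Top_diff (~~ b); rewrite negbK in e.
  rewrite Zop_Top_same !e Zop_Top_same (linopB _ _ (Top_lin _)).
  rewrite !(linopD (Top_lin _)) Top_Stw Top_Sop negbK.
  rewrite [X in X - _ - _]addrAC -[X in X - (_ + _)]addrA subrr addr0.
  by rewrite subrK opprD addrACA subrr addr0.
apply: seriesP => i j; apply/eqP; rewrite -subr_eq0; apply/eqP.
elim: i f => [|i IH] f.
  elim: j f => [|j IH] f; first by rewrite !Top0 subr0.
  have /(congr1 (fun h => - sev h 0%N j)) := ZD true f.
  by rewrite !seriesE !opprB /= IH.
have /(congr1 (fun h => sev h i j)) := ZD false f.
by rewrite !seriesE /= IH.
Qed.
End Model.
Arguments Zop : simpl never.
Arguments Top : simpl never.

(** * The Cherednik algebra acts on the power series *)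

Section PBW.
Variables (R : realType) (m : nat) (c : dihedral m -> R[i]).
Local Notation C := R[i].
Local Notation G := (dihedral m).
Variables (d : nat) (tau : mx_representation C [set: G]%G d).
Hypothesis m_gt0 : (0 < m)%N.
Hypothesis c_conj : forall (j : nat) (g : G), c (refl m j ^ g)%g = c (refl m j).
Local Notation series := (series C d).
Local Notation Zop := (@Zop R d).
Local Notation Gop := (Gop tau).
Local Notation Top := (Top c tau).
Local Notation Sop := (Sop c tau).
Local Notation Stw := (Stw c tau).

Definition Eop (u : 'cV[C]_2) (f : series) : series :=
  \sum_b pairing (zrow R b) u *: Top b f.
Definition Dop (a : 'rV[C]_2) (f : series) : series :=
  \sum_b pairing a (zcol R b) *: Zop b f.

Lemma Eop_lin u : linop (Eop u).
Proof. by apply: lincomb_lin => b; apply: Top_lin. Qed.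
Lemma Dop_lin a : linop (Dop a).
Proof. by apply: lincomb_lin => b; apply: Zop_lin. Qed.

Definition gen_op (x : cherednik_gen R m) : (endo series)^c :=
  match x with
  | GenG g => Endo (Gop_lin tau g)
  | GenE u => Endo (Eop_lin u)
  | GenEd a => Endo (Dop_lin a)
  end.

Lemma pairing_linr (a : 'rV[C]_2) k (u v : 'cV[C]_2) :
  pairing a (k *: u + v) = k * pairing a u + pairing a v.
Proof. by rewrite !pairingE !mxE; ring. Qed.
Lemma pairing_linl k (a b : 'rV[C]_2) (u : 'cV[C]_2) :
  pairing (k *: a + b) u = k * pairing a u + pairing b u.
Proof. by rewrite !pairingE !mxE; ring. Qed.

Lemma pairingDr (a : 'rV[C]_2) (u v : 'cV[C]_2) :
  pairing a (u + v) = pairing a u + pairing a v.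
Proof. by rewrite !pairingE !mxE; ring. Qed.
Lemma pairingZr (a : 'rV[C]_2) k (u : 'cV[C]_2) :
  pairing a (k *: u) = k * pairing a u.
Proof. by rewrite !pairingE !mxE; ring. Qed.

(** By bilinearity this reduces to the coordinates z_b and their dual basis. *)
Lemma Dop_Eop a u f : Dop a (Eop u f) - Eop u (Dop a f) =
  pairing a u *: f -
  \sum_(g : G | g.2) (c g * (pairing a u - pairing a (gmx R g *m u))) *: Gop g f.
Proof.
pose p b := pairing (zrow R b) u; pose q b := pairing a (zcol R b).
have au : pairing a u = p true * q true + p false * q false.
  by rewrite {1}(zcol_complete u) !big_bool /= pairingDr !pairingZr.
have agu (g : G) : g.2 -> pairing a (gmx R g *m u) =
    p true * (phase R false g * q false) + p false * (phase R true g * q true).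
  move=> g2; rewrite {1}(zcol_complete u) !big_bool /= mulmxDr -!scalemxAr !gmx_zcol g2.
  by rewrite pairingDr !pairingZr.
have -> : \sum_(g : G | g.2) (c g * (pairing a u - pairing a (gmx R g *m u))) *: Gop g f
   = pairing a u *: Sop f - (p true * q false) *: Stw false f
     - (p false * q true) *: Stw true f.
  rewrite SopE !StwE !scaler_sumr -!sumrB; apply: eq_bigr => g g2.
  by rewrite agu // !scalerA -!scalerBl; congr (_ *: _); ring.
have -> : Dop a (Eop u f) = \sum_b' q b' *: \sum_b p b *: Zop b' (Top b f).
  apply: eq_bigr => b' _; rewrite (linop_sum _ _ _ (Zop_lin b')); congr (_ *: _).
  by apply: eq_bigr => b _; rewrite (linopZ _ _ (Zop_lin b')).
have -> : Eop u (Dop a f) = \sum_b p b *: \sum_b' q b' *: Top b (Zop b' f).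
  apply: eq_bigr => b _; rewrite (linop_sum _ _ _ (Top_lin _ _ b)); congr (_ *: _).
  by apply: eq_bigr => b' _; rewrite (linopZ _ _ (Top_lin _ _ b)).
have d1 := Zop_Top_diff tau m_gt0 c_conj true.
have d0 := Zop_Top_diff tau m_gt0 c_conj false.
rewrite !big_bool !Zop_Top_same // d1 d0.
move: (p true) (p false) (q true) (q false) au => p1 p0 q1 q0 ->.
move: (Top true (Zop true f)) (Top true (Zop false f)) (Top false (Zop true f))
  (Top false (Zop false f)) (Sop f) (Stw true f) (Stw false f) => A1 A2 A3 A4 A5 A6 A7.
rewrite /= !(scalerDr, scalerBr, scalerN, scalerDl, scalerA).
rewrite [q1 * p1]mulrC [q1 * p0]mulrC [q0 * p1]mulrC [q0 * p0]mulrC.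
zmod_ring.
Qed.

Lemma Eop_Gop u g f : Eop u (Gop g f) = Gop g (Eop (gmx R g *m u) f).
Proof.
rewrite /Eop (linop_sum _ _ _ (Gop_lin tau g)).
have e b : pairing (zrow R b) (gmx R g *m u) = phase R b g * pairing (zrow R (b (+) g.2)) u.
  by rewrite /pairing mulmxA zrow_gmx -scalemxAl mxE.
rewrite [LHS](reindex_inj (@addIb g.2)) /=; apply: eq_bigr => b _.
rewrite (linopZ _ _ (Gop_lin tau g)) Top_Gop // e -addbA addbb addbF scalerA.
by rewrite mulrC.
Qed.

Lemma Dop_Gop a g f : Dop a (Gop g f) = Gop g (Dop (a *m gmx R g^-1%g) f).
Proof.
rewrite /Dop (linop_sum _ _ _ (Gop_lin tau g)).
have e b : pairing (a *m gmx R g^-1%g) (zcol R b) =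
    phase R (b (+) g.2) g^-1%g * pairing a (zcol R (b (+) g.2)).
  by rewrite /pairing -mulmxA gmx_zcol -scalemxAr mxE.
rewrite [LHS](reindex_inj (@addIb g.2)) /=; apply: eq_bigr => b _.
rewrite (linopZ _ _ (Gop_lin tau g)) Zop_Gop // e -addbA addbb addbF scalerA.
by rewrite mulrC.
Qed.

Lemma lincomb_comm (F : bool -> series -> series) (a a' : bool -> C) f :
  (forall b, linop (F b)) -> (forall b b' h, F b (F b' h) = F b' (F b h)) ->
  \sum_b a b *: F b (\sum_b' a' b' *: F b' f) = \sum_b a' b *: F b (\sum_b' a b' *: F b' f).
Proof.
move=> lin comm; have e (x y : bool -> C) : \sum_b x b *: F b (\sum_b' y b' *: F b' f) =
    \sum_b \sum_b' (x b * y b') *: F b (F b' f).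
  apply: eq_bigr => b _; rewrite (linop_sum _ _ _ (lin b)) scaler_sumr.
  by apply: eq_bigr => b' _; rewrite (linopZ _ _ (lin b)) scalerA.
rewrite !e exchange_big; apply: eq_bigr => b _; apply: eq_bigr => b' _.
by rewrite comm mulrC.
Qed.

Lemma Eop_comm u v f : Eop u (Eop v f) = Eop v (Eop u f).
Proof.
apply: lincomb_comm => [b|b b' h]; first exact: Top_lin.
by case: b b' => [] [] //; rewrite (Top_comm tau m_gt0 c_conj).
Qed.

Lemma Dop_comm a b f : Dop a (Dop b f) = Dop b (Dop a f).
Proof. by apply: lincomb_comm => [b'|b' b'' h]; [exact: Zop_lin | exact: Zop_comm]. Qed.

Lemma gen_op_rel t u : cherednik_rel c t u ->
  aeval (@endo_opscale C series) gen_op t = aeval (@endo_opscale C series) gen_op u.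
Proof.
case=> {t u} /=.
- by apply: endoP => f /=; rewrite Gop1 // scale1r.
- by move=> g h; apply: endoP => f /=; rewrite GopM.
- move=> k u v; apply: endoP => f; rewrite endo_opD endo_opM /= (linopZ _ _ (Eop_lin u)).
  rewrite /Eop scaler_sumr -big_split.
  by apply: eq_bigr => b _ /=; rewrite pairing_linr scalerDl scalerA.
- move=> k u v; apply: endoP => f; rewrite endo_opD endo_opM /= (linopZ _ _ (Dop_lin u)).
  rewrite /Dop scaler_sumr -big_split.
  by apply: eq_bigr => b _ /=; rewrite pairing_linl scalerDl scalerA.
- by move=> g u; apply: endoP => f; rewrite !endo_opM /= Eop_Gop.
- by move=> g a; apply: endoP => f; rewrite !endo_opM /= Dop_Gop.
- by move=> u v; apply: endoP => f; rewrite !endo_opM /= Eop_comm.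
- by move=> a b; apply: endoP => f; rewrite !endo_opM /= Dop_comm.
- move=> u a; apply: endoP => f.
  rewrite (big_morph (aeval (@endo_opscale C series) gen_op) (fun _ _ => erefl) (erefl _)).
  rewrite !endo_opD !endo_opM [LHS]/= (linopZ _ _ (Dop_lin a)) (linopZ _ _ (Eop_lin u)).
  rewrite scaleN1r Dop_Eop [endo_opscale _ _ f]/=; congr (_ + _).
  rewrite (big_morph (fun x : (endo series)^c => x (endo_opscale series (-2) f))
    (id1 := 0) (op1 := +%R)) //.
  rewrite -(big_refl m_gt0 (fun g => (c g * (pairing a u - pairing a (gmx R g *m u))) *: Gop g f)).
  rewrite -sumrN; apply: eq_bigr => j _.
  rewrite -alpha_pairing // endo_opM /= !(linopZ _ _ (Gop_lin tau _)) scalerA -scaleNr.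
    by congr (_ *: _); ring.
  by rewrite /= scale0r.
Qed.

End PBW.

(** * Coordinates on the standard module *)

Section Coordinates.
Variables (R : realType) (m : nat) (c : dihedral m -> R[i]).
Local Notation C := R[i].
Local Notation G := (dihedral m).
Variables (d : nat) (tau : mx_representation C [set: G]%G d).
Hypothesis m_gt0 : (0 < m)%N.
Hypothesis c_conj : forall (j : nat) (g : G), c (refl m j ^ g)%g = c (refl m j).
Local Notation series := (series C d).
Local Notation Hc := (cherednik c).
Local Notation M := (stdmod c tau).
Local Notation V := 'rV[C]_d.
Local Notation z b := (hEd c (zrow R b)).
Local Notation kc := (palg_cst (cherednik_rel c)).

Definition hact : Hc -> (endo series)^c :=
  @palg_lift C (cherednik_gen R m) (cherednik_rel c) (endo series)^c
    (@endo_opscale C series) (gen_op c tau).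

Let hC := @endo_opscale_central C series.
Let hr := gen_op_rel tau m_gt0 c_conj.

Lemma hactD a b f : hact (a + b) f = hact a f + hact b f.
Proof. by rewrite /hact palg_liftD. Qed.
Lemma hactM a b f : hact (a * b) f = hact b (hact a f).
Proof. by rewrite /hact palg_liftM. Qed.
Lemma hact1 f : hact 1 f = f.
Proof. by rewrite /hact palg_lift1. Qed.
Lemma hact_cst k f : hact (kc k) f = k *: f.
Proof. by rewrite /hact palg_lift_cst. Qed.
Lemma hact_g g f : hact (hG c g) f = Gop tau g f.
Proof. by rewrite /hact palg_lift_gen. Qed.
Lemma hact_E u f : hact (hE c u) f = Eop c tau u f.
Proof. by rewrite /hact palg_lift_gen. Qed.
Lemma hact_z b f : hact (z b) f = Zop b f.
Proof.
rewrite /hact palg_lift_gen //= /Dop (bigD1 b) //= zrow_zcol eqxx scale1r big1 ?addr0 //.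
by move=> b' /negPf nb; rewrite zrow_zcol eq_sym nb scale0r.
Qed.

(** The value on the module element x of the linear map f. *)
Fixpoint tpair (x : mterm Hc V) (f : series) : V :=
  match x with
  | MVar v => v *m sev f 0 0
  | MZero => 0
  | MAdd x y => tpair x f + tpair y f
  | MScale h x => tpair x (hact h f)
  end.

Lemma tpair_lin x k f g : tpair x (k *: f + g) = k *: tpair x f + tpair x g.
Proof.
elim: x f g => [v|| x IHx y IHy|h x IHx] f g /=.
- by rewrite mulmxDr scalemxAr.
- by rewrite scaler0 addr0.
- by rewrite IHx IHy scalerDr addrACA.
- by rewrite (endo_lin (hact h)) IHx.
Qed.

Lemma tpairD x f g : tpair x (f + g) = tpair x f + tpair x g.
Proof. by rewrite -[f]scale1r tpair_lin !scale1r. Qed.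

Lemma tpair0 x : tpair x 0 = 0.
Proof.
have := tpairD x 0 0; rewrite addr0 => e.
by apply: (addrI (tpair x 0)); rewrite -e addr0.
Qed.

Lemma tpairZ x k f : tpair x (k *: f) = k *: tpair x f.
Proof. by rewrite -[k *: f]addr0 tpair_lin tpair0 addr0. Qed.

(** The relations of the standard module hold because the Dunkl operators produce maps which
    vanish on V, and because the group acts on such maps through the representation. *)
Lemma tpair_cong x y : mcong (standard_rel (c:=c) tau) x y -> forall f, tpair x f = tpair y f.
Proof.
elim=> {x y} //=.
- move=> x y; case=> {x y} /= [k v w|g v|u v] f.
  + by rewrite hact_cst mulmxDl -scalemxAl scalemxAr.
  + rewrite hact_g GopE /= expr0 expr0 mulr1 scale1r /rep_act mulmxA.
    by case: g.2.
  + rewrite hact_E /Eop big_bool /= !Top0 // !scaler0 addr0.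
    by rewrite mulmx0.
- by move=> x y z _ IH1 _ IH2 f; rewrite IH1.
- by move=> x x' y y' _ IH1 _ IH2 f; rewrite IH1 IH2.
- by move=> *; rewrite addrA.
- by move=> *; rewrite addrC.
- by move=> *; rewrite add0r.
- move=> x f; rewrite -tpairD.
  have -> : hact (-1) f + f = 0; last exact: tpair0.
  by rewrite -{2}(hact1 f) -hactD addNr -(palg_cst0 (cherednik_rel c)) hact_cst scale0r.
- by move=> a b x f; rewrite hactM.
- by move=> x f; rewrite hact1.
- by move=> a b x f; rewrite hactD tpairD.
Qed.

Definition mpair (p : M) (f : series) : V := tpair (pmod_repr p) f.

Lemma mpair_of x f : mpair (pmod_of (standard_rel (c:=c) tau) x) f = tpair x f.
Proof. exact/tpair_cong/mcong_repr. Qed.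

Lemma stdmod_ind (P : M -> Prop) :
  (forall x, P (pmod_of (standard_rel (c:=c) tau) x)) -> forall p, P p.
Proof. by move=> h p; rewrite -(pmod_reprK p). Qed.

Lemma mpairD p q f : mpair (p + q) f = mpair p f + mpair q f.
Proof.
by elim/stdmod_ind: p => x; elim/stdmod_ind: q => y; rewrite -pmod_ofD !mpair_of.
Qed.

Lemma mpairH h p f : mpair (h *: p) f = mpair p (hact h f).
Proof. by elim/stdmod_ind: p => x; rewrite -pmod_ofZ !mpair_of. Qed.

Lemma mpair_gen v f : mpair (std_gen c tau v) f = v *m sev f 0 0.
Proof. exact: mpair_of. Qed.

Definition delta_series i j : series :=
  Series (fun a b => if (a == i) && (b == j) then 1%:M else 0).

(** The coefficient of z^i zbar^j in p. *)
Definition mcoord i j (p : M) : V := mpair p (delta_series i j).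

Lemma mcoordD i j p q : mcoord i j (p + q) = mcoord i j p + mcoord i j q.
Proof. exact: mpairD. Qed.

Lemma mcoordZ i j k p : mcoord i j (kc k *: p) = k *: mcoord i j p.
Proof. by rewrite /mcoord mpairH hact_cst /mpair tpairZ. Qed.

Lemma mcoord0 i j : mcoord i j 0 = 0.
Proof.
by apply: (addrI (mcoord i j 0)); rewrite -mcoordD !addr0.
Qed.

Lemma mcoord_sum i j I (r : seq I) (P : pred I) (F : I -> M) :
  mcoord i j (\sum_(x <- r | P x) F x) = \sum_(x <- r | P x) mcoord i j (F x).
Proof. exact: (big_morph (mcoord i j) (mcoordD i j) (mcoord0 i j)). Qed.

Lemma mcoord_gen i j v :
  mcoord i j (std_gen c tau v) = if (i == 0%N) && (j == 0%N) then v else 0.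
Proof.
rewrite /mcoord mpair_gen /= ![0%N == _]eq_sym.
by case: ifP; rewrite ?mulmx1 ?mulmx0.
Qed.

Lemma mcoord_z b i j p : mcoord i j (z b *: p) =
  if b then (if j is j'.+1 then mcoord i j' p else 0)
  else (if i is i'.+1 then mcoord i' j p else 0).
Proof.
rewrite /mcoord mpairH hact_z; case: b.
- case: j => [|j].
    have -> : Zop true (delta_series i 0) = 0; last exact: tpair0.
    by apply: seriesP => a b /=; rewrite andbF.
  by congr mpair; apply: seriesP => a b /=.
- case: i => [|i].
    have -> : Zop false (delta_series 0 j) = 0; last exact: tpair0.
    by apply: seriesP => a b /=.
  by congr mpair; apply: seriesP => a b /=.
Qed.
End Coordinates.

(** * Monomials and degrees *)

Section Spanning.
Variables (R : realType) (m : nat) (c : dihedral m -> R[i]).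
Local Notation C := R[i].
Local Notation G := (dihedral m).
Variables (d : nat) (tau : mx_representation C [set: G]%G d).
Hypothesis m_gt0 : (0 < m)%N.
Hypothesis c_conj : forall (j : nat) (g : G), c (refl m j ^ g)%g = c (refl m j).
Local Notation Hc := (cherednik c).
Local Notation M := (stdmod c tau).
Local Notation V := 'rV[C]_d.
Local Notation z b := (hEd c (zrow R b)).
Local Notation t b := (hE c (zcol R b)).
Local Notation sg := (h_sigma c).
Local Notation kc := (palg_cst (cherednik_rel c)).
Local Notation gen := (std_gen c tau).
Local Notation deg := (std_deg (c:=c) (tau:=tau)).

Lemma scale_hc k (h : Hc) (p : M) : (k *: h) *: p = kc k *: (h *: p).
Proof. by rewrite palg_scaleE scalerA. Qed.

Lemma kcZ_comm k (h : Hc) (p : M) : h *: (kc k *: p) = kc k *: (h *: p).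
Proof. by rewrite !scalerA palg_cstC. Qed.

Lemma vgenP k v w : gen (k *: v + w) = kc k *: gen v + gen w.
Proof.
rewrite -pmod_ofZ -pmod_ofD; exact/pmod_ofP/mc_rel/SrV.
Qed.

Lemma vgen0 : gen 0 = 0.
Proof.
have := vgenP 1 0 0; rewrite !scale1r addr0 => e.
by apply: (addrI (gen 0)); rewrite -e addr0.
Qed.

Lemma vgenD v w : gen (v + w) = gen v + gen w.
Proof. by rewrite -[v]scale1r vgenP scale1r palg_cst1 scale1r. Qed.

Lemma vgenZ k v : gen (k *: v) = kc k *: gen v.
Proof. by rewrite -[k *: v]addr0 vgenP vgen0 addr0. Qed.

Lemma vgen_sum I (r : seq I) (P : pred I) (F : I -> V) :
  gen (\sum_(x <- r | P x) F x) = \sum_(x <- r | P x) gen (F x).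
Proof. exact: (big_morph gen vgenD vgen0). Qed.

Lemma hG_gen g v : hG c g *: gen v = gen (rep_act tau g v).
Proof. by rewrite -pmod_ofZ; apply/pmod_ofP/mc_rel/SrG. Qed.

Lemma hE_gen u v : hE c u *: gen v = 0.
Proof. by rewrite -pmod_ofZ -(pmod_of0 (standard_rel (c:=c) tau)); apply/pmod_ofP/mc_rel/SrE. Qed.

Inductive spanned : M -> Prop :=
| sp_gen v : spanned (gen v)
| sp_add p q : spanned p -> spanned q -> spanned (p + q)
| sp_z b p : spanned p -> spanned (z b *: p).

Lemma spanned_cst k p : spanned p -> spanned (kc k *: p).
Proof.
elim=> {p} [v|p q _ IHp _ IHq|b p _ IH].
- by rewrite -vgenZ; apply: sp_gen.
- by rewrite scalerDr; apply: sp_add.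
- by rewrite -kcZ_comm; apply: sp_z.
Qed.

Lemma spanned0 : spanned 0. Proof. by rewrite -vgen0; apply: sp_gen. Qed.

Lemma spanned_sum (I : finType) (P : pred I) (F : I -> M) :
  (forall i, P i -> spanned (F i)) -> spanned (\sum_(i | P i) F i).
Proof. by move=> h; apply: big_ind => //; [apply: spanned0 | apply: sp_add]. Qed.

Lemma spanned_g g p : spanned p -> spanned (hG c g *: p).
Proof.
elim=> {p} [v|p q _ IHp _ IHq|b p _ IH].
- by rewrite hG_gen; apply: sp_gen.
- by rewrite scalerDr; apply: sp_add.
- by rewrite scalerA hG_z // scale_hc -scalerA; apply/spanned_cst/sp_z.
Qed.

Lemma kcN1 : kc (-1) = -1.
Proof. by rewrite -[LHS]mulr1 -palg_scaleE scaleN1r. Qed.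

Lemma kcN a : kc (- a) = - kc a.
Proof. by rewrite -mulN1r palg_cstM kcN1 mulN1r. Qed.

Lemma kcB a b : kc (a - b) = kc a - kc b.
Proof. by rewrite palg_cstD kcN. Qed.

Lemma spanned_N p : spanned p -> spanned (- p).
Proof.
move=> /(spanned_cst (-1)); congr spanned.
by rewrite kcN1 scaleN1r.
Qed.

Lemma spanned_sg p : spanned p -> spanned (sg *: p).
Proof.
move=> sp; rewrite h_sigmaE // scaler_suml; apply: spanned_sum => g _.
by rewrite scale_hc; apply/spanned_cst/spanned_g.
Qed.

Lemma spanned_tw b p : spanned p -> spanned (sigma_tw c b *: p).
Proof.
move=> sp; rewrite /sigma_tw scaler_suml; apply: spanned_sum => g _.
by rewrite scale_hc; apply/spanned_cst/spanned_g.
Qed.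

Lemma spanned_t b p : spanned p -> spanned (t b *: p).
Proof.
elim=> {p} [v|p q _ IHp _ IHq|b' p sp IH].
- by rewrite hE_gen; apply: spanned0.
- by rewrite scalerDr; apply: sp_add.
have [->|/eqP nb] := eqVneq b' b.
  rewrite scalerA t_z_same // scalerBl scalerDl scale1r -scalerA.
  apply: sp_add; first by apply: sp_add => //; apply: sp_z.
  exact/spanned_N/spanned_sg.
have -> : b' = ~~ b by case: b b' nb {IH} => [] [].
rewrite scalerA t_z_diff // scalerDl -scalerA.
by apply: sp_add; [apply: sp_z | apply: spanned_tw].
Qed.

(** The span of the monomials is a submodule, as the t_b can be moved to the right, where they
    vanish on V. *)
Lemma stdmod_spanned p : spanned p.
Proof.
have spanned_h (h : Hc) q : spanned q -> spanned (h *: q).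
  rewrite -(palg_reprK h); elim: (palg_repr h) q => {h} [[g|u|a]|k|x IHx y IHy|x IHx y IHy] q sp.
  - exact: spanned_g.
  - rewrite -[palg_of _ _]/(hE c u) hE_bool scaler_suml; apply: spanned_sum => b _.
    by rewrite scale_hc; apply/spanned_cst/spanned_t.
  - rewrite -[palg_of _ _]/(hEd c a) hEd_bool scaler_suml; apply: spanned_sum => b _.
    by rewrite scale_hc; apply/spanned_cst/sp_z.
  - exact: spanned_cst.
  - by rewrite palg_ofD scalerDl; apply: sp_add; [apply: IHx | apply: IHy].
  - by rewrite palg_ofM -scalerA; apply/IHx/IHy.
elim/stdmod_ind: p => x; elim: x => [v|| x IHx y IHy|h x IHx].
- exact: sp_gen.
- exact: spanned0.
- by rewrite pmod_ofD; apply: sp_add.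
- by rewrite pmod_ofZ; apply: spanned_h.
Qed.

Definition mon (i j : nat) : Hc := z false ^+ i * z true ^+ j.

Lemma z_mon b i j : z b * mon i j = if b then mon i j.+1 else mon i.+1 j.
Proof.
case: b; last by rewrite /mon exprS mulrA.
rewrite /mon [in RHS]exprS !mulrA; congr (_ * _).
elim: i => [|i IH]; first by rewrite expr0 mulr1 mul1r.
by rewrite exprS mulrA z_comm -!mulrA IH.
Qed.

Lemma mcoord_mon i j i' j' v :
  mcoord i j (mon i' j' *: gen v) = if (i == i') && (j == j') then v else 0.
Proof.
elim: i' i => [|i' IH] i; last first.
  by rewrite -(z_mon false) -scalerA mcoord_z //; case: i => [|i].
elim: j' i j => [|j' IH] i j; last first.
  rewrite -(z_mon true) -scalerA mcoord_z //; case: j => [|j]; last exact: IH.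
  by rewrite andbF.
by rewrite /mon !expr0 mulr1 scale1r mcoord_gen.
Qed.

Lemma stdmod_sum p : exists s : seq (nat * nat * V),
  p = \sum_(x <- s) mon x.1.1 x.1.2 *: gen x.2.
Proof.
elim: (stdmod_spanned p) => {p} [v|p q _ [s ->] _ [s' ->]|b p _ [s ->]].
- by exists [:: (0%N, 0%N, v)]; rewrite big_seq1 /mon !expr0 mulr1 scale1r.
- by exists (s ++ s'); rewrite big_cat.
- exists [seq (if b then (x.1.1, x.1.2.+1) else (x.1.1.+1, x.1.2), x.2) | x <- s].
  rewrite scaler_sumr big_map; apply: eq_bigr => x _.
  by rewrite scalerA z_mon; case: b.
Qed.

Lemma deg_lin k a p q : deg k p -> deg k q -> deg k (kc a *: p + q).
Proof.
elim: k p q => [|k IH] p q /=.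
  by move=> [v ->] [w ->]; exists (a *: v + w); rewrite vgenP.
intros [p1 [p2 [h1 h2 ->]]] [q1 [q2 [h3 h4 ->]]].
exists (kc a *: p1 + q1), (kc a *: p2 + q2); split; [exact: IH | exact: IH |].
by rewrite !scalerDr !kcZ_comm addrACA.
Qed.

Lemma deg0 k : deg k 0.
Proof.
elim: k => [|k IH] /=; first by exists 0; rewrite vgen0.
by exists 0, 0; split=> //; rewrite !scaler0 addr0.
Qed.

Lemma degD k p q : deg k p -> deg k q -> deg k (p + q).
Proof. by move=> hp hq; rewrite -[p]scale1r -palg_cst1; apply: deg_lin. Qed.

Lemma degZ k a p : deg k p -> deg k (kc a *: p).
Proof. by move=> hp; rewrite -[kc a *: p]addr0; apply: deg_lin => //; apply: deg0. Qed.

Lemma deg_sum k I (r : seq I) (P : pred I) (F : I -> M) :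
  (forall i, P i -> deg k (F i)) -> deg k (\sum_(i <- r | P i) F i).
Proof. by move=> h; apply: big_ind => //; [apply: deg0 | apply: degD]. Qed.

Lemma deg_z k b p : deg k p -> deg k.+1 (z b *: p).
Proof.
move=> hp; exists p, (kc ((-1) ^+ b * 'i) *: p); split=> //; first exact: degZ.
rewrite -[kc _ *: p]/(_) !scalerA -scalerDl; congr (_ *: _).
rewrite -palg_cstC -palg_scaleE -hEdZ -hEdD; congr hEd.
apply/rowP => j; rewrite !mxE.
by case: (ord2P j) => -> /=; rewrite ?mulr1 ?mulr0 ?addr0 ?add0r.
Qed.

Lemma degS k p : deg k.+1 p ->
  exists q0 q1, [/\ deg k q0, deg k q1 & p = z false *: q0 + z true *: q1].
Proof.
intros [p1 [p2 [h1 h2 ->]]].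
rewrite /h_x /h_y ![hEd c (delta_mx _ _)]hEd_bool !big_bool /= !scalerDl !scale_hc.
move: (pairing _ _) (pairing _ _) (pairing _ _) (pairing _ _) => b b' a a'.
exists (kc a *: p1 + kc b *: p2), (kc a' *: p1 + kc b' *: p2); split.
- by apply: degD; apply: degZ.
- by apply: degD; apply: degZ.
by rewrite !scalerDr !(kcZ_comm _ (z _)); zmod_ring.
Qed.

Lemma deg_mon i j v : deg (i + j) (mon i j *: gen v).
Proof.
elim: i => [|i IH]; last by rewrite -(z_mon false) -scalerA addSn; apply: deg_z.
elim: j => [|j IH]; last by rewrite -(z_mon true) -scalerA addnS; apply: deg_z.
by exists v; rewrite /mon !expr0 mulr1 scale1r.
Qed.

Variable N : C.
Hypothesis N_tau : sigma_scalar c tau N.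

(** The Euler operator H of the Lie superalgebra. *)
Definition hH : Hc := z false * t false + z true * t true + 1 - sg.

Lemma sg_gen v : sg *: gen v = kc N *: gen v.
Proof.
rewrite -vgenZ -N_tau /h_sigma scaler_suml.
rewrite (big_morph gen vgenD vgen0); apply: eq_bigr => j _.
by rewrite scale_hc hG_gen vgenZ.
Qed.

Lemma hH_z b : hH * z b = z b * hH + z b.
Proof.
have e b' : z b' * t b' * z b = z b * (z b' * t b') + (if b == b' then z b - z b * sg else sg * z b).
  have [<-|/eqP nb] := eqVneq b b'.
    by rewrite -mulrA t_z_same // !mulrDr mulr1 mulrN addrA.
  have -> : b = ~~ b' by case: b b' nb => [] [].
  rewrite -mulrA t_z_diff // mulrDr !mulrA (z_comm c b' (~~ b')).
  by rewrite sg_z // negbK.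
rewrite /hH mulrBl !mulrDl mul1r !e mulrBr !mulrDr mulr1; case: b {e} => /=; zmod_ring.
Qed.

End Spanning.

(** * The decomposition of the homogeneous components *)

Section Structure.
Variables (R : realType) (m : nat) (c : dihedral m -> R[i]).
Local Notation C := R[i].
Local Notation G := (dihedral m).
Variables (d : nat) (tau : mx_representation C [set: G]%G d).
Hypothesis m_gt0 : (0 < m)%N.
Hypothesis c_conj : forall (j : nat) (g : G), c (refl m j ^ g)%g = c (refl m j).
Local Notation Hc := (cherednik c).
Local Notation M := (stdmod c tau).
Local Notation V := 'rV[C]_d.
Local Notation z b := (hEd c (zrow R b)).
Local Notation t b := (hE c (zcol R b)).
Local Notation sg := (h_sigma c).
Local Notation kc := (palg_cst (cherednik_rel c)).
Local Notation gen := (std_gen c tau).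
Local Notation deg := (std_deg (c:=c) (tau:=tau)).
Local Notation mon := (mon c).
Local Notation hH := (hH c).

Lemma stdmod_coord p : exists B,
  p = \sum_(i < B) \sum_(j < B) mon i j *: gen (mcoord i j p).
Proof.
have [s ps] := stdmod_sum m_gt0 p.
pose B := (\max_(x <- s) maxn x.1.1 x.1.2).+1; exists B.
have ub x : x \in s -> (x.1.1 < B)%N /\ (x.1.2 < B)%N.
  move=> xs; have : (maxn x.1.1 x.1.2 < B)%N.
    by rewrite ltnS; exact: (leq_bigmax_seq (F := fun x : nat * nat * V => maxn x.1.1 x.1.2) x xs isT).
  by rewrite gtn_max => /andP[].
have cp i j : mcoord i j p = \sum_(x <- s) if (i == x.1.1) && (j == x.1.2) then x.2 else 0.
  by rewrite [in LHS]ps mcoord_sum //; apply: eq_bigr => x _; rewrite mcoord_mon.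
rewrite [LHS]ps.
under [RHS]eq_bigr do under eq_bigr do rewrite cp vgen_sum scaler_sumr.
under [RHS]eq_bigr do rewrite exchange_big.
rewrite [RHS]exchange_big /= big_seq [RHS]big_seq; apply: eq_bigr => x xs.
have [h1 h2] := ub x xs.
rewrite (bigD1 (Ordinal h1)) //= (bigD1 (Ordinal h2)) //= !eqxx /=.
rewrite !big1 ?addr0 // => i; rewrite -val_eqE /= => /negPf ni.
  by rewrite big1 // => j _; rewrite ni vgen0 scaler0.
by rewrite ni vgen0 scaler0.
Qed.

Lemma mcoord_eq0 (p : M) : (forall i j, mcoord i j p = 0) -> p = 0.
Proof.
move=> h; have [B ->] := stdmod_coord p.
by rewrite big1 // => i _; rewrite big1 // => j _; rewrite h vgen0 scaler0.
Qed.

Lemma z_inj b (p : M) : z b *: p = 0 -> p = 0.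
Proof.
move=> zp; apply: mcoord_eq0 => i j; case: b zp => zp.
  by have := mcoord_z m_gt0 c_conj true i j.+1 p; rewrite zp mcoord0.
by have := mcoord_z m_gt0 c_conj false i.+1 j p; rewrite zp mcoord0.
Qed.

(** The product z zbar. It is locked, as rewriting would otherwise unfold it. *)
Definition hEE : Hc := locked (z false * z true).

Lemma hEE_b b : hEE = z b * z (~~ b).
Proof. by rewrite /hEE -lock; case: b => //; rewrite z_comm. Qed.

Lemma E_inj (p : M) : hEE *: p = 0 -> p = 0.
Proof. by rewrite (hEE_b false) -scalerA => /z_inj/z_inj. Qed.

Lemma E_z b : z b * hEE = hEE * z b.
Proof. by rewrite (hEE_b b) -mulrA (z_comm c (~~ b) b). Qed.

Lemma t_E b : t b * hEE = hEE * t b + z (~~ b).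
Proof.
rewrite (hEE_b b) mulrA t_z_same // !mulrBl !mulrDl mul1r -[_ * _ * z _]mulrA t_z_diff //.
by rewrite sg_z // negbK mulrDr mulrA; zmod_ring.
Qed.

Lemma phase_conj b (g : G) : phase R b g * phase R (~~ b) g = 1.
Proof.
case g2 : g.2; first by rewrite phase_reflK.
have h2 : (s0 m * g)%g.2 by rewrite dihM2 g2.
by have := phase_reflK R m_gt0 (~~ b) h2; rewrite !phaseM // !phase_s0 !mul1r !addbT negbK.
Qed.

Lemma E_g g : hG c g * hEE = hEE * hG c g.
Proof.
rewrite (hEE_b false) mulrA hG_z // palg_scaleAl -[_ * hG c g * _]mulrA hG_z //.
rewrite palg_scaleAr scalerA (phase_conj false) scale1r mulrA; congr (_ * _).
by case: g.2 => //=; rewrite z_comm.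
Qed.

Lemma hHb b : hH = z b * t b + z (~~ b) * t (~~ b) + 1 - sg.
Proof. by case: b => //; rewrite /hH [X in X + _ - _]addrC; rewrite /=; zmod_ring. Qed.

Variable N : C.
Hypothesis N_tau : sigma_scalar c tau N.

(** The eigenvalue of H in degree k. *)
Definition lam (k : nat) : C := k%:R + 1 - N.

Lemma hH_gen v : hH *: gen v = kc (1 - N) *: gen v.
Proof.
rewrite /hH scalerBl !scalerDl -!scalerA !hE_gen !scaler0 !add0r (sg_gen N_tau).
by rewrite -!vgenZ scale1r scalerBl scale1r vgenD -scaleN1r -kcN1 -vgenZ scaleN1r.
Qed.

Lemma hH_deg k p : deg k p -> hH *: p = kc (lam k) *: p.
Proof.
elim: k p => [|k IH] p.
  by move=> [v ->]; rewrite hH_gen /lam add0r.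
move=> /degS [q0 [q1 [h0 h1 ->]]].
have e b q : deg k q -> hH *: (z b *: q) = kc (lam k.+1) *: (z b *: q).
  move=> hq; rewrite scalerA hH_z // scalerDl -scalerA IH // -kcZ_comm -scalerDr.
  congr (_ *: _); rewrite -{2}[q]scale1r -palg_cst1 -scalerDl -palg_cstD.
  by congr (kc _ *: _); rewrite /lam -[in RHS]natr1; ring.
by rewrite !scalerDr !e.
Qed.

Lemma deg_g k g p : deg k p -> deg k (hG c g *: p).
Proof.
elim: k p => [|k IH] p; first by move=> [v ->]; exists (rep_act tau g v); rewrite hG_gen.
move=> /degS [q0 [q1 [h0 h1 ->]]].
rewrite scalerDr !scalerA !hG_z // !scale_hc -!scalerA.
by apply: degD; apply: degZ; apply: deg_z; apply: IH.
Qed.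

Lemma deg_tw k b p : deg k p -> deg k (sigma_tw c b *: p).
Proof.
move=> hp; rewrite /sigma_tw scaler_suml; apply: deg_sum => g _.
by rewrite scale_hc; apply/degZ/deg_g.
Qed.

(** In H = z_b t_b + t_(~~ b) z_(~~ b) the first term vanishes on the kernel of t_b. *)
Lemma lower_raise k b p : deg k p -> t b *: p = 0 ->
  t (~~ b) *: (z (~~ b) *: p) = kc (lam k) *: p.
Proof.
move=> hp tp; rewrite -(hH_deg hp) scalerA t_z_same // (hHb b).
by rewrite !scalerBl !scalerDl -[(z b * t b) *: p]scalerA tp scaler0 add0r.
Qed.

Hypothesis N_lt1 : 0 < 1 - N.

Lemma lam_gt0 k : 0 < lam k.
Proof. by rewrite /lam -addrA ltr_wpDl. Qed.

Lemma lam_neq0 k : lam k != 0.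
Proof. by rewrite gt_eqF // lam_gt0. Qed.

(** Only z_(~~ b) a with t_b a = 0 has to be decomposed. Its image w under t_b is killed by
    t_(~~ b), so t_b z_b w is lam w, and subtracting z_b w / lam gives an element of ker t_b. *)
Lemma deg_decomp k b p : deg k p ->
  exists a, [/\ deg k a, t b *: a = 0 &
    if k is k'.+1 then exists2 q, deg k' q & p = a + z b *: q else p = a].
Proof.
elim: k p => [|k IH] p.
  by move=> [v ->]; exists (gen v); split=> //; [exists v | rewrite hE_gen].
move=> /degS [q0 [q1 [h0 h1 ->]]].
have main qq q : deg k qq -> deg k q -> exists a, [/\ deg k.+1 a, t b *: a = 0 &
    exists2 q', deg k q' & z b *: qq + z (~~ b) *: q = a + z b *: q'].
  move=> hqq hq; have [a [ha ta ea]] := IH q hq.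
  pose w := sigma_tw c (~~ b) *: a.
  have hw : deg k w by apply: deg_tw.
  have ew : t b *: (z (~~ b) *: a) = w.
    by rewrite scalerA t_z_diff // scalerDl -scalerA ta scaler0 add0r.
  have tw : t (~~ b) *: w = 0.
    rewrite -ew scalerA t_comm -scalerA (lower_raise ha ta).
    by rewrite kcZ_comm ta scaler0.
  have := lower_raise hw tw; rewrite negbK => tzw.
  pose x := kc (lam k)^-1 *: w.
  exists (z (~~ b) *: a - z b *: x); split.
  - apply: degD; first exact: deg_z.
    by rewrite -scalerN; apply: deg_z; rewrite -scaleN1r -kcN1; apply/degZ/degZ.
  - rewrite scalerBr ew /x !kcZ_comm tzw scalerA -palg_cstM mulVf ?lam_neq0 //.
    by rewrite palg_cst1 scale1r subrr.
  have [r hr er] : exists2 r, deg k r & z (~~ b) *: q = z (~~ b) *: a + z b *: r.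
    case: (k) ea => [->|k' [q2 h2 ->]]; first by exists 0; [apply: deg0 | rewrite scaler0 addr0].
    exists (z (~~ b) *: q2); first exact: deg_z.
    by rewrite scalerDr !scalerA z_comm.
  exists (qq + x + r); first by apply: degD => //; apply: degD => //; apply: degZ.
  by rewrite er !scalerDr; zmod_ring.
have [a [ha ta [q hq e]]] := main (if b then q1 else q0) (if b then q0 else q1)
  ltac:(by case: (b)) ltac:(by case: (b)).
exists a; split=> //; exists q => //; rewrite -e.
by case: (b) => //; rewrite addrC.
Qed.

Hypothesis d_gt0 : (0 < d)%N.

(** The power z_(~~ b)^k v is not a multiple of z_b, hence its component in the kernel is not
    zero. *)
Lemma deg_ker_neq0 k b : exists p, [/\ deg k p, t b *: p = 0 & p <> 0].
Proof.
pose v : V := const_mx 1.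
have v0 : v <> 0.
  by move=> /rowP/(_ (Ordinal d_gt0)); rewrite !mxE => /eqP; rewrite oner_eq0.
pose i n := if b then n else 0%N; pose j n := if b then 0%N else n.
have hm : deg k (mon (i k) (j k) *: gen v).
  by have := @deg_mon R m c d tau (i k) (j k) v; rewrite /i /j; case: (b); rewrite ?addn0 ?add0n.
have [a [ha ta ea]] := deg_decomp b hm.
exists a; split=> // a0; apply: v0.
have := mcoord_mon tau m_gt0 c_conj (i k) (j k) (i k) (j k) v; rewrite !eqxx /= => <-.
case: k hm ha ea => [|k] hm ha ea; first by rewrite ea a0 mcoord0.
case: ea => q _ ->; rewrite a0 add0r mcoord_z //.
by rewrite /i /j; case: (b).
Qed.

End Structure.

(** * Unitarity *)

Section Unitary.
Variables (R : realType) (m : nat) (c : dihedral m -> R[i]).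
Local Notation C := R[i].
Local Notation G := (dihedral m).
Variables (d : nat) (tau : mx_representation C [set: G]%G d).
Hypothesis m_gt0 : (0 < m)%N.
Hypothesis c_conj : forall (j : nat) (g : G), c (refl m j ^ g)%g = c (refl m j).
Local Notation z b := (hEd c (zrow R b)).
Local Notation t b := (hE c (zcol R b)).
Local Notation kc := (palg_cst (cherednik_rel c)).
Local Notation gen := (std_gen c tau).

Lemma irr_dim_gt0 : mx_irreducible tau -> (0 < d)%N.
Proof.
case=> _ nz _; case: (posnP d) => // d0; move: nz; rewrite -mxrank_eq0.
by rewrite mxrank1 d0 eqxx.
Qed.

Lemma z_false : z false = 'i *: h_y c + h_x c.
Proof.
rewrite -hEd_lin; congr hEd; apply/rowP => j; rewrite !mxE.
by case: (ord2P j) => -> /=; rewrite ?mulr1 ?mulr0 ?expr0 ?mul1r ?addr0 ?add0r.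
Qed.

Lemma conj_i : ('i : C)^*%C = - 'i.
Proof. by apply/eqP; rewrite eq_complex /= oppr0 !eqxx. Qed.

Lemma t_false : 2 *: t false = ('i^*)%C *: h_eta c + h_xi c.
Proof.
rewrite conj_i -hEZ -hE_lin; congr hE; apply/colP => j; rewrite !mxE.
by case: (ord2P j) => -> /=; rewrite ?expr0; field.
Qed.

(** The norm of z v is 2 (1 - N) times the norm of v. *)
Lemma unitary_N_lt1 N : sigma_scalar c tau N -> (0 < d)%N -> unitarisable c tau -> 0 < 1 - N.
Proof.
move=> N_tau d_gt0 [star [[star_lin starM starK [_ starx _ stary] _]]].
case=> beta [beta_lin beta_herm beta_star [_ beta_gen] beta_pos].
pose v : 'rV[C]_d := const_mx 1.
have v0 : v != 0.
  by apply/eqP => /rowP/(_ (Ordinal d_gt0)); rewrite !mxE => /eqP; rewrite oner_eq0.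
pose p := gen v.
have zp0 : z false *: p != 0.
  apply/eqP => /(z_inj m_gt0 c_conj) p0; have := beta_gen v v0.
  rewrite -/p p0; have := beta_lin (-1) 0 0 0.
  rewrite kcN1 scaler0 addr0 mulN1r addNr => ->; by rewrite ltxx.
have betaZ k q : beta q (kc k *: p) = (k^*)%C * beta q p.
  have := beta_lin k p 0 q; rewrite !addr0 => e.
  rewrite beta_herm e.
  have -> : beta 0 q = 0.
    by have := beta_lin (-1) 0 0 q; rewrite kcN1 scaler0 addr0 mulN1r addNr.
  by rewrite addr0 [beta q p]beta_herm rmorphM.
have bp := beta_gen v v0.
have := beta_pos _ zp0; rewrite beta_star z_false star_lin starx stary -t_false -z_false.
rewrite scalerA palg_scaleAl scale_hc t_z_same // scalerBl scalerDl scale1r -[(z _ * _) *: _]scalerA.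
have -> : z false *: (t false *: p) + p - h_sigma c *: p = kc (1 - N) *: p.
  by rewrite /p hE_gen scaler0 add0r (sg_gen N_tau) kcB scalerBl palg_cst1 scale1r.
rewrite scalerA -palg_cstM betaZ pmulr_lgt0 //.
have conj_gt0 (x : C) : 0 < (x^*)%C -> 0 < x.
  by case: x => a b; rewrite !ltcE /= oppr_eq0.
by move=> /conj_gt0; rewrite pmulr_rgt0 ?ltr0n.
Qed.
End Unitary.

(** * Spinor valued polynomials *)

Section ModuleLift.
Variables (A : pzRingType) (X : Type) (r : mterm A X -> mterm A X -> Prop).
Variables (W : lmodType A) (f : X -> W).

Fixpoint meval (x : mterm A X) : W :=
  match x with
  | MVar v => f v
  | MZero => 0
  | MAdd x y => meval x + meval y
  | MScale h x => h *: meval x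
  end.

Hypothesis hr : forall x y, r x y -> meval x = meval y.

Lemma meval_cong x y : mcong r x y -> meval x = meval y.
Proof.
elim=> {x y} //=.
- by move=> x y v _ -> _ ->.
- by move=> x x' y y' _ -> _ ->.
- by move=> a x x' _ ->.
- by move=> *; rewrite addrA.
- by move=> *; rewrite addrC.
- by move=> *; rewrite add0r.
- by move=> x; rewrite scaleN1r addNr.
- by move=> *; rewrite scalerA.
- by move=> *; rewrite scale1r.
- by move=> *; rewrite scalerDr.
- by move=> *; rewrite scalerDl.
Qed.

Definition pmod_lift (p : pmod r) : W := meval (pmod_repr p).

Lemma pmod_lift_of x : pmod_lift (pmod_of r x) = meval x.
Proof. exact/meval_cong/mcong_repr. Qed.

Lemma pmod_ind (P : pmod r -> Prop) : (forall x, P (pmod_of r x)) -> forall p, P p.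
Proof. by move=> h p; rewrite -(pmod_reprK p). Qed.

Lemma pmod_liftD p q : pmod_lift (p + q) = pmod_lift p + pmod_lift q.
Proof. by elim/pmod_ind: p => x; elim/pmod_ind: q => y; rewrite -pmod_ofD !pmod_lift_of. Qed.

Lemma pmod_liftZ a p : pmod_lift (a *: p) = a *: pmod_lift p.
Proof. by elim/pmod_ind: p => x; rewrite -pmod_ofZ !pmod_lift_of. Qed.

Lemma pmod_lift_gen v : pmod_lift (pmod_gen r v) = f v.
Proof. exact: pmod_lift_of. Qed.
End ModuleLift.

(** A module over a presented algebra, viewed as a module over the base ring. *)
Section Restriction.
Variables (K : comPzRingType) (X : Type) (r : aterm K X -> aterm K X -> Prop).
Variable V : lmodType (palg r).

Definition restr : Type := V.
HB.instance Definition _ := GRing.Zmodule.on restr.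

Let scale (k : K) (v : restr) : restr := palg_cst r k *: (v : V).
Let scaleA a b v : scale a (scale b v) = scale (a * b) v.
Proof. by rewrite /scale palg_cstM; apply: scalerA. Qed.
Let scale1 : left_id 1 scale.
Proof. by move=> v; rewrite /scale palg_cst1; apply: scale1r. Qed.
Let scaleDr : right_distributive scale +%R.
Proof. by move=> a u v; apply: scalerDr. Qed.
Let scaleDl v : {morph scale^~ v : a b / a + b}.
Proof. by move=> a b; rewrite /scale palg_cstD; apply: scalerDl. Qed.
HB.instance Definition _ := GRing.Zmodule_isLmodule.Build K restr
  scaleA scale1 scaleDr scaleDl.

Lemma restr_scale (k : K) (v : restr) : k *: v = (palg_cst r k *: (v : V)) :> V.
Proof. by []. Qed.
End Restriction.

Section SpinPair.
Variables (R : realType) (m : nat) (c : dihedral m -> R[i]).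
Local Notation C := R[i].
Local Notation G := (dihedral m).
Variables (d : nat) (tau : mx_representation C [set: G]%G d).
Local Notation M := (stdmod c tau).
Local Notation S := (spinor R).
Local Notation A := (HC c).
Local Notation K := (kmod c tau).
Local Notation Hc := (cherednik c).
Local Notation kc := (palg_cst (cherednik_rel c)).
Local Notation MC := (restr (stdmod c tau)).
Local Notation P := (MC * MC)%type.

Definition pair_h (h : Hc) (w : P) : P := (h *: (w.1 : M), h *: (w.2 : M)).
Definition pair_c (a : clifford R) (w : P) : P :=
  (spin_rep a 0 0 *: w.1 + spin_rep a 0 1 *: w.2,
   spin_rep a 1 0 *: w.1 + spin_rep a 1 1 *: w.2).

Lemma pair_h_lin h : linop (pair_h h).
Proof.
by move=> k u v; congr pair; rewrite /= !restr_scale scalerDr !kcZ_comm.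
Qed.

Lemma pair_c_lin a : linop (pair_c a).
Proof.
move=> k u v; rewrite /pair_c; congr pair => /=; rewrite !scalerDr ![_ *: (k *: _)]scaler_swap;
  zmod_ring.
Qed.

Definition pair_gen (x : Hc + clifford R) : endo P :=
  match x with inl h => Endo (pair_h_lin h) | inr a => Endo (pair_c_lin a) end.

Lemma spin_repM (a b : clifford R) : spin_rep (a * b) = spin_rep a *m spin_rep b.
Proof.
by rewrite /spin_rep palg_liftM //; [exact: scalar_mx_comm | exact: spin_rel].
Qed.
Lemma spin_rep1 : spin_rep (1 : clifford R) = 1%:M.
Proof.
by rewrite /spin_rep palg_lift1 //; [exact: scalar_mx_comm | exact: spin_rel].
Qed.
Lemma spin_rep_cst k : spin_rep (palg_cst (@clifford_rel R) k) = k%:M.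
Proof.
by rewrite /spin_rep palg_lift_cst //; [exact: scalar_mx_comm | exact: spin_rel].
Qed.

Lemma mul2E n (x : 'M[C]_2) (y : 'M[C]_(2, n)) i j : (x *m y) i j = x i 0 * y 0 j + x i 1 * y 1 j.
Proof.
by rewrite mxE !big_ord_recl big_ord0 addr0; congr (_ * _ + x _ _ * y _ _); apply: val_inj.
Qed.

Lemma pair_gen_rel t u : tensor_rel (cherednik_rel c) (@clifford_rel R) t u ->
  aeval (@endo_scale C P) pair_gen t = aeval (@endo_scale C P) pair_gen u.
Proof.
case=> {t u} /= [k a a'||a a'|k b b'||b b'|a b]; apply: endoP => w.
- by rewrite endoD endoM /=; congr pair => /=; rewrite !restr_scale /= scalerDl palg_scaleE scalerA.
- by rewrite /= /pair_h !scale1r; case: w => p q; rewrite ?scale1r.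
- by rewrite endoM /= /pair_h /= !scalerA.
- rewrite endoD endoM /= /pair_c spin_repD spin_repZ; congr pair => /=;
  rewrite ![fun_of_matrix (_ + _) _ _]mxE ![fun_of_matrix (_ *: _) _ _]mxE !scalerDl !scalerDr !scalerA; zmod_ring.
- rewrite /= /pair_c spin_rep1 !mxE /=; case: w => p q /=.
  by rewrite !scale1r !scale0r addr0 add0r.
- rewrite endoM /= /pair_c spin_repM !mul2E; congr pair => /=;
  rewrite !scalerDl !scalerDr !scalerA; zmod_ring.
- rewrite !endoM /= /pair_h /pair_c; congr pair => /=;
  by rewrite scalerDr !restr_scale !kcZ_comm.
Qed.

Definition pair_rep : A -> endo P :=
  @palg_lift C _ (tensor_rel (cherednik_rel c) (@clifford_rel R)) (endo P)
    (@endo_scale C P) pair_gen.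

Let hC := @endo_scale_central C P.

(** A model of M (x) S, with one copy of M for each of the basis spinors. *)
Definition spin_pair : Type := P.
HB.instance Definition _ := GRing.Zmodule.on spin_pair.

Let act (a : A) (w : spin_pair) : spin_pair := pair_rep a w.
Let actA a b w : act a (act b w) = act (a * b) w.
Proof. by rewrite /act /pair_rep palg_liftM //; exact: pair_gen_rel. Qed.
Let act1 : left_id 1 act.
Proof. by move=> w; rewrite /act /pair_rep palg_lift1 //; exact: pair_gen_rel. Qed.
Let actDr : right_distributive act +%R.
Proof. by move=> a u v; rewrite /act; apply: (linopD (endo_lin (pair_rep a))). Qed.
Let actDl w : {morph act^~ w : a b / a + b}.
Proof. by move=> a b; rewrite /act /pair_rep palg_liftD //; exact: pair_gen_rel. Qed.
HB.instance Definition _ := GRing.Zmodule_isLmodule.Build A spin_pair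
  actA act1 actDr actDl.

Local Notation inH h := (tensl (cherednik_rel c) (@clifford_rel R) h : A).
Local Notation inC a := (tensr (cherednik_rel c) (@clifford_rel R) a : A).

Lemma spin_pair_h h (w : spin_pair) : inH h *: w = pair_h h w.
Proof.
by rewrite -[LHS]/(pair_rep _ _) /pair_rep palg_lift_gen //; exact: pair_gen_rel.
Qed.
Lemma spin_pair_c a (w : spin_pair) : inC a *: w = pair_c a w.
Proof.
by rewrite -[LHS]/(pair_rep _ _) /pair_rep palg_lift_gen //; exact: pair_gen_rel.
Qed.
Lemma spin_pair_cst k (w : spin_pair) : HCcst c k *: w = k *: (w : P).
Proof.
by rewrite -[LHS]/(pair_rep _ _) /pair_rep palg_lift_cst //; exact: pair_gen_rel.
Qed.

Definition tens_pair (x : M * S) : spin_pair :=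
  ((x.2 0 0 *: (x.1 : MC), x.2 1 0 *: (x.1 : MC)) : P).

Lemma tens_pair_rel x y : kmod_rel x y -> meval tens_pair x = meval tens_pair y.
Proof.
case=> {x y} [k p p' s|k p s s'|h p s|a p s] /=.
- rewrite spin_pair_cst; congr pair => /=; rewrite !restr_scale scalerDr kcZ_comm;
  rewrite !scalerA; congr (_ *: _ + _); exact: palg_cstC.
- rewrite spin_pair_cst -[palg_cst _ k *: s]/(spin_rep _ *m s) spin_rep_cst mul_scalar_mx.
  by congr pair => /=; rewrite !mxE scalerDl scalerA.
- by rewrite spin_pair_h; congr pair => /=; rewrite !restr_scale kcZ_comm.
- rewrite spin_pair_c -[a *: s]/(spin_rep _ *m s); congr pair => /=;
  by rewrite mul2E scalerDl !scalerA.
Qed.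

Definition kcoord : K -> spin_pair := @pmod_lift _ _ _ spin_pair tens_pair.

Lemma kcoordD u v : kcoord (u + v) = kcoord u + kcoord v.
Proof. exact/pmod_liftD/tens_pair_rel. Qed.
(** The elements p (x) 1 and p (x) f^dagger. *)
Definition ket (l : bool) (p : M) : K := ktens p (spin_basis R l).

Lemma kcoord_ket l p : kcoord (ket l p) = (if l then (0, p) else (p, 0)).
Proof.
rewrite /kcoord /ket /ktens pmod_lift_gen; last exact: tens_pair_rel.
rewrite /tens_pair /spin_basis !mxE /=.
have -> : (inord l : 'I_2) = if l then 1 else 0.
  by case: l; apply: val_inj; rewrite /= inordK.
by case: l; rewrite /= scale1r scale0r.
Qed.

Lemma ket_inj l p q : ket l p = ket l q -> p = q.
Proof. by move=> /(congr1 kcoord); rewrite !kcoord_ket; case: l => [] []. Qed.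

Lemma HCcst1 : HCcst c 1 = (1 : A).
Proof. exact: palg_cst1. Qed.

Lemma ktensDl p p' s : ktens (c := c) (tau := tau) (p + p') s = ktens p s + ktens p' s.
Proof.
have /pmod_ofP := mc_rel (KrL (c:=c) (tau:=tau) 1 p p' s).
by rewrite palg_cst1 scale1r pmod_ofD pmod_ofZ HCcst1 scale1r.
Qed.

Lemma ktensDr p s s' : ktens (c := c) (tau := tau) p (s + s') = ktens p s + ktens p s'.
Proof.
have /pmod_ofP := mc_rel (KrR (c:=c) (tau:=tau) 1 p s s').
by rewrite palg_cst1 scale1r pmod_ofD pmod_ofZ HCcst1 scale1r.
Qed.

Lemma ketD l p q : ket l (p + q) = ket l p + ket l q.
Proof. exact: ktensDl. Qed.

Lemma ktens_h h p s : inH h *: ktens p s = ktens (h *: p) s :> K.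
Proof. by rewrite -pmod_ofZ; apply/pmod_ofP/mc_rel/KrH. Qed.
Lemma ktens_c a p s : inC a *: ktens p s = ktens p (a *: s) :> K.
Proof. by rewrite -pmod_ofZ; apply/pmod_ofP/mc_rel/KrC. Qed.

Lemma inHlin k h h' : inH (k *: h + h') = HCcst c k * inH h + inH h'.
Proof. by rewrite -palg_ofM -palg_ofD; apply/palg_ofP/ac_rel/TrLlin. Qed.

Lemma inH1 : inH 1 = 1.
Proof. by apply/palg_ofP/ac_rel/TrL1. Qed.
Lemma inHD h h' : inH (h + h') = inH h + inH h'.
Proof. by rewrite -{1}[h]scale1r inHlin HCcst1 mul1r. Qed.
Lemma inH0 : inH 0 = 0.
Proof. by apply: (addrI (inH 0)); rewrite -inHD !addr0. Qed.
Lemma inHN h : inH (- h) = - inH h.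
Proof. by apply: (addrI (inH h)); rewrite -inHD !subrr inH0. Qed.
Lemma inHZ k h : inH (k *: h) = HCcst c k * inH h.
Proof. by rewrite -[k *: h]addr0 inHlin inH0 addr0. Qed.

Lemma inHcst k : inH (kc k) = HCcst c k.
Proof. by rewrite -[kc k]mulr1 -palg_scaleE inHZ inH1 mulr1. Qed.

Lemma ket_cst l k p : HCcst c k *: ket l p = ket l (kc k *: p).
Proof. by rewrite -inHcst ktens_h. Qed.

Lemma ket_h l h p : inH h *: ket l p = ket l (h *: p).
Proof. exact: ktens_h. Qed.

Lemma ket0 l : ket l 0 = 0.
Proof. by apply: (addrI (ket l 0)); rewrite -ketD !addr0. Qed.
Lemma ketN l p : ket l (- p) = - ket l p.
Proof. by apply: (addrI (ket l p)); rewrite -ketD !subrr ket0. Qed.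
Lemma ket_sum l I (r : seq I) (Q : pred I) (F : I -> M) :
  ket l (\sum_(i <- r | Q i) F i) = \sum_(i <- r | Q i) ket l (F i).
Proof. exact: (big_morph (ket l) (ketD l) (ket0 l)). Qed.

Lemma ktens_cst k p s :
  ktens p (palg_cst (@clifford_rel R) k *: s) = HCcst c k *: ktens p s :> K.
Proof.
have e0 : ktens p 0 = 0 :> K by apply: (addrI (ktens p 0)); rewrite -ktensDr !addr0.
have /pmod_ofP := mc_rel (KrR (c:=c) (tau:=tau) k p s 0).
by rewrite pmod_ofD pmod_ofZ addr0 -![pmod_of _ (MVar _)]/(ktens p _) e0 addr0.
Qed.

Lemma spinor_ket p (s : S) : ktens (c := c) (tau := tau) p s =
  ket false (kc (s 0 0) *: p) + ket true (kc (s 1 0) *: p).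
Proof.
have e k x : palg_cst (@clifford_rel R) k *: (x : S) = (k *: (x : 'cV[C]_2) : S).
  by rewrite -[LHS]/(spin_rep _ *m x) spin_rep_cst mul_scalar_mx.
have {1}-> : s = palg_cst (@clifford_rel R) (s 0 0) *: spin_basis R false
            + palg_cst (@clifford_rel R) (s 1 0) *: spin_basis R true.
  rewrite !e; apply/colP => i; rewrite !mxE.
  have -> : (inord false : 'I_2) = 0 by apply: val_inj; rewrite /= inordK.
  have -> : (inord true : 'I_2) = 1 by apply: val_inj; rewrite /= inordK.
  by case: (ord2P i) => -> /=; rewrite ?mulr1 ?mulr0 ?addr0 ?add0r.
by rewrite ktensDr !ktens_cst -!ket_cst.
Qed.

Lemma ket_total (u : K) : exists p q, u = ket false p + ket true q.
Proof.
have ket_A (a : A) p q : exists p' q', a *: (ket false p + ket true q) = ket false p' + ket true q'.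
  rewrite -(palg_reprK a); elim: (palg_repr a) p q => {a} [[h|b]|k|x IHx y IHy|x IHx y IHy] p q.
  - by exists (h *: p), (h *: q); rewrite scalerDr !ket_h.
  - rewrite scalerDr !ktens_c !spinor_ket.
    set a0 := kc _ *: p; set a1 := kc _ *: p; set b0 := kc _ *: q; set b1 := kc _ *: q.
    by exists (a0 + b0), (a1 + b1); rewrite !ketD; zmod_ring.
  - by exists (kc k *: p), (kc k *: q); rewrite scalerDr !ket_cst.
  - destruct (IHx p q) as [p1 [q1 e1]], (IHy p q) as [p2 [q2 e2]].
    by exists (p1 + p2), (q1 + q2); rewrite palg_ofD scalerDl e1 e2 !ketD; zmod_ring.
  - destruct (IHy p q) as [p1 [q1 e1]], (IHx p1 q1) as [p2 [q2 e2]].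
    by exists p2, q2; rewrite palg_ofM -scalerA e1 e2.
elim/pmod_ind: u => x; elim: x => [[p s]|| x [p1 [q1 e1]] y [p2 [q2 e2]]|a x [p [q e]]].
- by exists (kc (s 0 0) *: p), (kc (s 1 0) *: p); apply: spinor_ket.
- by exists 0, 0; rewrite !ket0 addr0.
- by exists (p1 + p2), (q1 + q2); rewrite pmod_ofD e1 e2 !ketD; zmod_ring.
- by have [p' [q' e']] := ket_A a p q; exists p', q'; rewrite pmod_ofZ e e'.
Qed.

Lemma cl_f_basis l : cl_f R *: spin_basis R l = if l then spin_basis R false else 0.
Proof.
rewrite cl_fE /spin_f /spin_basis; case: l.
  have -> : (inord true : 'I_2) = 1 by apply: val_inj; rewrite /= inordK.
  have -> : (inord false : 'I_2) = 0 by apply: val_inj; rewrite /= inordK.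
  by rewrite mul_delta_mx.
have -> : (inord false : 'I_2) = 0 by apply: val_inj; rewrite /= inordK.
by rewrite mul_delta_mx_0.
Qed.

Lemma cl_fd_basis l : cl_fd R *: spin_basis R l = if l then 0 else spin_basis R true.
Proof.
rewrite cl_fdE /spin_fd /spin_basis; case: l.
  have -> : (inord true : 'I_2) = 1 by apply: val_inj; rewrite /= inordK.
  by rewrite mul_delta_mx_0.
have -> : (inord true : 'I_2) = 1 by apply: val_inj; rewrite /= inordK.
have -> : (inord false : 'I_2) = 0 by apply: val_inj; rewrite /= inordK.
by rewrite mul_delta_mx.
Qed.

Lemma ktens0 (p : M) : ktens p 0 = 0 :> K.
Proof. by apply: (addrI (ktens p 0)); rewrite -ktensDr !addr0. Qed.

Local Notation z b := (hEd c (zrow R b)).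
Local Notation t b := (hE c (zcol R b)).

Lemma h_zE : h_z c = z false.
Proof. by rewrite /h_z addrC z_false. Qed.
Lemma h_zbE : h_zb c = z true.
Proof.
rewrite /h_zb addrC -scaleNr -hEd_lin; congr hEd; apply/rowP => j; rewrite !mxE.
by case: (ord2P j) => -> /=; rewrite ?mulr1 ?mulr0 ?expr1 ?mulN1r ?addr0 ?add0r.
Qed.
Lemma h_zetaE : h_zeta c = t false.
Proof.
rewrite /h_zeta addrC -scaleNr -hE_lin -hEZ; congr hE; apply/colP => j; rewrite !mxE.
by case: (ord2P j) => -> /=; rewrite ?expr0 !(mulN1r, mulr0, mulr1, mul1r, add0r, addr0, opprK).
Qed.
Lemma h_zetabE : h_zetab c = t true.
Proof.
rewrite /h_zetab addrC -hE_lin -hEZ; congr hE; apply/colP => j; rewrite !mxE.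
by case: (ord2P j) => -> /=; rewrite ?expr1 !(mulN1r, mulr0, mulr1, mul1r, add0r, addr0, opprK).
Qed.

(** The odd generators which raise, resp. lower, the polynomial degree on the spinors of degree l. *)
Definition Fup : bool -> A := locked (fun l => if l then u_Fbp c else u_Fp c).
Definition Fdown : bool -> A := locked (fun l => if l then u_Fbm c else u_Fm c).
Lemma FupE l : Fup l = if l then u_Fbp c else u_Fp c.
Proof. by rewrite /Fup -lock. Qed.
Lemma FdownE l : Fdown l = if l then u_Fbm c else u_Fm c.
Proof. by rewrite /Fdown -lock. Qed.

Lemma Fup_ket l l' p :
  Fup l *: ket l' p = if l' == l then ket (~~ l) (z (~~ l) *: p) else 0.
Proof.
rewrite FupE; case: l; rewrite /u_Fp /u_Fbp -scalerA ktens_c ktens_h.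
  by rewrite cl_f_basis h_zE; case: l'; rewrite //= ktens0.
by rewrite cl_fd_basis h_zbE; case: l'; rewrite //= ktens0.
Qed.

Lemma Fdown_ket l l' p :
  Fdown l *: ket l' p = if l' == l then ket (~~ l) (kc 2 *: (t l *: p)) else 0.
Proof.
rewrite FdownE; case: l; rewrite /u_Fm /u_Fbm -scalerA ktens_c ktens_h.
  by rewrite cl_f_basis h_zetabE scale_hc; case: l'; rewrite //= ktens0.
by rewrite cl_fd_basis h_zetaE scale_hc; case: l'; rewrite //= ktens0.
Qed.

Lemma Z2_ket l p : u_Z2 c *: ket l p = ket l (kc (l%:R - 2^-1) *: p).
Proof.
have ktensNr s : ktens p (- s) = - ktens p s :> K.
  by apply: (addrI (ktens p s)); rewrite -ktensDr !subrr ktens0.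
rewrite /u_Z2 ktens_c scalerBl palg_scaleE mulr1 -scalerA cl_f_basis.
rewrite ktensDr ktensNr ktens_cst -/(ket l p) ket_cst kcB scalerBl ketD ketN.
congr (_ - _); case: l; first by rewrite cl_fd_basis palg_cst1 scale1r.
by rewrite scaler0 ktens0 palg_cst0 scale0r ket0.
Qed.

Hypothesis m_gt0 : (0 < m)%N.
Hypothesis c_conj : forall (j : nat) (g : G), c (refl m j ^ g)%g = c (refl m j).

Lemma H_ket l p : u_H c *: ket l p = ket l (hH c *: p).
Proof. by rewrite /u_H ket_h h_zE h_zbE h_zetaE h_zetabE. Qed.

Lemma Ep_ket l p : u_Ep c *: ket l p = ket l (kc 2^-1 *: (hEE c *: p)).
Proof. by rewrite /u_Ep ket_h h_zE h_zbE scale_hc (hEE_b c false). Qed.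

(** The angular operator as which - Z_1 acts on M (x) S^l. *)
Definition hL (l : bool) : Hc :=
  z false * t false - z true * t true + (if l then - h_sigma c else h_sigma c).

Lemma Z1_ket l p : u_Z1 c *: ket l p = ket l (- (hL l *: p)).
Proof.
rewrite /u_Z1 scalerDl ket_h h_zE h_zbE h_zetaE h_zetabE palg_scaleE -!scalerA.
rewrite Z2_ket ket_h ket_cst -ketD; congr ket.
rewrite /hL; set a := z false * _; set b := z true * _.
rewrite kcZ_comm [kc 2 *: _]scalerA -palg_cstM.
case: l.
  rewrite (_ : 2 * (true%:R - 2^-1) = 1); last by rewrite /=; field.
  by rewrite palg_cst1 scale1r !scalerDl !scaleNr; zmod_ring.
rewrite (_ : 2 * (false%:R - 2^-1) = -1); last by rewrite /=; field.
by rewrite kcN1 scaleN1r !scalerDl !scaleNr; zmod_ring.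
Qed.

Lemma ket_ext (x y : A) : (forall l p, x *: ket l p = y *: ket l p) ->
  forall u : K, x *: u = y *: u.
Proof. by move=> h u; have [p [q ->]] := ket_total u; rewrite !scalerDr !h. Qed.

Lemma half_double (p : M) : kc 2^-1 *: (kc 2 *: p) = p.
Proof. by rewrite scalerA -palg_cstM mulVf ?pnatr_eq0 // palg_cst1 scale1r. Qed.

Let anti_act (V : lmodType A) (k x y x' y' : A) (u : V) :
  (k * (x * y + x' * y')) *: u = k *: (x *: (y *: u) + x' *: (y' *: u)).
Proof. by rewrite -scalerA scalerDl !scalerA. Qed.

(** The even generators act as brackets of the odd ones, up to a multiple of Z_2. *)
Lemma Ep_brackets (u : K) :
  u_Ep c *: u = (HCcst c 2^-1 * (Fup false * Fup true + Fup true * Fup false)) *: u.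
Proof.
move: u; apply: ket_ext => l p.
rewrite Ep_ket anti_act !Fup_ket (hEE_b c l).
by case: l; rewrite /= !Fup_ket scaler0 ?(add0r, addr0) ket_cst /= scalerA.
Qed.

Lemma Em_brackets (u : K) : u_Em c *: u = (HCcst c (- 2^-1) *
    (Fdown false * Fdown true + Fdown true * Fdown false)) *: u.
Proof.
move: u; apply: ket_ext => l p.
rewrite anti_act /u_Em ket_h h_zetaE h_zetabE.
have e : kc (- 2) = kc (- 2^-1) * kc 2 * kc 2 :> Hc.
  by rewrite -!palg_cstM; congr (kc _); field.
have tt : t false *: (t true *: p) = t true *: (t false *: p) by rewrite !scalerA t_comm.
rewrite scale_hc e -2!scalerA -[(t _ * t _) *: p]scalerA !Fdown_ket.
by case: l; rewrite /= !Fdown_ket scaler0 ?(add0r, addr0) ket_cst /= (kcZ_comm 2 (t _)) // tt.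
Qed.

Let act_addM (V : lmodType A) (k x y w : A) (u : V) :
  (k * (x + y) + w) *: u = k *: (x *: u + y *: u) + w *: u.
Proof. by rewrite scalerDl -scalerA scalerDl. Qed.

(** H and Z_1 are combinations of these brackets and Z_2. *)
Definition anti_up_down (l : bool) : A := Fup l * Fdown (~~ l) + Fdown (~~ l) * Fup l.

Lemma anti_ket l p : anti_up_down l *: ket l p = ket l (kc 2 *: ((t (~~ l) * z (~~ l)) *: p)).
Proof.
rewrite /anti_up_down -[_ + _]mul1r anti_act scale1r Fup_ket Fdown_ket eqxx.
rewrite (_ : (l == ~~ l) = false); last by case: l.
by rewrite scaler0 add0r Fdown_ket eqxx negbK -scalerA.
Qed.

Lemma anti_ket' l p : anti_up_down (~~ l) *: ket l p = ket l (kc 2 *: ((z l * t l) *: p)).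
Proof.
rewrite /anti_up_down -[_ + _]mul1r anti_act scale1r Fup_ket Fdown_ket negbK eqxx.
rewrite (_ : (l == ~~ l) = false); last by case: l.
by rewrite scaler0 addr0 Fup_ket eqxx !negbK kcZ_comm -scalerA.
Qed.

Lemma H_brackets (u : K) : u_H c *: u =
  (HCcst c 2^-1 * (anti_up_down false + anti_up_down true) + 0) *: u.
Proof.
move: u; apply: ket_ext => l p.
rewrite H_ket act_addM scale0r addr0.
have -> : anti_up_down false *: ket l p + anti_up_down true *: ket l p
    = anti_up_down l *: ket l p + anti_up_down (~~ l) *: ket l p.
  by case: l; rewrite // addrC.
rewrite anti_ket anti_ket' -ketD ket_cst -scalerDr half_double; congr ket.
rewrite -scalerDl t_z_same // (hHb c l); congr (_ *: _); zmod_ring.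
Qed.

Lemma Z1_brackets (u : K) : u_Z1 c *: u = (HCcst c 2^-1 *
    (anti_up_down false + - anti_up_down true) + HCcst c 2 * u_Z2 c) *: u.
Proof.
move: u; apply: ket_ext => l p.
rewrite Z1_ket act_addM -[(HCcst c 2 * _) *: _]scalerA Z2_ket ket_cst.
rewrite [kc 2 *: (kc _ *: p)]scalerA -palg_cstM scaleNr.
have h2 (x y : M) : kc 2^-1 *: (kc 2 *: x - kc 2 *: y) = x - y.
  by rewrite -scalerBr half_double.
case: l.
  rewrite (anti_ket true) (anti_ket' true) -ketN -ketD ket_cst -ketD; congr ket.
  rewrite h2 (_ : 2 * (true%:R - 2^-1) = 1); last by rewrite /=; field.
  by rewrite palg_cst1 -scaleNr -scalerBl -scalerDl t_z_same // /hL; congr (_ *: _); zmod_ring.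
rewrite (anti_ket false) (anti_ket' false) -ketN -ketD ket_cst -ketD; congr ket.
rewrite h2 (_ : 2 * (false%:R - 2^-1) = -1); last by rewrite /=; field.
by rewrite kcN1 -scaleNr -scalerBl -scalerDl t_z_same // /hL; congr (_ *: _); zmod_ring.
Qed.

End SpinPair.

(** * Polynomials in z zbar *)

Section PolynomialValue.
Variables (K : comNzRingType) (X : Type) (r : aterm K X -> aterm K X -> Prop).
Variable x : palg r.

Definition pev (P : {poly K}) : palg r := \sum_(i < size P) P`_i *: x ^+ i.

Lemma pev_widen n (P : {poly K}) : (size P <= n)%N -> pev P = \sum_(i < n) P`_i *: x ^+ i.
Proof.
move=> sn; rewrite /pev (big_ord_widen _ (fun i => P`_i *: x ^+ i) sn) big_mkcond.
by apply: eq_bigr => i _; case: ltnP => // h; rewrite nth_default // scale0r.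
Qed.
Lemma pev_lin k P Q : pev (k *: P + Q) = k *: pev P + pev Q.
Proof.
pose n := maxn (size (k *: P + Q)) (maxn (size P) (size Q)).
rewrite !(@pev_widen n) ?leq_maxl // ?leq_max ?leqnn ?orbT //.
rewrite scaler_sumr -big_split; apply: eq_bigr => i _ /=.
by rewrite coefD coefZ scalerDl scalerA.
Qed.
Lemma pev0 : pev 0 = 0.
Proof. by rewrite /pev size_poly0 big_ord0. Qed.
Lemma pevZ k P : pev (k *: P) = k *: pev P.
Proof. by rewrite -[k *: P]addr0 pev_lin pev0 addr0. Qed.
Lemma pevD P Q : pev (P + Q) = pev P + pev Q.
Proof. by rewrite -[P]scale1r pev_lin !scale1r. Qed.
Lemma pevMX P : pev (P * 'X) = pev P * x.
Proof.
rewrite (@pev_widen (size P).+1 (P * 'X)).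
  rewrite big_ord_recl coefMX /= scale0r add0r mulr_suml; apply: eq_bigr => i _.
  by rewrite coefMX /= palg_scaleAl -exprSr.
by rewrite (leq_trans (size_polyMleq _ _)) // size_polyX addn2.
Qed.
Lemma pevC k : pev k%:P = palg_cst r k.
Proof.
rewrite (@pev_widen 1) ?size_polyC_leq1 // big_ord1 coefC expr0 /=.
by rewrite palg_scaleE mulr1.
Qed.
Lemma pev1 : pev 1 = 1.
Proof. by rewrite pevC palg_cst1. Qed.
Lemma pevXn n : pev 'X^n = x ^+ n.
Proof. by elim: n => [|n IH]; rewrite ?expr0 ?pev1 // exprSr pevMX IH -exprSr. Qed.

Lemma pev_root (P : {poly K}) (a : K) : pev (P * ('X - a%:P)) = pev P * (x - palg_cst r a).
Proof.
have -> : P * ('X - a%:P) = (- a) *: P + P * 'X.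
  by rewrite mulrBr addrC scaleNr [P * a%:P]mulrC mul_polyC.
rewrite pev_lin pevMX mulrBr addrC; congr (_ + _).
by rewrite scaleNr palg_scaleE palg_cstC.
Qed.
End PolynomialValue.

Section PolyAction.
Variables (R : realType) (m : nat) (c : dihedral m -> R[i]).
Local Notation C := R[i].
Local Notation G := (dihedral m).
Variables (d : nat) (tau : mx_representation C [set: G]%G d).
Hypothesis m_gt0 : (0 < m)%N.
Hypothesis c_conj : forall (j : nat) (g : G), c (refl m j ^ g)%g = c (refl m j).
Local Notation M := (stdmod c tau).
Local Notation Hc := (cherednik c).
Local Notation kc := (palg_cst (cherednik_rel c)).
Local Notation z b := (hEd c (zrow R b)).
Local Notation t b := (hE c (zcol R b)).
Local Notation deg := (std_deg (c:=c) (tau:=tau)).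
Local Notation EE := (hEE c).
Local Notation hH := (hH c).

Definition hev (P : {poly C}) : Hc := pev EE P.

Lemma hev_lin k P Q : hev (k *: P + Q) = k *: hev P + hev Q. Proof. exact: pev_lin. Qed.
Lemma hev0 : hev 0 = 0. Proof. exact: pev0. Qed.
Lemma hevZ k P : hev (k *: P) = k *: hev P. Proof. exact: pevZ. Qed.
Lemma hevD P Q : hev (P + Q) = hev P + hev Q. Proof. exact: pevD. Qed.
Lemma hevMX P : hev (P * 'X) = hev P * EE. Proof. exact: pevMX. Qed.
Lemma hevC k : hev k%:P = kc k. Proof. exact: pevC. Qed.
Lemma hev1 : hev 1 = 1. Proof. exact: pev1. Qed.
Lemma hevXn n : hev 'X^n = EE ^+ n. Proof. exact: pevXn. Qed.

Lemma hev_comm (x : Hc) : x * EE = EE * x -> forall P, x * hev P = hev P * x.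
Proof.
move=> xE; elim/poly_ind => [|P k IH]; first by rewrite hev0 mulr0 mul0r.
rewrite hevD hevMX hevC mulrDr mulrDl mulrA IH -!mulrA xE; congr (_ + _).
by rewrite palg_cstC.
Qed.

Lemma hev_z b P : z b * hev P = hev P * z b.
Proof. by apply: hev_comm; apply: E_z. Qed.

(** The commutator of t_b with z zbar is z_(~~ b), which commutes with z zbar. *)
Lemma t_hev b P : t b * hev P = hev P * t b + hev P^`() * z (~~ b).
Proof.
elim/poly_ind: P => [|P k IH].
  by rewrite hev0 mulr0 mul0r deriv0 hev0 mul0r addr0.
rewrite derivD derivM derivX derivC mulr1 addr0 !hevD !hevMX hevC mulrDr mulrA IH.
rewrite !mulrDl -!mulrA t_E // mulrDr -palg_cstC E_z; zmod_ring.
Qed.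

Lemma deg_E k p : deg k p -> deg k.+2 (EE *: p).
Proof. by move=> hp; rewrite (hEE_b c false) -scalerA; do 2! apply: deg_z. Qed.

Lemma deg_En k n p : deg k p -> deg (k + n.*2) (EE ^+ n *: p).
Proof.
elim: n k p => [|n IH] k p hp; first by rewrite addn0 scale1r.
by rewrite doubleS !addnS exprS -scalerA; apply/deg_E/IH.
Qed.

Lemma En_inj n p : EE ^+ n *: p = 0 -> (p : M) = 0.
Proof.
elim: n => [|n IH]; first by rewrite scale1r.
by rewrite exprS -scalerA => /(E_inj m_gt0 c_conj)/IH.
Qed.

Lemma kc_inj k (p : M) : k != 0 -> kc k *: p = 0 -> p = 0.
Proof.
move=> k0 kp; rewrite -[p]scale1r -palg_cst1 -(mulVf k0) palg_cstM -scalerA kp.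
exact: scaler0.
Qed.

(** The product of the T - a_j over j != i kills all the other vectors. *)
Lemma eigen_indep (T : Hc) (I : finType) (a : I -> C) (v : I -> M) :
  injective a -> (forall i, T *: v i = kc (a i) *: v i) ->
  \sum_i v i = 0 -> forall i, v i = 0.
Proof.
move=> a_inj Tv sv i.
pose op (s : seq I) (x : M) := foldr (fun j y => T *: y - kc (a j) *: y) x s.
have op_eig s j : op s (v j) = kc (\prod_(x <- s) (a j - a x)) *: v j.
  elim: s => [|x s IH]; first by rewrite big_nil scale1r.
  rewrite /= IH big_cons kcZ_comm Tv !scalerA -!palg_cstM -scalerBl -kcB.
  by congr (kc _ *: _); ring.
have op_add s x y : op s (x + y) = op s x + op s y.
  by elim: s => //= j s ->; rewrite !scalerDr; zmod_ring.
have op_0 s : op s 0 = 0 by elim: s => //= j s ->; rewrite !scaler0 subr0.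
pose s := [seq j <- enum I | j != i].
have := congr1 (op s) sv; rewrite (big_morph (op s) (op_add s) (op_0 s)) op_0.
rewrite (bigD1 i) //= big1 ?addr0 => [|j ji].
  rewrite op_eig => /kc_inj; apply; rewrite prodf_seq_neq0; apply/allP => j.
  rewrite mem_filter => /andP[ji _]; apply/implyP => _; rewrite subr_eq0.
  by apply/eqP => /a_inj ij; rewrite ij eqxx in ji.
rewrite op_eig (bigD1_seq j) /=; last 2 first.
- by rewrite mem_filter ji mem_enum.
- by rewrite filter_uniq // enum_uniq.
by rewrite subrr mul0r palg_cst0 scale0r.
Qed.

Variable N : C.
Hypothesis N_tau : sigma_scalar c tau N.
Hypothesis N_lt1 : 0 < 1 - N.
Local Notation lam := (lam N).

(** ket l p is monogenic if p satisfies this: of the two lowering operators one is t_l on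
    spinors of degree l, and the other vanishes there. *)
Definition mono l k (p : M) := deg k p /\ t l *: p = 0.

Lemma lam_inj : injective lam.
Proof. by move=> i j; rewrite /lam => /addIr/addIr/eqP; rewrite eqr_nat => /eqP. Qed.

Lemma hev_inj k p P : deg k p -> p <> 0 -> hev P *: p = 0 -> P = 0.
Proof.
move=> hp p0 Pp; apply/polyP => i; rewrite coef0.
case: (ltnP i (size P)) => [si|]; last exact: nth_default.
have := @eigen_indep hH 'I_(size P) (fun j => lam (k + j.*2)%N)
  (fun j => kc P`_j *: (EE ^+ j *: p)) _ _ _ (Ordinal si).
rewrite /= => h; apply: contra_notP p0 => /eqP Pi0.
apply: (@En_inj i); apply: (kc_inj Pi0); apply: h => [j j'|j|].
- move=> /lam_inj/addnI/double_inj; exact: val_inj.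
- by rewrite kcZ_comm (hH_deg m_gt0 N_tau (deg_En j hp)) !scalerA palg_cstC.
- by rewrite -[RHS]Pp /hev /pev scaler_suml; apply: eq_bigr => j _; rewrite scale_hc.
Qed.

End PolyAction.

(** * The u(2|1)-module generated by a monogenic *)

Section LowestWeight.
Variables (R : realType) (m : nat) (c : dihedral m -> R[i]).
Local Notation C := R[i].
Local Notation G := (dihedral m).
Variables (d : nat) (tau : mx_representation C [set: G]%G d).
Hypothesis m_gt0 : (0 < m)%N.
Hypothesis c_conj : forall (j : nat) (g : G), c (refl m j ^ g)%g = c (refl m j).
Variable N : C.
Hypothesis N_tau : sigma_scalar c tau N.
Hypothesis N_lt1 : 0 < 1 - N.
Hypothesis d_gt0 : (0 < d)%N.
Local Notation M := (stdmod c tau).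
Local Notation A := (HC c).
Local Notation K := (kmod c tau).
Local Notation kc := (palg_cst (cherednik_rel c)).
Local Notation z b := (hEd c (zrow R b)).
Local Notation hev := (hev c).
Local Notation ket := (ket (c:=c) (tau:=tau)).
Local Notation mono := (mono (c:=c) (tau:=tau)).
Local Notation Fup := (Fup c).
Local Notation Fdown := (Fdown c).
Local Notation lam := (lam N).
Local Notation W := ({poly C} * {poly C})%type.

Definition phi (l : bool) (w : W) (p : M) : K :=
  ket l (hev w.1 *: p) + ket (~~ l) (hev w.2 *: (z (~~ l) *: p)).

Lemma phi_lin l k w w' p : phi l (k *: w + w') p = HCcst c k *: phi l w p + phi l w' p.
Proof.
rewrite /phi /= !hev_lin !scalerDl !scale_hc !ketD -!ket_cst [HCcst c k *: (_ + _)]scalerDr.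
zmod_ring.
Qed.

Lemma phi0 l p : phi l 0 p = 0.
Proof. by rewrite /phi /= hev0 !scale0r !ket0 addr0. Qed.

Lemma phi_linr l k w p q :
  phi l w (kc k *: p + q) = HCcst c k *: phi l w p + phi l w q.
Proof.
rewrite /phi !scalerDr !(kcZ_comm _ (z _)) !(kcZ_comm _ (hev _)) !ketD -!ket_cst; zmod_ring.
Qed.

Lemma ket_sum_inj l p q : ket l p + ket (~~ l) q = 0 -> p = 0 /\ q = 0.
Proof.
have k0 : kcoord (c:=c) (tau:=tau) 0 = (0, 0) by rewrite -(ket0 c tau false) kcoord_ket.
move=> /(congr1 (@kcoord R m c d tau)); rewrite k0 kcoordD !kcoord_ket.
by case: l => e; have := congr1 fst e; have := congr1 snd e; rewrite /= ?addr0 ?add0r.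
Qed.

Lemma phi_inj l k w p : mono l k p -> p <> 0 -> phi l w p = 0 -> w = 0.
Proof.
move=> [hp tp] p0 /ket_sum_inj [e1 e2]; case: w e1 e2 => P Q /= e1 e2.
rewrite (hev_inj m_gt0 c_conj N_tau hp p0 e1).
suff -> : Q = 0 by [].
apply: (hev_inj m_gt0 c_conj N_tau (deg_z (~~ l) hp) _ e2).
by move=> /(z_inj m_gt0 c_conj).
Qed.

Lemma mono_ex l k : exists p, mono l k p /\ p <> 0.
Proof.
by have [p [h1 h2 h3]] := deg_ker_neq0 m_gt0 c_conj N_tau N_lt1 d_gt0 k l; exists p.
Qed.

(** X acts on the coefficients w by a rule which is the same for all monogenics. *)
Definition acts l k (X : A) (w w' : W) := forall p, mono l k p -> X *: phi l w p = phi l w' p.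
Definition good l k (X : A) := forall w, exists w', acts l k X w w'.

Lemma Fup_acts l k w : acts l k (Fup l) w (0, w.1).
Proof.
move=> p _; rewrite /phi scalerDr !Fup_ket eqxx (_ : (~~ l == l) = false); last by case: (l).
by rewrite addr0 hev0 scale0r ket0 add0r !scalerA hev_z.
Qed.

Lemma Fup'_acts l k w : acts l k (Fup (~~ l)) w (w.2 * 'X, 0).
Proof.
move=> p _; rewrite /phi scalerDr !Fup_ket eqxx (_ : (l == ~~ l) = false); last by case: (l).
rewrite add0r hev0 scale0r ket0 addr0 negbK hevMX (hEE_b c l) -!scalerA.
by rewrite scalerA hev_z -scalerA.
Qed.

Lemma Fdown_acts l k w : acts l k (Fdown l) w (0, 2 *: w.1^`()).
Proof.
move=> p [_ tp]; rewrite /phi scalerDr !Fdown_ket eqxx (_ : (~~ l == l) = false); last by case: (l).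
rewrite addr0 hev0 scale0r ket0 add0r hevZ scale_hc; congr ket; congr (_ *: _).
by rewrite scalerA t_hev // scalerDl -!scalerA tp scaler0 add0r.
Qed.

Lemma Fdown'_acts l k w :
  acts l k (Fdown (~~ l)) w (2 *: (w.2^`() * 'X + lam k *: w.2), 0).
Proof.
move=> p [hp tp]; rewrite /phi scalerDr !Fdown_ket eqxx (_ : (l == ~~ l) = false); last by case: (l).
rewrite add0r hev0 scale0r ket0 addr0 negbK hevZ scale_hc; congr ket; congr (_ *: _).
rewrite scalerA t_hev // scalerDl -!scalerA (lower_raise m_gt0 N_tau hp tp) negbK.
by rewrite hevD hevMX hevZ scalerDl scale_hc kcZ_comm (hEE_b c l) -!scalerA addrC.
Qed.

Lemma Z2_acts l k w : acts l k (u_Z2 c) w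
  ((l%:R - 2^-1) *: w.1, ((~~ l)%:R - 2^-1) *: w.2).
Proof.
by move=> p _; rewrite /phi scalerDr !Z2_ket /= !hevZ !scale_hc.
Qed.

Lemma acts_lin l k a X Y w x y : acts l k X w x -> acts l k Y w y ->
  acts l k (HCcst c a * X + Y) w (a *: x + y).
Proof. by move=> hx hy p hp; rewrite scalerDl -scalerA hx // hy // phi_lin. Qed.

Lemma acts_mul l k X Y w x y : acts l k X w x -> acts l k Y x y -> acts l k (Y * X) w y.
Proof. by move=> hx hy p hp; rewrite -scalerA hx // hy. Qed.

Lemma good_mul l k X Y : good l k X -> good l k Y -> good l k (X * Y).
Proof.
move=> gX gY w; have [w1 h1] := gY w; have [w2 h2] := gX w1.
by exists w2; apply: acts_mul h1 h2.
Qed.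
Lemma good_lin l k a X Y : good l k X -> good l k Y -> good l k (HCcst c a * X + Y).
Proof.
move=> gX gY w; have [w1 h1] := gX w; have [w2 h2] := gY w.
by exists (a *: w1 + w2); apply: acts_lin.
Qed.
Lemma good0 l k : good l k 0.
Proof. by move=> w; exists 0 => p _; rewrite scale0r phi0. Qed.
Lemma good_add l k X Y : good l k X -> good l k Y -> good l k (X + Y).
Proof. by move=> gX gY; rewrite -[X]mul1r -(HCcst1 c); apply: good_lin. Qed.
Lemma good_cst l k a X : good l k X -> good l k (HCcst c a * X).
Proof. by move=> gX; rewrite -[_ * X]addr0; apply: good_lin => //; apply: good0. Qed.
Lemma HCcstN1 : HCcst c (-1) = -1.
Proof. by rewrite -inHcst kcN1 inHN inH1. Qed.
Lemma good_opp l k X : good l k X -> good l k (- X).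
Proof. by move=> gX; rewrite -mulN1r -HCcstN1; apply: good_cst. Qed.
Lemma good_ext l k X Y : (forall u : K, X *: u = Y *: u) -> good l k Y -> good l k X.
Proof. by move=> e g w; have [w' h] := g w; exists w' => p hp; rewrite e h. Qed.

Lemma good_Fup l k b : good l k (Fup b).
Proof.
move=> w; have [->|/eqP nb] := eqVneq b l; first by eexists; apply: Fup_acts.
have -> : b = ~~ l by case: b l nb => [] [].
by eexists; apply: Fup'_acts.
Qed.
Lemma good_Fdown l k b : good l k (Fdown b).
Proof.
move=> w; have [->|/eqP nb] := eqVneq b l; first by eexists; apply: Fdown_acts.
have -> : b = ~~ l by case: b l nb => [] [].
by eexists; apply: Fdown'_acts.
Qed.
Lemma good_Z2 l k : good l k (u_Z2 c).
Proof. by move=> w; eexists; apply: Z2_acts. Qed.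
Lemma good_anti l k b : good l k (anti_up_down c b).
Proof.
by apply: good_add; apply: good_mul; (apply: good_Fup || apply: good_Fdown).
Qed.
Lemma good_H l k : good l k (u_H c).
Proof.
apply: (@good_ext l k _ _ (H_brackets m_gt0)); apply: good_add; last exact: good0.
by apply/good_cst/good_add; apply: good_anti.
Qed.
Lemma good_Z1 l k : good l k (u_Z1 c).
Proof.
apply: (@good_ext l k _ _ (Z1_brackets m_gt0)); apply: good_add; last exact/good_cst/good_Z2.
by apply/good_cst/good_add; [|apply: good_opp]; apply: good_anti.
Qed.
Lemma good_Ep l k : good l k (u_Ep c).
Proof.
apply: (@good_ext l k _ _ (Ep_brackets (c:=c) (tau:=tau))); apply/good_cst/good_add; apply: good_mul; exact: good_Fup.
Qed.
Lemma good_Em l k : good l k (u_Em c).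
Proof.
apply: (@good_ext l k _ _ (Em_brackets (c:=c) (tau:=tau))); apply/good_cst/good_add; apply: good_mul; exact: good_Fdown.
Qed.

Lemma good_lspan l k (s : seq A) X :
  (forall i : 'I_(size s), good l k s`_i) -> lspan s X -> good l k X.
Proof.
move=> h [a ->]; apply: big_ind; [exact: good0 | exact: good_add |].
by move=> i _; rewrite -[_ *: _]/(HCcst c (a i) * s`_i); apply/good_cst/h.
Qed.

Lemma good_part l k b X : u21_part c b X -> good l k X.
Proof.
case: b => /good_lspan; apply; last first.
  case=> [[|[|[|[|[|//]]]]] hi] /=; [exact: good_Ep | exact: good_Em
    | exact: good_H | exact: good_Z1 | exact: good_Z2].
case=> [[|[|[|[|//]]]] hi] /=.
- by have := good_Fup l k false; rewrite FupE.
- by have := good_Fup l k true; rewrite FupE.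
- by have := good_Fdown l k false; rewrite FdownE.
- by have := good_Fdown l k true; rewrite FdownE.
Qed.

Lemma good_u21 l k X : u21 c X -> good l k X.
Proof. by move=> [X0 [X1 [h0 h1 ->]]]; apply: good_add; apply: good_part; eassumption. Qed.

End LowestWeight.

(** * The irreducible lowest weight modules *)

Lemma neq_negb (a b : bool) : a <> b -> a = ~~ b.
Proof. by case: a b => [] []. Qed.

Section Irreducible.
Variables (R : realType) (m : nat) (c : dihedral m -> R[i]).
Local Notation C := R[i].
Local Notation G := (dihedral m).
Variables (d : nat) (tau : mx_representation C [set: G]%G d).
Hypothesis m_gt0 : (0 < m)%N.
Hypothesis c_conj : forall (j : nat) (g : G), c (refl m j ^ g)%g = c (refl m j).
Variable N : C.
Hypothesis N_tau : sigma_scalar c tau N.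
Hypothesis N_lt1 : 0 < 1 - N.
Hypothesis d_gt0 : (0 < d)%N.
Local Notation A := (HC c).
Local Notation kc := (palg_cst (cherednik_rel c)).
Local Notation z b := (hEd c (zrow R b)).
Local Notation t b := (hE c (zcol R b)).
Local Notation hev := (hev c).
Local Notation ket := (ket (c:=c) (tau:=tau)).
Local Notation mono := (mono (c:=c) (tau:=tau)).
Local Notation Fup := (Fup c).
Local Notation Fdown := (Fdown c).
Local Notation lam := (lam N).
Local Notation W := ({poly C} * {poly C})%type.
Local Notation phi := (phi (c:=c) (tau:=tau)).
Local Notation acts := (@acts R m c d tau).

Lemma acts_uniq l k X w w1 w2 : acts l k X w w1 -> acts l k X w w2 -> w1 = w2.
Proof.
move=> h1 h2; have [p [hp p0]] := mono_ex m_gt0 c_conj N_tau N_lt1 d_gt0 l k.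
apply/eqP; rewrite -subr_eq0; apply/eqP.
apply: (phi_inj m_gt0 c_conj N_tau hp p0).
by rewrite addrC -scaleN1r phi_lin -h2 // -h1 // HCcstN1 scaleN1r addNr.
Qed.

(** The value is unique by [acts_uniq], and it exists for X in u(2|1). *)
Definition lw_rho l k (X : A) (w : W) : W :=
  if pselect (exists w', acts l k X w w') is left h then sval (cid h) else 0.

Lemma lw_rho_acts l k X w : u21 c X -> acts l k X w (lw_rho l k X w).
Proof.
move=> /(good_u21 m_gt0 N_tau l k)/(_ w) h; rewrite /lw_rho.
by case: pselect => // h'; case: (cid h').
Qed.

Lemma lw_rhoE l k X w w' : acts l k X w w' -> lw_rho l k X w = w'.
Proof.
move=> h; rewrite /lw_rho; case: pselect => [h'|[]]; last by exists w'.
by case: (cid h') => x hx; apply: acts_uniq hx h.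
Qed.

Definition lw_part (l q : bool) : set W := fun w => if q == l then w.2 = 0 else w.1 = 0.

Lemma lw_part_ket l k q w p : mono l k p -> p <> 0 ->
  lw_part l q w <-> exists x, phi l w p = ket q x.
Proof.
move=> hp p0; case: w => P Q; rewrite /lw_part /phi /=; split=> [|[x]].
  have [->|/eqP nq] := eqVneq q l => /= ->; rewrite hev0 scale0r ket0 ?addr0 ?add0r.
    by eexists.
  have -> : q = ~~ l by apply: neq_negb.
  by eexists.
have [->|/eqP nq] := eqVneq q l => e.
  have /ket_sum_inj [_ e2] : ket l (hev P *: p - x) + ket (~~ l) (hev Q *: (z (~~ l) *: p)) = 0.
    by rewrite ketD ketN addrAC e subrr.
  apply: (hev_inj m_gt0 c_conj N_tau (deg_z (~~ l) (proj1 hp)) _ e2).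
  by move=> /(z_inj m_gt0 c_conj).
have eq : q = ~~ l by apply: neq_negb.
have /ket_sum_inj [e1 _] : ket l (hev P *: p) + ket (~~ l) (hev Q *: (z (~~ l) *: p) - x) = 0.
  by rewrite ketD ketN addrA e eq subrr.
exact: (hev_inj m_gt0 c_conj N_tau (proj1 hp) p0 e1).
Qed.

Lemma part_ket b X l p : u21_part c b X -> exists x, X *: ket l p = ket (b (+) l) x.
Proof.
move=> hX; have {hX} : exists2 s : seq A, lspan s X &
    forall i : 'I_(size s), exists x, s`_i *: ket l p = ket (b (+) l) x.
  case: b hX => hX; eexists; try exact: hX.
    case=> [[|[|[|[|//]]]] hi] /=.
    - rewrite -(FupE c false) Fup_ket; case: (l) => /=; last by eexists.
      by exists 0; rewrite ket0.
    - rewrite -(FupE c true) Fup_ket; case: (l) => /=; first by eexists.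
      by exists 0; rewrite ket0.
    - rewrite -(FdownE c false) Fdown_ket; case: (l) => /=; last by eexists.
      by exists 0; rewrite ket0.
    - rewrite -(FdownE c true) Fdown_ket; case: (l) => /=; first by eexists.
      by exists 0; rewrite ket0.
  case=> [[|[|[|[|[|//]]]]] hi] /=.
  - by eexists; apply: Ep_ket.
  - by rewrite /u_Em ket_h; eexists.
  - by eexists; apply: H_ket.
  - by eexists; apply: Z1_ket.
  - by eexists; apply: Z2_ket.
move=> [s [a ->] hs]; rewrite scaler_suml.
have /choice [x hx] := hs; exists (\sum_(i < size s) kc (a i) *: x i).
rewrite ket_sum; apply: eq_bigr => i _.
by rewrite -[_ *: s`_i]/(HCcst c (a i) * s`_i) -scalerA hx ket_cst.
Qed.

Lemma part_u21 b X : u21_part c b X -> u21 c X.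
Proof.
have l0 (s : seq A) : lspan s 0.
  by exists (fun=> 0); rewrite big1 // => i _; rewrite scale0r.
by case: b => h; [exists 0, X | exists X, 0]; split; rewrite ?add0r ?addr0 //; apply: l0.
Qed.

Lemma Fup_u21 b : u21 c (Fup b).
Proof.
apply: (@part_u21 true); rewrite FupE /u21_part.
case: b.
  exists (fun i => (i == 1%N)%:R); rewrite !big_ord_recl big_ord0 /= !scale0r scale1r.
  by rewrite !addr0 add0r.
exists (fun i => (i == 0%N)%:R); rewrite !big_ord_recl big_ord0 /= !scale0r scale1r.
by rewrite !addr0.
Qed.

Lemma Fdown_u21 b : u21 c (Fdown b).
Proof.
apply: (@part_u21 true); rewrite FdownE /u21_part.
case: b.
  exists (fun i => (i == 3%N)%:R); rewrite !big_ord_recl big_ord0 /= !scale0r scale1r.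
  by rewrite !addr0 !add0r.
exists (fun i => (i == 2%N)%:R); rewrite !big_ord_recl big_ord0 /= !scale0r scale1r.
by rewrite !addr0 !add0r.
Qed.

Section Rep.
Variables (l : bool) (k : nat).
Local Notation rho := (lw_rho l k).

Lemma rho_linr_proof X : u21 c X ->
  forall a v w, rho X (a *: v + w) = a *: rho X v + rho X w.
Proof.
move=> hX a v w; apply: lw_rhoE => p hp.
rewrite !phi_lin scalerDr -(lw_rho_acts v hX hp) -(lw_rho_acts w hX hp).
by rewrite !scalerA palg_cstC.
Qed.

Lemma rho_linl_proof a X Y w : u21 c X -> u21 c Y ->
  rho (a *: X + Y) w = a *: rho X w + rho Y w.
Proof. by move=> hX hY; apply: lw_rhoE; apply: acts_lin; apply: lw_rho_acts. Qed.

Lemma rho_part_proof p q X w :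
  u21_part c p X -> lw_part l q w -> lw_part l (p (+) q) (rho X w).
Proof.
move=> hX hw; have [v [hv v0]] := mono_ex m_gt0 c_conj N_tau N_lt1 d_gt0 l k.
have [x ex] := (lw_part_ket q w hv v0).1 hw.
apply/(lw_part_ket (p (+) q) (rho X w) hv v0).
by rewrite -(lw_rho_acts w (part_u21 hX) hv) ex; apply: part_ket.
Qed.

Lemma rho_bracket_proof p q X Y w : u21_part c p X -> u21_part c q Y ->
  rho (sbracket p q X Y) w = rho X (rho Y w) - (-1) ^+ (p && q) *: rho Y (rho X w).
Proof.
move=> /part_u21 hX /part_u21 hY.
have hXY : acts l k (X * Y) w (rho X (rho Y w)) by apply: acts_mul; apply: lw_rho_acts.
have hYX : acts l k (Y * X) w (rho Y (rho X w)) by apply: acts_mul; apply: lw_rho_acts.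
apply: lw_rhoE => v hv.
rewrite /sbracket scalerBl hXY // -scalerA hYX // addrC.
have -> : rho X (rho Y w) - (-1) ^+ (p && q) *: rho Y (rho X w) =
  (- (-1) ^+ (p && q)) *: rho Y (rho X w) + rho X (rho Y w) by rewrite scaleNr addrC.
rewrite phi_lin; congr (_ + _).
by case: (p && q); rewrite ?expr0 ?expr1 ?opprK ?HCcstN1 ?HCcst1 ?scaleN1r ?scale1r ?opprK.
Qed.

Lemma lw_part0 p : lw_part l p 0.
Proof. by rewrite /lw_part; case: eqP. Qed.
Lemma lw_part_lin p a v w : lw_part l p v -> lw_part l p w -> lw_part l p (a *: v + w).
Proof. by rewrite /lw_part; case: eqP => _ /= -> ->; rewrite scaler0 addr0. Qed.
Lemma lw_part_sum w : exists w0 w1, [/\ lw_part l false w0, lw_part l true w1 & w = w0 + w1].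
Proof.
case: w => P Q; rewrite /lw_part; case: (l) => /=.
  by exists (0, Q), (P, 0); split=> //; congr pair; rewrite /= ?addr0 ?add0r.
by exists (P, 0), (0, Q); split=> //; congr pair; rewrite /= ?addr0 ?add0r.
Qed.
Lemma lw_part_dir w : lw_part l false w -> lw_part l true w -> w = 0.
Proof. by case: w => P Q; rewrite /lw_part; case: (l) => /= -> ->. Qed.

(** The pair (P, Q) stands for P(2 E_+) v0 + Q(2 E_+) F v0, where F is the odd raising operator
    which does not kill the lowest weight vector v0. *)
Definition lw_rep : u21_rep c :=
  @U21Rep R m c W (lw_part l) rho lw_part0 lw_part_lin lw_part_sum lw_part_dir
    rho_linr_proof rho_linl_proof rho_part_proof rho_bracket_proof.

Lemma rho_Fup w : rho (Fup l) w = (0, w.1).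
Proof. by apply: lw_rhoE; apply: Fup_acts. Qed.
Lemma rho_Fup' w : rho (Fup (~~ l)) w = (w.2 * 'X, 0).
Proof. by apply: lw_rhoE; apply: Fup'_acts. Qed.
Lemma rho_Fdown w : rho (Fdown l) w = (0, 2 *: w.1^`()).
Proof. by apply: lw_rhoE; apply: Fdown_acts. Qed.
Lemma rho_Fdown' w : rho (Fdown (~~ l)) w = (2 *: (w.2^`() * 'X + lam k *: w.2), 0).
Proof. by apply: lw_rhoE; apply: (Fdown'_acts m_gt0 N_tau). Qed.

Definition lw_v0 : rep_space lw_rep := ((1, 0) : W).

Lemma phi_v0 p : phi l lw_v0 p = ket l p.
Proof. by rewrite /phi /= hev1 hev0 scale1r scale0r ket0 addr0. Qed.

Lemma lw_lowest : lowest_weight_vector (L := lw_rep)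
  (k%:R + 1 - N) ((-1) ^+ l * (k%:R - N)) (l%:R - 2%:R^-1) lw_v0.
Proof.
have kets X a : (forall p, mono l k p -> X *: ket l p = ket l (kc a *: p)) ->
    lw_rho l k X lw_v0 = a *: (lw_v0 : W).
  move=> h; apply: lw_rhoE => p hp; rewrite phi_v0 h //.
  by rewrite -[a *: _]addr0 phi_lin phi0 addr0 phi_v0 ket_cst.
have down b p : mono l k p -> Fdown b *: ket l p = 0.
  move=> [_ tp]; rewrite Fdown_ket; case: eqP => // <-.
  by rewrite tp scaler0 ket0.
split.
- by move=> /(congr1 fst) /= /eqP; rewrite oner_eq0.
- split.
  + rewrite [LHS](kets _ 0) ?scale0r // => p hp.
    by rewrite Em_brackets palg_cst0 scale0r ket0 -scalerA scalerDl -!scalerA !down // !scaler0 addr0 scaler0.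
  + by rewrite [LHS](kets _ 0) ?scale0r // => p hp; rewrite -(FdownE c false) down // palg_cst0 scale0r ket0.
  + by rewrite [LHS](kets _ 0) ?scale0r // => p hp; rewrite -(FdownE c true) down // palg_cst0 scale0r ket0.
split.
- by apply: kets => p [hp _]; rewrite H_ket (hH_deg m_gt0 N_tau hp).
- apply: kets => p [hp tp]; rewrite Z1_ket; congr ket.
  have := hH_deg m_gt0 N_tau hp; rewrite (hHb c l) -addrA scalerDl scalerBl scalerDl.
  rewrite -[(z l * t l) *: p]scalerA tp scaler0 add0r scale1r => e.
  have e' : (z (~~ l) * t (~~ l)) *: p - h_sigma c *: p = kc (k%:R - N) *: p.
    have -> : k%:R - N = lam k - 1 by rewrite /lam; ring.
    by rewrite kcB scalerBl -e palg_cst1 scale1r; zmod_ring.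
  rewrite /hL palg_cstM -scalerA -e' !scalerBr.
  move: tp {e e' hp}; case: (l) => /= tp.
    rewrite !scalerDl !scaleNr -!scalerA tp scaler0 expr1 kcN1 !scaleN1r; zmod_ring.
  by rewrite !scalerDl !scaleNr -!scalerA tp scaler0 expr0 palg_cst1 !scale1r; zmod_ring.
- by apply: kets => p hp; rewrite Z2_ket.
Qed.

Lemma deriv_neq0 (P : {poly C}) : (1 < size P)%N -> P^`() != 0.
Proof.
move=> s1; apply: contraL s1 => /eqP/polyP/(_ (size P).-2); rewrite coef_deriv coef0.
case sP: (size P) => [|[|n]] //= /eqP.
rewrite -mulr_natr mulf_eq0 pnatr_eq0 orbF => /eqP h.
have : lead_coef P == 0 by rewrite lead_coefE sP /= h.
by rewrite lead_coef_eq0 -size_poly_eq0 sP.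
Qed.

(** The leading coefficient of Q is multiplied by deg Q + lam k > 0. *)
Lemma euler_neq0 (Q : {poly C}) : Q != 0 -> 2 *: (Q^`() * 'X + lam k *: Q) != 0.
Proof.
move=> Q0; rewrite scaler_eq0 pnatr_eq0 /=; apply/eqP => /polyP/(_ (size Q).-1).
rewrite coefD coefZ coefMX coef_deriv coef0.
have -> : (if (size Q).-1 == 0%N then 0 else Q`_(size Q).-2.+1 *+ (size Q).-2.+1)
    = (size Q).-1%:R * Q`_(size Q).-1.
  by case: (size Q).-1 => [|n] /=; rewrite ?mul0r // mulr_natl.
move/eqP; rewrite -mulrDl mulf_eq0 -lead_coefE lead_coef_eq0 (negPf Q0) orbF.
by rewrite gt_eqF // ltr_wpDl ?ler0n // (lam_gt0 N_lt1).
Qed.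

(** From a nonzero vector the lowering operators lead to the lowest weight vector, from which the
    raising operators produce all pairs. *)
Lemma lw_irr (S : set (rep_space lw_rep)) : u21_subrep S -> S = [set 0] \/ S = setT.
Proof.
move=> [S0 Slin Sgr Srho].
have SZ a (v : W) : S v -> S (a *: v) by move=> Sv; rewrite -[_ *: _]addr0; apply: Slin.
have SD (v w : W) : S v -> S w -> S (v + w) by move=> Sv; rewrite -[v]scale1r; apply: Slin.
have SF b (w : W) : S w -> S (rho (Fup b) w) by apply: Srho; apply: Fup_u21.
have SFd b (w : W) : S w -> S (rho (Fdown b) w) by apply: Srho; apply: Fdown_u21.
have gr (P Q : {poly C}) : S (P, Q) -> S (P, 0) /\ S (0, Q).
  have e1 : (P, Q) = ((P, 0) : W) + (0, Q) by congr pair; rewrite /= ?addr0 ?add0r.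
  have e2 : (P, Q) = ((0, Q) : W) + (P, 0) by congr pair; rewrite /= ?addr0 ?add0r.
  rewrite /rep_part /= in Sgr; move: Sgr; rewrite /lw_part.
  case: (l) => Sgr SPQ.
    by have [] := Sgr (0, Q) (P, 0) (erefl _) (erefl _); rewrite -?e2.
  by have [] := Sgr (P, 0) (0, Q) (erefl _) (erefl _); rewrite -?e1.
have step (Q : {poly C}) : S (0, Q) -> S (2 *: (Q^`() * 'X + lam k *: Q), 0).
  by move=> SQ; rewrite -(rho_Fdown' (0, Q)); apply: SFd.
have down n (P : {poly C}) : (size P <= n)%N -> P != 0 -> S (P, 0) -> S (1, 0).
  elim: n P => [|n IH] P sP P0 SP; first by move: P0; rewrite -size_poly_leq0 sP.
  case: (ltnP 1 (size P)) => s1.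
    pose Q := 2 *: P^`().
    have Q0 : Q != 0 by rewrite scaler_eq0 pnatr_eq0 /= deriv_neq0.
    have sQ : (size Q <= n)%N.
      rewrite (leq_trans (size_scale_leq _ _)) // -ltnS (leq_trans _ sP) //.
      by rewrite lt_size_deriv.
    apply: (IH (2 *: (Q^`() * 'X + lam k *: Q))); last 2 first.
    - exact: euler_neq0.
    - by apply: step; rewrite -(rho_Fdown (P, 0)); apply: SFd.
    rewrite (leq_trans (size_scale_leq _ _)) // (leq_trans (size_polyD _ _)) //.
    rewrite geq_max (leq_trans (size_scale_leq _ _)) // andbT.
    rewrite (leq_trans (size_polyMleq _ _)) // size_polyX addn2 /=.
    by rewrite (leq_trans _ sQ) // lt_size_deriv.
  move: SP; rewrite (size1_polyC s1); set a := P`_0 => SP.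
  have a0 : a != 0 by rewrite -polyC_eq0 -(size1_polyC s1).
  have := SZ a^-1 _ SP; congr S; congr pair; last by rewrite scaler0.
  by rewrite /= -mul_polyC -polyCM mulVf.
case: (pselect (exists2 w : W, S w & w <> 0)) => [[[P Q] Sw w0]|h]; last first.
  left; apply/seteqP; split=> [w Sw|w ->//]; apply: contrapT => w0.
  by apply: h; exists w.
right; have S1 : S (1, 0).
  have [SP SQ] := gr _ _ Sw.
  have [P0|P0] := eqVneq P 0; last exact: (down (size P) P).
  have Q0 : Q != 0 by apply/eqP => Q0; apply: w0; rewrite P0 Q0.
  by apply: (down (size (2 *: (Q^`() * 'X + lam k *: Q)))) (step _ SQ) => //; apply: euler_neq0.
move: S1 => {P Q Sw w0} S1; have SP (P : {poly C}) : S (P, 0).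
  elim/poly_ind: P => [|P a IH]; first exact: S0.
  have -> : (P * 'X + a%:P, 0) = (P * 'X, 0) + (a *: (1, 0)) :> W.
    by congr pair; rewrite /= ?scaler0 ?addr0 // -mul_polyC mulr1.
  apply: (SD) (SZ _ _ S1); rewrite -(rho_Fup' (0, P)); apply: (SF).
  by rewrite -(rho_Fup (P, 0)); apply: SF.
apply/seteqP; split=> // -[P' Q'] _.
have -> : (P', Q') = ((P', 0) : W) + (0, Q') by congr pair; rewrite /= ?addr0 ?add0r.
by apply: (SD) => //; rewrite -(rho_Fup (Q', 0)); apply: SF.
Qed.

Lemma lw_rep_irr : is_irr_lowest_weight
  (k%:R + 1 - N) ((-1) ^+ l * (k%:R - N)) (l%:R - 2%:R^-1) lw_rep.
Proof. by split; [exists lw_v0; apply: lw_lowest | apply: lw_irr]. Qed.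

End Rep.
End Irreducible.

(** * The isomorphism *)

Section DirectSum.
Variables (R : realType) (m : nat) (c : dihedral m -> R[i]).
Local Notation C := R[i].
Local Notation G := (dihedral m).
Variables (d : nat) (tau : mx_representation C [set: G]%G d).
Hypothesis m_gt0 : (0 < m)%N.
Hypothesis c_conj : forall (j : nat) (g : G), c (refl m j ^ g)%g = c (refl m j).
Variable N : C.
Hypothesis N_tau : sigma_scalar c tau N.
Hypothesis N_lt1 : 0 < 1 - N.
Hypothesis d_gt0 : (0 < d)%N.
Local Notation M := (stdmod c tau).
Local Notation A := (HC c).
Local Notation K := (kmod c tau).
Local Notation kc := (palg_cst (cherednik_rel c)).
Local Notation z b := (hEd c (zrow R b)).
Local Notation t b := (hE c (zcol R b)).
Local Notation deg := (std_deg (c:=c) (tau:=tau)).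
Local Notation EE := (hEE c).
Local Notation hH := (hH c).
Local Notation hev := (hev c).
Local Notation ket := (ket (c:=c) (tau:=tau)).
Local Notation mono := (mono (c:=c) (tau:=tau)).
Local Notation lam := (lam N).
Local Notation W := ({poly C} * {poly C})%type.
Local Notation phi := (phi (c:=c) (tau:=tau)).
Local Notation lwr := (@lw_rep R m c d tau m_gt0 c_conj N N_tau N_lt1 d_gt0).
Local Notation DS := (dsum tau lwr).
Local Notation mg l k := {u : K | monogenics tau l k u}.

Lemma two_neq0 : 2 != 0 :> C. Proof. by rewrite pnatr_eq0. Qed.

Lemma monogenicsE l k u : monogenics tau l k u <-> exists2 p, mono l k p & u = ket l p.
Proof.
have down b p : Fdown c b *: ket l p = 0 -> b = l -> t l *: p = 0.
  move=> + e; rewrite e Fdown_ket eqxx -(ket0 c tau (~~ l)) => /ket_inj.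
  by move=> /(kc_inj two_neq0).
split=> [[[p hp ->]]|[p [hp tp] ->]].
  rewrite -(FdownE c false) -(FdownE c true) => /down h0 /down h1.
  by exists p => //; split=> //; case: (l) h0 h1 => h0 h1; [apply: h1 | apply: h0].
split; first by exists p.
  rewrite -(FdownE c false) Fdown_ket; case: (l) tp => // tp.
  by rewrite tp scaler0 ket0.
rewrite -(FdownE c true) Fdown_ket; case: (l) tp => // tp.
by rewrite tp scaler0 ket0.
Qed.

Lemma mg_ex l k (u : mg l k) : exists p, mono l k p /\ sval u = ket l p.
Proof. by case: u => u /= /monogenicsE [p hp ->]; exists p. Qed.
Definition mg_vec l k (u : mg l k) : M := sval (cid (mg_ex u)).
Lemma mg_vecP l k (u : mg l k) : mono l k (mg_vec u) /\ sval u = ket l (mg_vec u).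
Proof. by rewrite /mg_vec; case: (cid _). Qed.

Definition Phi_gen (g : dsum_gen tau lwr) : restr K :=
  phi (dg_l g) (dg_w g : W) (mg_vec (dg_m g)).

Lemma Phi_rel x y : dsum_rel x y -> meval Phi_gen x = meval Phi_gen y.
Proof.
case=> {x y} [l k a u v w x e|l k a u x y] /=; rewrite /Phi_gen restr_scale /=; last first.
  exact: phi_lin.
rewrite -[palg_cst _ a]/(HCcst c a) -phi_linr; congr phi.
have [_ eu] := mg_vecP u; have [_ ev] := mg_vecP v; have [_ ew] := mg_vecP w.
by move: e; rewrite eu ev ew ket_cst -ketD => /ket_inj.
Qed.

Definition Phi (x : DS) : K := @pmod_lift _ _ _ (restr K) Phi_gen x.

Lemma PhiP a u v : Phi (a *: u + v) = HCcst c a *: Phi u + Phi v.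
Proof. by rewrite /Phi pmod_liftD ?pmod_liftZ //; exact: Phi_rel. Qed.

Lemma Phi_tens l k (u : mg l k) (x : W) :
  Phi (dtens (u : mg l k) (x : rep_space (lwr l k))) = phi l x (mg_vec u).
Proof. by rewrite /Phi pmod_lift_gen //; exact: Phi_rel. Qed.

Lemma PhiD u v : Phi (u + v) = Phi u + Phi v.
Proof. by rewrite -[u]scale1r PhiP HCcst1 !scale1r. Qed.
Lemma Phi0 : Phi 0 = 0.
Proof. by apply: (addrI (Phi 0)); rewrite -PhiD !addr0. Qed.

Lemma Phi_v0 l k (u : mg l k) : Phi (dtens u (lw_v0 m_gt0 c_conj N_tau N_lt1 d_gt0 l k)) = sval u.
Proof. by rewrite Phi_tens phi_v0; have [_ ->] := mg_vecP u. Qed.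

Lemma Phi_intertwines l k (u : mg l k) x (X : A) : u21 c X ->
  Phi (dtens u (rho X x : rep_space (lwr l k))) = X *: Phi (dtens u x).
Proof.
move=> hX; rewrite !Phi_tens; have [hu _] := mg_vecP u.
exact/esym/(lw_rho_acts m_gt0 N_tau x hX hu).
Qed.

Lemma Phi_part l k (u : mg l k) (x : rep_space (lwr l k)) p :
  rep_part p x -> kmod_part p (Phi (dtens u x)).
Proof.
rewrite Phi_tens /rep_part /= /lw_part; case: x => P Q /=.
have [->|/eqP np] := eqVneq p l => /= ->.
  by exists (hev P *: mg_vec u); rewrite /phi /= hev0 scale0r ket0 addr0.
rewrite (neq_negb np) /phi /= hev0 scale0r ket0 add0r.
by eexists.
Qed.

Definition Phi_image (y : K) := exists x, Phi x = y.

Lemma image_phi l k w p : mono l k p -> Phi_image (phi l w p).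
Proof.
move=> hp; have hu : monogenics tau l k (ket l p) by apply/monogenicsE; exists p.
pose u : mg l k := exist _ _ hu.
exists (dtens u (w : rep_space (lwr l k))); rewrite Phi_tens; congr phi.
by have [_ /ket_inj] := mg_vecP u.
Qed.

Lemma imageD y y' : Phi_image y -> Phi_image y' -> Phi_image (y + y').
Proof. by move=> [x <-] [x' <-]; exists (x + x'); rewrite PhiD. Qed.

(** For p = a + z_s b + z zbar r, with t_s a = 0 and t_(~~ s) b = 0, the first two terms come from
    monogenics, and r has smaller degree. *)
Lemma image_En s k n p : deg k p -> Phi_image (ket s (EE ^+ n *: p)).
Proof.
elim/ltn_ind: k n p => k IH n p hp.
have [a [ha ta]] := deg_decomp m_gt0 N_tau N_lt1 s hp.
have ia : Phi_image (ket s (EE ^+ n *: a)).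
  have := @image_phi s k ('X^n, 0) a (conj ha ta).
  by rewrite /phi /= hev0 scale0r ket0 addr0 hevXn.
case: k IH hp ha => [|k] IH hp ha; first by move=> ->.
move=> [q hq ->]; rewrite scalerDr ketD; apply: imageD => //.
have [b [hb tb]] := deg_decomp m_gt0 N_tau N_lt1 (~~ s) hq.
have ib : Phi_image (ket s (EE ^+ n *: (z s *: b))).
  have := @image_phi (~~ s) k (0, 'X^n) b (conj hb tb).
  by rewrite /phi /= hev0 scale0r ket0 add0r hevXn negbK.
case: k IH hp ha hq hb => [|k] IH hp ha hq hb; first by move=> ->.
move=> [r hr ->]; rewrite !scalerDr ketD; apply: imageD => //.
rewrite [z s *: _]scalerA -(hEE_b c s) scalerA -exprSr.
by apply: (IH k _ n.+1 r hr).

Qed.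

Lemma Phi_surj y : Phi_image y.
Proof.
have [p [q ->]] := ket_total y.
have ik s x : Phi_image (ket s x).
  have [xs ->] := stdmod_sum m_gt0 x; rewrite ket_sum.
  apply: big_ind => [||i _]; [by exists 0; apply: Phi0 | exact: imageD |].
  have := image_En s 0 (@deg_mon R m c d tau i.1.1 i.1.2 i.2); by rewrite scale1r.
by apply: imageD.
Qed.

Lemma mono0 l k : mono l k 0.
Proof. by split; [apply: deg0 | rewrite scaler0]. Qed.
Lemma mono_lin l k a p q : mono l k p -> mono l k q -> mono l k (kc a *: p + q).
Proof.
move=> [hp tp] [hq tq]; split; first exact: deg_lin.
by rewrite scalerDr kcZ_comm tp tq scaler0 addr0.
Qed.
Lemma monoZ l k a p : mono l k p -> mono l k (kc a *: p).
Proof. by move=> hp; rewrite -[_ *: p]addr0; apply: mono_lin => //; apply: mono0. Qed.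
Lemma monoD l k p q : mono l k p -> mono l k q -> mono l k (p + q).
Proof. by move=> hp hq; rewrite -[p]scale1r -palg_cst1; apply: mono_lin. Qed.

Definition mg_mk l k p (hp : mono l k p) : mg l k :=
  exist _ (ket l p) ((monogenicsE l k _).2 (ex_intro2 _ _ p hp erefl)).

Definition lw_unit (e : bool) (n : nat) : W := if e then (0, 'X^n) else ('X^n, 0).

(** The tensor of ket l p with a monomial; zero if p is not monogenic, so that it is defined for
    all p. *)
Definition dbasis l e k n (p : M) : DS :=
  if pselect (mono l k p) is left hp
  then dtens (mg_mk hp) (lw_unit e n : rep_space (lwr l k)) else 0.

Lemma dbasisE l e k n p (hp : mono l k p) :
  dbasis l e k n p = dtens (mg_mk hp) (lw_unit e n : rep_space (lwr l k)).
Proof.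
rewrite /dbasis; case: pselect => // h.
by rewrite (Prop_irrelevance h hp).
Qed.

Lemma dbasis_lin l e k n a p q : mono l k p -> mono l k q ->
  dbasis l e k n (kc a *: p + q) = a *: dbasis l e k n p + dbasis l e k n q.
Proof.
move=> hp hq; rewrite (dbasisE _ _ (mono_lin a hp hq)) (dbasisE _ _ hp) (dbasisE _ _ hq).
rewrite -pmod_ofZ -pmod_ofD; apply/pmod_ofP/mc_rel/DrL => /=.
by rewrite ket_cst ketD.
Qed.
Lemma dbasis0 l e k n : dbasis l e k n 0 = 0.
Proof.
apply: (addrI (dbasis l e k n 0)).
have := dbasis_lin e n 1 (mono0 l k) (mono0 l k).
by rewrite scaler0 !addr0 scale1r => <-.
Qed.
Lemma dbasisZ l e k n a p : mono l k p ->
  dbasis l e k n (kc a *: p) = a *: dbasis l e k n p.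
Proof.
by move=> hp; rewrite -[kc a *: p]addr0 dbasis_lin ?dbasis0 ?addr0 //; apply: mono0.
Qed.
Lemma dbasisD l e k n p q : mono l k p -> mono l k q ->
  dbasis l e k n (p + q) = dbasis l e k n p + dbasis l e k n q.
Proof.
by move=> hp hq; rewrite -[p in LHS]scale1r -palg_cst1 dbasis_lin // scale1r.
Qed.

Lemma dtens_lin l k (u : mg l k) a (x y : rep_space (lwr l k)) :
  dtens u (a *: x + y) = a *: dtens u x + dtens u y.
Proof. by rewrite -pmod_ofZ -pmod_ofD; apply/pmod_ofP/mc_rel/DrR. Qed.
Lemma dtens0 l k (u : mg l k) : dtens u (0 : rep_space (lwr l k)) = 0.
Proof.
apply: (addrI (dtens u 0)); have := dtens_lin u 1 0 0.
by rewrite scaler0 !addr0 scale1r => <-.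
Qed.
Lemma dtensD l k (u : mg l k) (x y : rep_space (lwr l k)) :
  dtens u (x + y) = dtens u x + dtens u y.
Proof. by rewrite -[x in LHS]scale1r dtens_lin scale1r. Qed.
Lemma dtensZ l k (u : mg l k) a (x : rep_space (lwr l k)) :
  dtens u (a *: x) = a *: dtens u x.
Proof. by rewrite -[_ *: x]addr0 dtens_lin dtens0 addr0. Qed.
Lemma dtens_sum l k (u : mg l k) I (r : seq I) (P : pred I) (F : I -> rep_space (lwr l k)) :
  dtens u (\sum_(i <- r | P i) F i) = \sum_(i <- r | P i) dtens u (F i).
Proof. exact: (big_morph (dtens u) (dtensD u) (dtens0 u)). Qed.

Lemma lw_expand B (w : W) : (size w.1 <= B)%N -> (size w.2 <= B)%N ->
  w = \sum_e \sum_(n < B) (if e then w.2 else w.1)`_n *: lw_unit e n.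
Proof.
have expand (P : {poly C}) : (size P <= B)%N -> \sum_(n < B) P`_n *: 'X^n = P.
  move=> sP; rewrite -[RHS](coefK P) poly_def (big_ord_widen _ (fun n => P`_n *: 'X^n) sP) [RHS]big_mkcond.
  by apply: eq_bigr => i _; case: ltnP => // h; rewrite nth_default // scale0r.
move=> h1 h2; rewrite big_bool; case: w h1 h2 => P Q /= /expand {1}<- /expand {1}<-.
have e1 (F : nat -> C) : \sum_(n < B) F n *: (('X^n, 0) : W) = (\sum_(n < B) F n *: 'X^n, 0).
  by elim/big_rec2: _ => // n x y _ ->; congr pair; rewrite /= scaler0 addr0.
have e2 (F : nat -> C) : \sum_(n < B) F n *: ((0, 'X^n) : W) = (0, \sum_(n < B) F n *: 'X^n).
  by elim/big_rec2: _ => // n x y _ ->; congr pair; rewrite /= scaler0 addr0.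
by rewrite (e1 (fun n => P`_n)) (e2 (fun n => Q`_n)); congr pair; rewrite /= ?addr0 ?add0r.
Qed.

Lemma dtens_dbasis l k (u : mg l k) e n :
  dtens u (lw_unit e n : rep_space (lwr l k)) = dbasis l e k n (mg_vec u).
Proof.
have [hu eu] := mg_vecP u; rewrite (dbasisE _ _ hu); congr dtens.
by case: u hu eu => u hu /= h e'; apply: eq_exist.
Qed.

Definition monos (F : bool -> bool -> nat -> nat -> M) :=
  forall l e k n, mono l k (F l e k n).

Lemma dsum_normal (x : DS) : exists2 F, monos F & exists B0, forall B, (B0 <= B)%N ->
  x = \sum_l \sum_e \sum_(k < B) \sum_(n < B) dbasis l e k n (F l e k n).
Proof.
elim/pmod_ind: x => x; elim: x => [[l k u w]||x [F mF [B eB]] y [F' mF' [B' eB']]|a x [F mF [B eB]]].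
- pose p := mg_vec u; have [hp _] := mg_vecP u.
  pose W' := (w : W).
  exists (fun l' e k' n => if (l' == l) && (k' == k)
            then kc (if e then W'.2 else W'.1)`_n *: p else 0).
    move=> l' e k' n; case: ifP => [/andP[/eqP-> /eqP->]|_]; last exact: mono0.
    exact: monoZ.
  exists (maxn k.+1 (maxn (size W'.1) (size W'.2))) => B.
  rewrite !geq_max => /andP[kB /andP[s1 s2]].
  rewrite (bigD1 l) //= [X in _ + X]big1 ?addr0; last first.
    move=> l' /negPf nl; rewrite big1 // => e _; rewrite big1 // => k' _.
    by rewrite big1 // => n _; rewrite nl dbasis0.
  rewrite -[LHS]/(dtens u w) [w in LHS](lw_expand (w:=W') s1 s2) dtens_sum.
  apply: eq_bigr => e _; rewrite dtens_sum.
  rewrite [RHS](bigD1 (Ordinal kB)) //= [X in _ + X]big1 ?addr0; last first.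
    move=> k'; rewrite -val_eqE /= => /negPf nk; rewrite big1 // => n _.
    by rewrite nk andbF dbasis0.
  by apply: eq_bigr => n _; rewrite dtensZ dtens_dbasis !eqxx /= dbasisZ.
- exists (fun _ _ _ _ => 0); first by move=> *; apply: mono0.
  exists 0%N => B _; rewrite big1 // => l _; rewrite big1 // => e _.
  by rewrite big1 // => k _; rewrite big1 // => n _; rewrite dbasis0.
- exists (fun l e k n => F l e k n + F' l e k n); first by move=> *; apply: monoD.
  exists (maxn B B') => B1; rewrite geq_max => /andP[h h']; rewrite pmod_ofD (eB _ h) (eB' _ h').
  rewrite -big_split; apply: eq_bigr => l _; rewrite -big_split; apply: eq_bigr => e _.
  rewrite -big_split; apply: eq_bigr => k _; rewrite -big_split; apply: eq_bigr => n _.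
  by rewrite dbasisD.
- exists (fun l e k n => kc a *: F l e k n); first by move=> *; apply: monoZ.
  exists B => B1 /eB e1; rewrite pmod_ofZ e1.
  rewrite scaler_sumr; apply: eq_bigr => l _; rewrite scaler_sumr; apply: eq_bigr => e _.
  rewrite scaler_sumr; apply: eq_bigr => k _; rewrite scaler_sumr; apply: eq_bigr => n _.
  by rewrite dbasisZ.
Qed.

(** The polynomial part of the image of dbasis l e k n p. *)
Definition raised l (e : bool) n (p : M) : M := EE ^+ n *: (if e then z (~~ l) *: p else p).

Lemma Phi_dbasis l e k n p : mono l k p ->
  Phi (dbasis l e k n p) = ket (l (+) e) (raised l e n p).
Proof.
move=> hp; rewrite (dbasisE _ _ hp) Phi_tens.
have -> : mg_vec (mg_mk hp) = p by have [_ /ket_inj] := mg_vecP (mg_mk hp).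
rewrite /phi /raised; case: e => /=.
  by rewrite hev0 scale0r ket0 add0r hevXn addbT.
by rewrite hev0 scale0r ket0 addr0 hevXn addbF.
Qed.

(** On the vectors raised the first term has eigenvalue n + e lam k, and H is determined by the
    degree k + 2 n + e; the factor i keeps the two real eigenvalues apart. *)
Definition eigenop s : cherednik c := z s * t s + ('i%R : C) *: hH.
Definition eigenval (e : bool) k n : C :=
  n%:R + (if e then lam k else 0) + 'i%R * lam (k + n.*2 + e).

Lemma eigenopP s e k n p : mono (s (+) e) k p ->
  eigenop s *: raised (s (+) e) e n p = kc (eigenval e k n) *: raised (s (+) e) e n p.
Proof.
move=> [hp tp]; set v := raised _ _ _ _.
have hv : deg (k + n.*2 + e) v.
  rewrite /v /raised -addnA [(_ + e)%N]addnC addnA; apply: deg_En.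
  by case: (e); rewrite ?addn1 ?addn0 //; apply: deg_z.
rewrite /eigenop scalerDl scale_hc (hH_deg m_gt0 N_tau hv) /eigenval [in RHS]palg_cstD scalerDl.
congr (_ + _); last by rewrite scalerA -palg_cstM.
rewrite {hv}/v /raised; set y := if e then _ else _.
have ey : t s *: y = kc (if e then lam k else 0) *: (if e then p else y).
  rewrite /y; case: (e) tp => tp; last by rewrite palg_cst0 scale0r -tp addbF.
  have := lower_raise m_gt0 N_tau hp tp; by rewrite addbT !negbK.
have zy : kc (if e then lam k else 0) *: (z s *: (if e then p else y))
    = kc (if e then lam k else 0) *: y.
  rewrite /y; case: (e); first by rewrite addbT negbK.
  by rewrite palg_cst0 !scale0r.
rewrite -hevXn -scalerA [t s *: _]scalerA t_hev // scalerDl scalerDr addrC palg_cstD scalerDl.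
congr (_ + _).
  rewrite derivXn -scaler_nat hevZ palg_scaleAl scale_hc kcZ_comm; case: (n) => [|n'].
    by rewrite palg_cst0 !scale0r.
  congr (_ *: _); rewrite scalerA mulrA hev_z -mulrA -(hEE_b c s) -hevMX -exprSr.
  by [].
by rewrite scalerA mulrA hev_z -!scalerA ey kcZ_comm zy kcZ_comm.
Qed.

(** The real and imaginary parts determine n + e lam k and k + 2 n + e. If e and e' differ, say
    e = 0 and e' = 1, then n > n' + k', and this contradicts k + 2 n = k' + 2 n' + 1. *)
Lemma eigenval_inj e e' k k' n n' : eigenval e k n = eigenval e' k' n' ->
  [/\ e = e', k = k' & n = n'].
Proof.
have rlam i : lam i \is Num.real by rewrite ger0_real // ltW // (lam_gt0 N_lt1).
have rif (b : bool) i : (if b then lam i else 0) \is Num.real by case: b; rewrite ?real0.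
have rn i j b : j%:R + (if b then lam i else 0) \is Num.real by rewrite realD // realn.
rewrite /eigenval => e1; have := congr1 (fun x : C => 'Re x) e1; have := congr1 (fun x : C => 'Im x) e1.
rewrite /= !Re_rect ?Im_rect ?rlam ?rn // => /lam_inj h.
have lt_lam (a b i : nat) : a%:R = b%:R + lam i -> (b + i < a)%N.
  move=> ab; rewrite -(ltr_nat C) ab natrD ltrD2l /lam -addrA ltrDl //.
have eq_lam (a b i j : nat) : a%:R + lam i = b%:R + lam j -> (a + i = b + j)%N.
  rewrite /lam !addrA -!natrD => /addIr /addIr /eqP; rewrite eqr_nat => /eqP //.
case: e e' h {e1} => [] [] h; rewrite ?addr0.
- by move=> /eq_lam e; split; lia.
- by move=> /esym/lt_lam e; lia.
- by move=> /lt_lam e; lia.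
by move=> /eqP; rewrite eqr_nat => /eqP e; split; lia.
Qed.

Lemma raised_inj l e n p : raised l e n p = 0 -> p = 0.
Proof.
move=> /(En_inj m_gt0 c_conj); case: e => //.
exact: (z_inj m_gt0 c_conj).
Qed.

Lemma Phi_ker x : Phi x = 0 -> x = 0.
Proof.
have [F mF [B0 /(_ B0 (leqnn _)) ex]] := dsum_normal x => Px.
pose T l e := \sum_(k < B0) \sum_(n < B0) raised l e n (F l e k n).
have Phi_sum I (r : seq I) (f : I -> DS) : Phi (\sum_(i <- r) f i) = \sum_(i <- r) Phi (f i).
  exact: (big_morph Phi PhiD Phi0).
have {Px} : \sum_l \sum_e ket (l (+) e) (T l e) = 0.
  rewrite -[RHS]Px ex Phi_sum; apply: eq_bigr => l _; rewrite Phi_sum; apply: eq_bigr => e _.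
  rewrite Phi_sum ket_sum; apply: eq_bigr => k _; rewrite Phi_sum ket_sum; apply: eq_bigr => n _.
  by rewrite Phi_dbasis.
rewrite !big_bool /= => hT.
have /ket_sum_inj [T0 T1] : ket false (T true true + T false false) +
    ket (~~ false) (T true false + T false true) = 0.
  by rewrite !ketD /= -[RHS]hT; zmod_ring.
have {T0 T1 hT} Ts s : \sum_e T (s (+) e) e = 0 by rewrite big_bool; case: s; rewrite //= addrC.
pose I := (bool * ('I_B0 * 'I_B0))%type.
have F0 l e (k n : 'I_B0) : F l e k n = 0.
  have [s ->] : exists s, l = s (+) e by exists (l (+) e); rewrite -addbA addbb addbF.
  pose v (i : I) := raised (s (+) i.1) i.1 i.2.2 (F (s (+) i.1) i.1 i.2.1 i.2.2).
  apply: (@raised_inj (s (+) e) e n); apply: (eigen_indep (T := eigenop s) (I := I)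
    (a := fun i : I => eigenval i.1 i.2.1 i.2.2) (v := v) _ _ _ (e, (k, n))).
  - move=> [e1 [k1 n1]] [e2 [k2 n2]] /eigenval_inj /= [-> h1 h2].
    by congr (_, (_, _)); apply: val_inj.
  - by move=> i; apply: eigenopP.
  rewrite -[RHS](Ts s) /T; under [RHS]eq_bigr do rewrite pair_bigA.
  by rewrite pair_bigA.
rewrite ex big1 // => l _; rewrite big1 // => e _; rewrite big1 // => k _.
by rewrite big1 // => n _; rewrite F0 dbasis0.
Qed.

Lemma Phi_bij : bijective Phi.
Proof.
have /choice [g gK] := Phi_surj; exists g => // x.
apply/eqP; rewrite -subr_eq0; apply/eqP/Phi_ker.
by rewrite PhiD -[- x]scaleN1r -[-1 *: x]addr0 PhiP Phi0 addr0 HCcstN1 scaleN1r gK subrr.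
Qed.

Lemma Phi_iso : u21_iso Phi.
Proof.
split; [exact: PhiP | exact: Phi_bij | exact: Phi_intertwines | exact: Phi_part].
Qed.

End DirectSum.

(** * The angular operator *)

Section Angular.
Variables (R : realType) (m : nat) (c : dihedral m -> R[i]).
Local Notation C := R[i].
Local Notation G := (dihedral m).
Hypothesis m_gt0 : (0 < m)%N.
Hypothesis c_conj : forall (j : nat) (g : G), c (refl m j ^ g)%g = c (refl m j).
Local Notation Hc := (cherednik c).
Local Notation z b := (hEd c (zrow R b)).
Local Notation t b := (hE c (zcol R b)).
Local Notation sg := (h_sigma c).
Local Notation tw b := (sigma_tw c b).
Local Notation EE := (hEE c).

(** For c = 0 this is z d/dz - zbar d/dzbar, the infinitesimal rotation. It is locked, as rewriting
    would otherwise unfold it. *)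
Definition ang : Hc := locked (z false * t false - z true * t true + sg).

Lemma angE : ang = z false * t false - z true * t true + sg.
Proof. by rewrite /ang -lock. Qed.

Lemma ang_z0 : ang * z false = z false * ang + z false - (z false * sg + z false * sg).
Proof.
rewrite angE [in LHS]mulrDl [in LHS]mulrBl -!mulrA t_z_same // (t_z_diff c m_gt0 true).
rewrite sg_z //= !mulrDr !mulrN mulr1 !mulrA (z_comm c true false); zmod_ring.
Qed.

Lemma ang_z1 : ang * z true = z true * ang - z true + (z false * tw true + z false * tw true).
Proof.
rewrite angE [in LHS]mulrDl [in LHS]mulrBl -!mulrA t_z_same // (t_z_diff c m_gt0 false).
rewrite sg_z //= !mulrDr !mulrN mulr1 !mulrA (z_comm c true false); zmod_ring.
Qed.

Lemma zt_g b g : hG c g * (z b * t b) = z (b (+) g.2) * t (b (+) g.2) * hG c g.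
Proof.
rewrite mulrA hG_z // palg_scaleAl -[_ * hG c g * _]mulrA hG_t palg_scaleAr scalerA -[RHS]mulrA.
have := phaseV R m_gt0 (b (+) g.2) g; rewrite -addbA addbb addbF => e.
by rewrite mulrC e scale1r.
Qed.

Lemma ang_g g : ang * hG c g =
  if g.2 then (sg * hG c g + sg * hG c g) - hG c g * ang else hG c g * ang.
Proof.
rewrite angE !mulrDl !mulNr !mulrDr !mulrN hG_sg // !zt_g.
by case: g.2 => //=; zmod_ring.
Qed.

Lemma ang_E : ang * EE = EE * ang.
Proof.
have zt b : z b * t b * EE = EE * (z b * t b) + EE.
  by rewrite -mulrA t_E // mulrDr -(hEE_b c b) mulrA E_z -mulrA.
have sE : sg * EE = EE * sg.
  rewrite h_sigmaE // mulr_suml mulr_sumr; apply: eq_bigr => g _.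
  by rewrite palg_scaleAl palg_scaleAr E_g.
by rewrite angE !mulrDl !mulNr !mulrDr !mulrN sE !zt; zmod_ring.
Qed.

(** The span of the products of coordinates with rotations, resp. reflections. *)
Inductive fld : bool -> Hc -> Prop :=
| fld_g g : fld g.2 (hG c g)
| fldD e x y : fld e x -> fld e y -> fld e (x + y)
| fldZ e k x : fld e x -> fld e (k *: x)
| fld_z e b x : fld e x -> fld e (z b * x).

(** Weight i: the exponent of z minus that of zbar is i. *)
Inductive wt : bool -> int -> Hc -> Prop :=
| wt_g g : wt g.2 0 (hG c g)
| wtZ e i k x : wt e i x -> wt e i (k *: x)
| wt_z e i b x : wt e i x -> wt e (i + (if b then -1 else 1)) (z b * x).

Lemma fld0 e : fld e 0.
Proof. by rewrite -(scale0r (hG c ((0, e) : G))); apply/fldZ/(fld_g (0, e)). Qed.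
Lemma fldN e x : fld e x -> fld e (- x).
Proof. by rewrite -scaleN1r; apply: fldZ. Qed.
Lemma fld1 : fld false 1.
Proof. by have := fld_g (1%g : G); rewrite hG1. Qed.
Lemma fld_sum e I (r : seq I) (P : pred I) (F : I -> Hc) :
  (forall i, P i -> fld e (F i)) -> fld e (\sum_(i <- r | P i) F i).
Proof. by move=> h; apply: big_ind => //; [apply: fld0 | apply: fldD]. Qed.

Lemma fld_gl g e x : fld e x -> fld (g.2 (+) e) (hG c g * x).
Proof.
elim=> {e x} [g'|e x y _ IHx _ IHy|e k x _ IH|e b x _ IH].
- by have := fld_g ((g : G) * (g' : G))%g; rewrite hGM.
- by rewrite mulrDr; apply: fldD.
- by rewrite palg_scaleAr; apply: fldZ.
by rewrite mulrA hG_z // palg_scaleAl -mulrA; apply/fldZ/fld_z.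
Qed.

Lemma fldM e x e' y : fld e x -> fld e' y -> fld (e (+) e') (x * y).
Proof.
move=> hx hy; elim: hx => {e x} [g|e x x' _ IHx _ IHy|e k x _ IH|e b x _ IH].
- exact: fld_gl.
- by rewrite mulrDl; apply: fldD.
- by rewrite palg_scaleAl; apply: fldZ.
by rewrite -mulrA; apply: fld_z.
Qed.

Lemma fld_zz b : fld false (z b).
Proof. by rewrite -[z b]mulr1; apply/fld_z/fld1. Qed.
Lemma fld_sg : fld true sg.
Proof.
rewrite h_sigmaE //; apply: fld_sum => g g2; apply: fldZ.
by have := fld_g g; rewrite g2.
Qed.
Lemma fld_tw b : fld true (tw b).
Proof.
rewrite /sigma_tw; apply: fld_sum => g g2; apply: fldZ.
by have := fld_g g; rewrite g2.
Qed.

Lemma wt_fld e i x : wt e i x -> fld e x.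
Proof.
elim=> {e i x} [g|e i k x _ IH|e i b x _ IH].
- exact: fld_g.
- exact: fldZ.
exact: fld_z.
Qed.

Lemma fld_wt e x : fld e x -> exists2 s : seq (int * Hc),
  {in s, forall a, wt e a.1 a.2} & x = \sum_(a <- s) a.2.
Proof.
elim=> {e x} [g|e x y _ [s hs ->] _ [s' hs' ->]|e k x _ [s hs ->]|e b x _ [s hs ->]].
- exists [:: (0, hG c g)]; last by rewrite big_seq1.
  by move=> a; rewrite inE => /eqP->; apply: wt_g.
- exists (s ++ s'); last by rewrite big_cat.
  by move=> a; rewrite mem_cat => /orP[/hs|/hs'].
- exists [seq (a.1, k *: a.2) | a <- s]; last by rewrite big_map scaler_sumr.
  by move=> _ /mapP[a /hs ha ->]; apply: wtZ.
exists [seq (a.1 + (if b then -1 else 1), z b * a.2) | a <- s]; last first.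
  by rewrite big_map mulr_sumr.
by move=> _ /mapP[a /hs ha ->]; apply: wt_z.
Qed.

(** The reflections anticommute with ang to leading order, and the deformation terms contain one
    more reflection. *)
Lemma ang_wt e i x : wt e i x -> exists2 y, fld (~~ e) y &
  ang * x = (-1) ^+ e *: (x * ang) + i%:~R *: x + y.
Proof.
elim=> {e i x} [g|e i k x _ [y hy ey]|e i b x hx [y hy ey]].
- rewrite ang_g scale0r addr0; have := fld_g g; case: g.2 => hg.
    exists (sg * hG c g + sg * hG c g); last by rewrite expr1 scaleN1r addrC.
    by apply: fldD; apply: (fldM fld_sg hg).
  by exists 0; [apply: fld0 | rewrite expr0 scale1r addr0].
- exists (k *: y); first exact: fldZ.
  rewrite palg_scaleAr ey palg_scaleAl !scalerDr !scalerA.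
  by rewrite ![k * _]mulrC.
have {}hx := wt_fld hx.
have [o ho eo] : exists2 o, fld true o & ang * z b = z b * ang + (-1) ^+ b *: z b + o.
  case: b.
    exists (z false * tw true + z false * tw true); last by rewrite ang_z1 expr1 scaleN1r.
    by apply: fldD; apply/fld_z/fld_tw.
  exists (- (z false * sg + z false * sg)); last by rewrite ang_z0 expr0 scale1r.
  by apply: fldN; apply: fldD; apply/fld_z/fld_sg.
exists (z b * y + o * x); first by apply: fldD; [apply: fld_z | exact: (fldM ho hx)].
rewrite mulrA eo !mulrDl -[_ * ang * x]mulrA ey !mulrDr !palg_scaleAr palg_scaleAl !mulrA.
rewrite intrD scalerDl (_ : (if b then -1 else 1)%:~R = (-1) ^+ b); last by case: b {eo}.
zmod_ring.
Qed.

Lemma ang_wts e (s : seq (int * Hc)) : {in s, forall a, wt e a.1 a.2} ->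
  exists2 y, fld (~~ e) y & ang * (\sum_(a <- s) a.2) =
    (-1) ^+ e *: ((\sum_(a <- s) a.2) * ang) + \sum_(a <- s) a.1%:~R *: a.2 + y.
Proof.
elim: s => [|a s IH] hs.
  by exists 0; [exact: fld0 | rewrite !big_nil mulr0 mul0r scaler0 !addr0].
have [|y hy e1] := IH; first by move=> b bs; apply: hs; rewrite inE bs orbT.
have [y' hy' e2] := ang_wt (hs a (mem_head _ _)).
exists (y' + y); first exact: fldD.
by rewrite !big_cons mulrDr mulrDl scalerDr e1 e2; zmod_ring.
Qed.

Lemma ang_fld e x : fld e x -> exists x' y, [/\ fld e x', fld (~~ e) y &
  ang * x = (-1) ^+ e *: (x * ang) + x' + y].
Proof.
move=> /fld_wt [s hs ->]; have [y hy ey] := ang_wts hs.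
exists (\sum_(a <- s) a.1%:~R *: a.2), y; split=> //.
by rewrite big_seq; apply: fld_sum => a /hs /wt_fld; apply: fldZ.
Qed.

Lemma rot_expm (g : G) : g.2 = false -> (g ^+ m)%g = 1%g.
Proof.
case: g => k [] //= _.
have e n : (((k, false) : G) ^+ n)%g = (k *+ n, false).
  by elim: n => [|n IH]; rewrite ?expg0 // expgS IH mulrS.
by rewrite e; congr pair; apply: val_inj; rewrite /= Zp_mulrn /= -[X in (_ * X)%N](prednK m_gt0) modnMl.
Qed.

Lemma phase_rot_exp b (g : G) n : g.2 = false -> phase R b (g ^+ n)%g = phase R b g ^+ n.
Proof.
move=> g2; elim: n => [|n IH]; first by rewrite expg0 expr0 phase1.
by rewrite expgS phaseM // g2 addbF IH exprS.
Qed.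

Lemma phase_expm b (g : G) : phase R b g ^+ m = 1.
Proof.
have rot b' (x : G) : x.2 = false -> phase R b' x ^+ m = 1.
  by move=> x2; rewrite -phase_rot_exp // rot_expm // phase1.
case g2 : g.2; last exact: rot.
have e : phase R b g = phase R (~~ b) (s0 m * g)%g by rewrite phaseM // phase_s0 mul1r addbT negbK.
by rewrite e rot // dihM2 g2.
Qed.

Lemma hG_zn g b n : hG c g * z b ^+ n = phase R b g^-1%g ^+ n *: (z (b (+) g.2) ^+ n * hG c g).
Proof.
elim: n => [|n IH]; first by rewrite !expr0 mulr1 mul1r scale1r.
rewrite exprS mulrA hG_z // palg_scaleAl -[_ * hG c g * _]mulrA IH palg_scaleAr scalerA mulrA -exprS.
by rewrite -exprS.
Qed.

(** Invariant under G; the next polynomial is invariant under the rotations and negated by the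
    reflections. *)
Definition ez : Hc := locked (z false ^+ m + z true ^+ m).
Definition del : Hc := locked (z false ^+ m - z true ^+ m).
Lemma ezE b : ez = z b ^+ m + z (~~ b) ^+ m.
Proof. by rewrite /ez -lock; case: b; rewrite //= addrC. Qed.
Lemma delE : del = z false ^+ m - z true ^+ m.
Proof. by rewrite /del -lock. Qed.

Lemma z_commX b b' n : z b ^+ n * z b' = z b' * z b ^+ n.
Proof. by apply/esym/commrX; rewrite /GRing.comm z_comm. Qed.

Lemma ez_fld e x : fld e x -> ez * x = x * ez.
Proof.
elim=> {e x} [g|e x y _ IHx _ IHy|e k x _ IH|e b x _ IH].
- rewrite (ezE false) mulrDr !hG_zn !phase_expm !scale1r -mulrDl; congr (_ * _).
  by case: g.2; rewrite //= addrC.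
- by rewrite mulrDr mulrDl IHx IHy.
- by rewrite palg_scaleAr palg_scaleAl IH.
rewrite -mulrA -IH !mulrA; congr (_ * _); rewrite (ezE b) mulrDr mulrDl -exprSr exprS.
by rewrite z_commX.
Qed.

Lemma del_fld e x : fld e x -> del * x = (-1) ^+ e *: (x * del).
Proof.
elim=> {e x} [g|e x y _ IHx _ IHy|e k x _ IH|e b x _ IH].
- rewrite delE mulrBr !hG_zn !phase_expm !scale1r -mulrBl.
  case: g.2 => /=; last by rewrite expr0 scale1r.
  by rewrite expr1 scaleN1r -mulNr opprB.
- by rewrite mulrDr mulrDl scalerDr IHx IHy.
- by rewrite palg_scaleAr palg_scaleAl IH !scalerA mulrC.
rewrite mulrA (_ : del * z b = z b * del).
  by rewrite -!mulrA IH palg_scaleAr.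
by rewrite delE mulrBl mulrBr !z_commX.
Qed.

Lemma fld_zn b n : fld false (z b ^+ n).
Proof.
elim: n => [|n IH]; first exact: fld1.
by rewrite exprS; apply: fld_z.
Qed.

Lemma fld_del : fld false del.
Proof. by rewrite delE; apply: fldD; [|apply: fldN]; apply: fld_zn. Qed.

(** The divided difference of z_b^n along the root of the reflection which maps
    z_b to x times its conjugate. *)
Fixpoint divdiff b (x : C) n : Hc :=
  if n is n'.+1 then z b * divdiff b x n' + x ^+ n' *: z (~~ b) ^+ n' else 0.

Lemma divdiffS b x n : divdiff b x n.+1 = x *: (z (~~ b) * divdiff b x n) + z b ^+ n.
Proof.
have dS k : divdiff b x k.+1 = z b * divdiff b x k + x ^+ k *: z (~~ b) ^+ k by [].
elim: n => [|n IH]; first by rewrite /= !mulr0 scaler0 !expr0 scale1r.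
rewrite dS [in LHS]IH dS.
rewrite !mulrDr !palg_scaleAr !scalerDr !mulrA (z_comm c b (~~ b)) scalerA -!exprS; zmod_ring.
Qed.

(** Moving t_b past z_b produces the term - sigma, and the reflections in it have to be moved past
    the remaining powers. *)
Lemma t_zn b n : t b * z b ^+ n = z b ^+ n * t b + n%:R *: z b ^+ n.-1
  - \sum_(g : G | g.2) c g *: (divdiff b (phase R b g) n * hG c g).
Proof.
elim: n => [|n IH].
  rewrite !expr0 mulr1 mul1r scale0r addr0 big1 ?subr0 // => g _.
  by rewrite mul0r scaler0.
rewrite exprS mulrA t_z_same // mulrBl mulrDl mul1r -[z b * t b * _]mulrA IH.
rewrite [z b * (_ - _)]mulrBr [z b * (_ + _)]mulrDr palg_scaleAr [z b * (_ * t b)]mulrA -[z b * z b ^+ n]exprS.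
have -> : sg * z b ^+ n = \sum_(g : G | g.2) c g *: (phase R b g ^+ n *: (z (~~ b) ^+ n * hG c g)).
  rewrite h_sigmaE // mulr_suml; apply: eq_bigr => g g2.
  by rewrite palg_scaleAl hG_zn g2 addbT; case: g g2 => k [].
set u := _ ^+ n.+1 * t b; set v := n%:R *: _.
have ev : v + z b ^+ n = n.+1%:R *: z b ^+ n.+1.-1.
  rewrite /v; case: (n) => [|n']; first by rewrite scale0r add0r scale1r.
  by rewrite -exprS -[in RHS]natr1 scalerDl scale1r.
rewrite -[in RHS]ev mulr_sumr.
rewrite [X in _ = _ - X](_ : _ = \sum_(g : G | g.2) z b * (c g *: (divdiff b (phase R b g) n * hG c g))
    + \sum_(g : G | g.2) c g *: (phase R b g ^+ n *: (z (~~ b) ^+ n * hG c g))).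
  by zmod_ring.
rewrite -big_split; apply: eq_bigr => g _ /=.
by rewrite palg_scaleAr -scalerDr mulrDl mulrA palg_scaleAl.
Qed.

Lemma t_zn' b n : t b * z (~~ b) ^+ n = z (~~ b) ^+ n * t b +
  \sum_(g : G | g.2) c g *: (phase R (~~ b) g ^+ n *: (divdiff b (phase R b g) n * hG c g)).
Proof.
elim: n => [|n IH].
  rewrite !expr0 mulr1 mul1r big1 ?addr0 // => g _.
  by rewrite mul0r !scaler0.
rewrite exprS mulrA t_z_diff // mulrDl -[z (~~ b) * t b * _]mulrA IH mulrDr [z (~~ b) * (_ * t b)]mulrA.
rewrite -[z (~~ b) * _ ^+ n]exprS -addrA; congr (_ + _).
rewrite /sigma_tw mulr_suml mulr_sumr -big_split; apply: eq_bigr => g g2 /=.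
rewrite palg_scaleAl hG_zn g2 addbT negbK palg_scaleAr -scalerA -scalerDr; congr (_ *: _).
rewrite palg_scaleAr -[z b * _ + _]/(divdiff b (phase R b g) n.+1) divdiffS mulrDl [in RHS]scalerDr mulrA.
have e1 : phase R (~~ b) g * phase R b g = 1 by rewrite mulrC phase_conj.
congr (_ + _).
  set w := z (~~ b) * _.
  transitivity (phase R (~~ b) g ^+ n.+1 *: (phase R b g *: (w * hG c g))).
    by rewrite scalerA exprSr -mulrA e1 mulr1.
  by congr (_ *: _); apply/esym/palg_scaleAl.
by rewrite scalerA exprS; case: g g2 {e1} => k [].
Qed.

(** For n = m the divided differences in [t_zn] and [t_zn'] cancel, since the phases are m-th roots
    of unity. *)
Lemma t_ez b : t b * ez = ez * t b + m%:R *: z b ^+ m.-1.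
Proof.
rewrite (ezE b) mulrDr t_zn t_zn'.
under [X in _ + (_ + X)]eq_bigr do rewrite phase_expm scale1r.
by rewrite mulrDl; zmod_ring.
Qed.

Lemma ang_ez : ang * ez = ez * ang + m%:R *: del.
Proof.
have zt b : z b * t b * ez = ez * (z b * t b) + m%:R *: z b ^+ m.
  rewrite -mulrA t_ez mulrDr palg_scaleAr -exprS prednK // !mulrA; congr (_ * _ + _).
  by rewrite (ez_fld (fld_zz b)).
by rewrite angE !mulrDl !mulNr !mulrDr !mulrN -(ez_fld fld_sg) !zt delE scalerBr; zmod_ring.
Qed.

End Angular.

(** * Polynomials in the angular operator *)

Section Filtration.
Variables (R : realType) (m : nat) (c : dihedral m -> R[i]).
Local Notation C := R[i].
Local Notation G := (dihedral m).
Variables (d : nat) (tau : mx_representation C [set: G]%G d).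
Hypothesis m_gt0 : (0 < m)%N.
Hypothesis c_conj : forall (j : nat) (g : G), c (refl m j ^ g)%g = c (refl m j).
Local Notation M := (stdmod c tau).
Local Notation Hc := (cherednik c).
Local Notation z b := (hEd c (zrow R b)).
Local Notation ang := (ang c).
Local Notation fld := (@fld R m c).
Local Notation ez := (ez c).
Local Notation del := (del c).

(** The elements of C[z, zbar] x| G. *)
Definition F0 (x : Hc) := exists a b, [/\ fld false a, fld true b & x = a + b].

Lemma F0_fld e x : fld e x -> F0 x.
Proof.
case: e => hx; first by exists 0, x; split; rewrite ?add0r //; apply: fld0.
by exists x, 0; split; rewrite ?addr0 //; apply: fld0.
Qed.
Lemma F00 : F0 0. Proof. exact/F0_fld/(fld0 c false). Qed.
Lemma F0D x y : F0 x -> F0 y -> F0 (x + y).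
Proof.
move=> [a [b [ha hb ->]]] [a' [b' [ha' hb' ->]]].
by exists (a + a'), (b + b'); split; [exact: fldD | exact: fldD | zmod_ring].
Qed.
Lemma F0Z k x : F0 x -> F0 (k *: x).
Proof.
move=> [a [b [ha hb ->]]].
by exists (k *: a), (k *: b); split; [exact: fldZ | exact: fldZ | rewrite scalerDr].
Qed.
Lemma F0N x : F0 x -> F0 (- x).
Proof. by rewrite -scaleN1r; apply: F0Z. Qed.
Lemma F0M x y : F0 x -> F0 y -> F0 (x * y).
Proof.
move=> [a [b [ha hb ->]]] [a' [b' [ha' hb' ->]]].
rewrite mulrDl !mulrDr.
by apply: F0D; apply: F0D;
  [exact: (F0_fld (fldM ha ha')) | exact: (F0_fld (fldM ha hb'))
  | exact: (F0_fld (fldM hb ha')) | exact: (F0_fld (fldM hb hb'))].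
Qed.

Lemma F0_ang x : F0 x -> exists x1 x2, [/\ F0 x1, F0 x2 & ang * x = x1 * ang + x2].
Proof.
move=> [a [b [ha hb ->]]].
have [a' [y [ha' hy ea]]] := ang_fld m_gt0 c_conj ha.
have [b' [y' [hb' hy' eb]]] := ang_fld m_gt0 c_conj hb.
exists (a - b), (a' + y + (b' + y')); split.
- by apply: F0D; [exact: (F0_fld ha) | exact/F0N/(F0_fld hb)].
- apply: F0D; apply: F0D;
  [exact: (F0_fld ha') | exact: (F0_fld hy) | exact: (F0_fld hb') | exact: (F0_fld hy')].
by rewrite mulrDr ea eb expr0 expr1 scale1r scaleN1r mulrBl; zmod_ring.
Qed.

Lemma ez_F0 x : F0 x -> ez * x = x * ez.
Proof. by move=> [a [b [ha hb ->]]]; rewrite mulrDr mulrDl !(ez_fld m_gt0 ha, ez_fld m_gt0 hb). Qed.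

(** The polynomials in ang of degree less than n, with coefficients in F0 on the left. *)
Definition fil n (X : Hc) := exists2 D : nat -> Hc,
  forall i, F0 (D i) & X = \sum_(i < n) D i * ang ^+ i.

Lemma fil0 n : fil n 0.
Proof.
exists (fun=> 0); first by move=> _; apply: F00.
by rewrite big1 // => i _; rewrite mul0r.
Qed.
Lemma filD n X Y : fil n X -> fil n Y -> fil n (X + Y).
Proof.
move=> [D hD ->] [D' hD' ->]; exists (fun i => D i + D' i); first by move=> i; apply: F0D.
by rewrite -big_split; apply: eq_bigr => i _; rewrite mulrDl.
Qed.
Lemma fil_l n x X : F0 x -> fil n X -> fil n (x * X).
Proof.
move=> hx [D hD ->]; exists (fun i => x * D i); first by move=> i; apply: F0M.
by rewrite mulr_sumr; apply: eq_bigr => i _; rewrite mulrA.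
Qed.
Lemma filZ n k X : fil n X -> fil n (k *: X).
Proof.
move=> [D hD ->]; exists (fun i => k *: D i); first by move=> i; apply: F0Z.
by rewrite scaler_sumr; apply: eq_bigr => i _; rewrite palg_scaleAl.
Qed.
Lemma filN n X : fil n X -> fil n (- X).
Proof. by rewrite -scaleN1r; apply: filZ. Qed.
Lemma fil_top n x X : F0 x -> fil n X -> fil n.+1 (x * ang ^+ n + X).
Proof.
move=> hx [D hD ->]; exists (fun i => if (i == n)%N then x else D i).
  by move=> i; case: ifP.
rewrite big_ord_recr /= eqxx addrC; congr (_ + _); apply: eq_bigr => i _.
by rewrite ltn_eqF.
Qed.
Lemma fil_inv n X : fil n.+1 X -> exists x Y, [/\ F0 x, fil n Y & X = x * ang ^+ n + Y].
Proof.
move=> [D hD ->]; exists (D n), (\sum_(i < n) D i * ang ^+ i); split=> //.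
  by exists D.
by rewrite big_ord_recr addrC.
Qed.
Lemma fil_0inv X : fil 0 X -> X = 0.
Proof. by move=> [D _ ->]; rewrite big_ord0. Qed.
Lemma filS n X : fil n X -> fil n.+1 X.
Proof. by move=> h; rewrite -[X]add0r -(mul0r (ang ^+ n)); apply: fil_top => //; apply: F00. Qed.
Lemma fil_mono n n' X : (n <= n')%N -> fil n X -> fil n' X.
Proof.
move=> nn' h; rewrite -(subnKC nn'); elim: (n' - n)%N => [|k IH]; first by rewrite addn0.
by rewrite addnS; apply: filS.
Qed.

Lemma fil_ang n X : fil n X -> fil n.+1 (ang * X).
Proof.
elim: n X => [|n IH] X; first by move=> /fil_0inv ->; rewrite mulr0; apply: fil0.
move=> /fil_inv [x [Y [hx hY ->]]]; have [x1 [x2 [h1 h2 e]]] := F0_ang hx.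
rewrite mulrDr mulrA e mulrDl -[x1 * ang * _]mulrA -exprS -addrA.
apply: fil_top => //; apply: filD; last exact: IH.
by rewrite -[_ * _]addr0; apply: fil_top => //; apply: fil0.
Qed.

Lemma pow_ez n : exists2 Y, fil n Y &
  ang ^+ n.+1 * ez = ez * ang ^+ n.+1 + (n.+1%:R * m%:R) *: (del * ang ^+ n) + Y.
Proof.
elim: n => [|n [Y hY e]].
  by exists 0; [exact: fil0 | rewrite expr1 expr0 mulr1 mul1r addr0 ang_ez].
have [x [y [hx hy ed]]] := ang_fld m_gt0 c_conj (fld_del c).
exists ((n.+1%:R * m%:R) *: ((x + y) * ang ^+ n) + ang * Y).
  apply: filD; last exact: fil_ang.
  apply: filZ; rewrite -[_ * _]addr0; apply: fil_top; last exact: fil0.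
  by apply: F0D; [exact: (F0_fld hx) | exact: (F0_fld hy)].
have -> : n.+2%:R * m%:R = m%:R + n.+1%:R * m%:R :> C by rewrite -[n.+2%:R]natr1 mulrDl mul1r addrC.
move: (n.+1%:R * m%:R) e => k e.
rewrite exprS -mulrA e !mulrDr !palg_scaleAr mulrA ang_ez // mulrDl palg_scaleAl -!mulrA -exprS.
rewrite [ang * (del * _)]mulrA ed expr0 scale1r !mulrDl -mulrA -exprS.
rewrite !scalerDl !scalerDr; zmod_ring.
Qed.

Lemma fil_ez n Y : fil n.+1 Y -> exists2 Y', fil n Y' & Y * ez = ez * Y + Y'.
Proof.
elim: n Y => [|n IH] Y /fil_inv [x [Y0 [hx hY ->]]].
  rewrite (fil_0inv hY) addr0 expr0 mulr1; exists 0; first exact: fil0.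
  by rewrite addr0 ez_F0.
have [Y1 h1 e1] := pow_ez n; have [Y2 h2 e2] := IH _ hY.
exists (x * ((n.+1%:R * m%:R) *: (del * ang ^+ n) + Y1) + Y2).
  apply: filD; last exact: filS.
  apply: fil_l => //; rewrite -palg_scaleAl; apply: fil_top => //.
  exact/F0Z/(F0_fld (fld_del c)).
rewrite mulrDl -mulrA e1 e2 -addrA; set w := _ *: _ + Y1.
by rewrite [x * _]mulrDr [ez * (_ + _)]mulrDr !mulrA (ez_F0 hx); zmod_ring.
Qed.

(** The elements which act as zero on M. *)
Definition nul (X : Hc) := forall p : M, X *: p = 0.

Lemma nulD X Y : nul X -> nul Y -> nul (X + Y).
Proof. by move=> hX hY p; rewrite scalerDl hX hY addr0. Qed.
Lemma nulZ k X : nul X -> nul (k *: X).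
Proof. by move=> hX p; rewrite scale_hc hX scaler0. Qed.
Lemma nulN X : nul X -> nul (- X).
Proof. by move=> hX p; rewrite scaleNr hX oppr0. Qed.
Lemma nul_l x X : nul X -> nul (x * X).
Proof. by move=> hX p; rewrite -scalerA hX scaler0. Qed.
Lemma nul_r x X : nul X -> nul (X * x).
Proof. by move=> hX p; rewrite -scalerA. Qed.
Lemma nulZ_inv k X : k != 0 -> nul (k *: X) -> nul X.
Proof. by move=> k0 h p; apply: (kc_inj k0); rewrite -scale_hc. Qed.

Lemma mcoord_zn b n i j (p : M) : mcoord i j (z b ^+ n *: p) =
  if b then (if (n <= j)%N then mcoord i (j - n)%N p else 0)
  else (if (n <= i)%N then mcoord (i - n)%N j p else 0).
Proof.
elim: n i j => [|n IH] i j; first by rewrite expr0 scale1r !subn0; case: b.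
rewrite exprS -scalerA mcoord_z //; case: b IH => IH; first by case: j => [|j] //; rewrite IH.
by case: i => [|i] //; rewrite IH.
Qed.

Lemma del_inj (p : M) : del *: p = 0 -> p = 0.
Proof.
rewrite delE scalerBl => /eqP; rewrite subr_eq0 => /eqP e.
apply: (mcoord_eq0 m_gt0 c_conj) => i j; elim/ltn_ind: j i => j IH i.
have := congr1 (mcoord (i + m) j) e; rewrite !mcoord_zn leq_addl addnK => ->.
by case: leqP => // mj; apply: IH; lia.
Qed.

Lemma nul_del X : nul (del * X) -> nul X.
Proof. by move=> h p; apply: del_inj; rewrite scalerA. Qed.

(** Multiplication by del from the left and from the right agrees on the first part and differs by
    a sign on the second one. *)
Lemma nul_parity a b : fld false a -> fld true b -> nul (a + b) -> nul a /\ nul b.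
Proof.
move=> ha hb h; have h' : nul (a - b).
  apply: nul_del; rewrite mulrBr (del_fld m_gt0 ha) (del_fld m_gt0 hb).
  rewrite expr0 expr1 scale1r scaleN1r opprK -mulrDl; exact: nul_r.
have two0 : 2 != 0 :> C by rewrite pnatr_eq0.
split; apply: (nulZ_inv two0); rewrite scalerDl scale1r.
  rewrite (_ : a + a = (a + b) + (a - b)); last by zmod_ring.
  exact: nulD.
rewrite (_ : b + b = (a + b) + - (a - b)); last by zmod_ring.
by apply: nulD => //; apply: nulN.
Qed.

(** The commutator with ez lowers n by one and multiplies the top coefficient by a nonzero multiple
    of del. *)
Lemma nul_top n x Y : F0 x -> fil n Y -> nul (x * ang ^+ n + Y) -> nul x.
Proof.
elim: n x Y => [|n IH] x Y hx hY h.
  by move: h; rewrite (fil_0inv hY) expr0 mulr1 addr0.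
have [Y1 h1 e1] := pow_ez n; have [Y2 h2 e2] := fil_ez hY.
have : nul ((x * ((n.+1%:R * m%:R) *: del)) * ang ^+ n + (x * Y1 + Y2)).
  rewrite (_ : _ + _ = (x * ang ^+ n.+1 + Y) * ez + - (ez * (x * ang ^+ n.+1 + Y))).
    by apply: nulD; [exact: nul_r | exact/nulN/nul_l].
  rewrite [RHS](_ : _ = x * (ang ^+ n.+1 * ez) + Y * ez - (x * (ez * ang ^+ n.+1) + ez * Y)).
    by rewrite e1 e2 -[_ * _ * ang ^+ n]mulrA palg_scaleAl !mulrDr; zmod_ring.
  by rewrite mulrDl mulrDr !mulrA (ez_F0 hx).
move=> /(IH _ _ _ _) hn.
have {hn} : nul (x * ((n.+1%:R * m%:R) *: del)).
  apply: hn; last by apply: filD => //; apply: fil_l.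
  by apply: F0M => //; apply/F0Z/(F0_fld (fld_del c)).
rewrite palg_scaleAr => /nulZ_inv h'.
have {}h' : nul (x * del).
  by apply: h'; rewrite mulf_neq0 // pnatr_eq0 // -lt0n.
apply: nul_del; apply: nul_del.
have [a [b [ha hb ex]]] := hx.
rewrite (_ : del * (del * x) = x * del * del); first exact: nul_r.
rewrite ex !mulrDr (del_fld m_gt0 ha) (del_fld m_gt0 hb) expr0 expr1 scale1r scaleN1r mulrN.
by rewrite !mulrA (del_fld m_gt0 ha) (del_fld m_gt0 hb) expr0 expr1 scale1r scaleN1r mulNr opprK !mulrDl.
Qed.

End Filtration.

(** * Weights and rotations *)

Section Rotations.
Variables (R : realType) (m : nat) (c : dihedral m -> R[i]).
Local Notation C := R[i].
Local Notation G := (dihedral m).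
Variables (d : nat) (tau : mx_representation C [set: G]%G d).
Hypothesis m_gt0 : (0 < m)%N.
Hypothesis c_conj : forall (j : nat) (g : G), c (refl m j ^ g)%g = c (refl m j).
Local Notation M := (stdmod c tau).
Local Notation Hc := (cherednik c).
Local Notation kc := (palg_cst (cherednik_rel c)).
Local Notation z b := (hEd c (zrow R b)).
Local Notation gen := (std_gen c tau).
Local Notation ang := (ang c).
Local Notation fld := (@fld R m c).
Local Notation wt := (@wt R m c).
Local Notation F0 := (@F0 R m c).
Local Notation fil := (@fil R m c).
Local Notation nul := (@nul R m c d tau).
Local Notation sg b := (if b then -1 else 1).

(** The vectors z^i zbar^j v with i - j = w span this space. *)
Inductive wspan : int -> M -> Prop :=
| ws_gen v : wspan 0 (gen v)
| ws_add w p q : wspan w p -> wspan w q -> wspan w (p + q)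
| ws_cst w k p : wspan w p -> wspan w (kc k *: p)
| ws_z w b p : wspan w p -> wspan (w + sg b) (z b *: p).

Lemma wspan_g g w p : g.2 = false -> wspan w p -> wspan w (hG c g *: p).
Proof.
move=> g2; elim=> {w p} [v|w p q _ IHp _ IHq|w k p _ IH|w b p _ IH].
- by rewrite hG_gen; apply: ws_gen.
- by rewrite scalerDr; apply: ws_add.
- by rewrite kcZ_comm; apply: ws_cst.
by rewrite scalerA hG_z // g2 addbF scale_hc -scalerA; apply/ws_cst/ws_z.
Qed.

Lemma wspan_wt e i x w p : wt e i x -> e = false -> wspan w p -> wspan (w + i) (x *: p).
Proof.
elim=> {e i x} [g|e i k x _ IH|e i b x _ IH] e0 hp.
- by rewrite addr0; apply: wspan_g.
- by rewrite scale_hc; apply/ws_cst/IH.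
by rewrite -scalerA addrA; apply/ws_z/IH.
Qed.

Lemma wspan_coord w p a b : wspan w p -> a%:Z - b%:Z != w -> mcoord a b p = 0.
Proof.
move=> hp; elim: hp a b => {w p} [v|w p q _ IHp _ IHq|w k p _ IH|w b' p _ IH] a b h.
- rewrite mcoord_gen //; move: h; have [->|_] := eqVneq a 0%N; last by [].
  by have [->|_] := eqVneq b 0%N; rewrite ?subrr ?eqxx.
- by rewrite mcoordD // IHp // IHq // addr0.
- by rewrite mcoordZ // IH // scaler0.
rewrite mcoord_z //; case: b' h => h.
  by case: b h => // b h; apply: IH; apply: contraNneq h => <-; lia.
by case: a h => // a h; apply: IH; apply: contraNneq h => <-; lia.
Qed.

Lemma wspan_mon i j v : exists w, wspan w (mon c i j *: gen v).
Proof.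
elim: i => [|i [w hw]]; last first.
  by exists (w + sg false); rewrite -(z_mon c false) -scalerA; exact: (ws_z false hw).
elim: j => [|j [w hw]]; last first.
  by exists (w + sg true); rewrite -(z_mon c true) -scalerA; exact: (ws_z true hw).
by exists 0; rewrite /mon !expr0 mulr1 scale1r; apply: ws_gen.
Qed.

(** On a vector of given weight, terms of different weights have no coordinate in common. *)
Lemma weight_sep (s : seq (int * Hc)) (f : int -> C) :
  {in s, forall a, wt false a.1 a.2} -> nul (\sum_(a <- s) a.1%:~R *: a.2) ->
  f 0 = 0 -> nul (\sum_(a <- s) f a.1 *: a.2).
Proof.
move=> hs h f0 p.
have [ps ->] := stdmod_sum m_gt0 p; rewrite scaler_sumr big1 // => -[[i j] v] _ /=.
have [w hw] := wspan_mon i j v; set y := _ *: gen v in hw *.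
apply: (mcoord_eq0 m_gt0 c_conj) => a b.
have sumE (F : int -> C) : mcoord a b ((\sum_(x <- s) F x.1 *: x.2) *: y) =
    \sum_(x <- s) F x.1 *: mcoord a b (x.2 *: y).
  by rewrite scaler_suml mcoord_sum //; apply: eq_bigr => x _; rewrite scale_hc mcoordZ.
have vanish x : x \in s -> a%:Z - b%:Z - w != x.1 -> mcoord a b (x.2 *: y) = 0.
  move=> xs h'; apply: (wspan_coord (wspan_wt (hs x xs) erefl hw)).
  by apply: contraNneq h' => ->; rewrite addrAC subrr add0r.
set k := a%:Z - b%:Z - w in vanish.
have := congr1 (mcoord a b) (h y); rewrite (sumE (fun k => k%:~R)) mcoord0 // => e; rewrite sumE.
have [k0|k0] := eqVneq k 0.
  rewrite big_seq big1 // => x xs; have [e1|ne] := eqVneq k x.1.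
    by rewrite -e1 k0 f0 scale0r.
  by rewrite vanish // scaler0.
have kC : k%:~R != 0 :> C by rewrite intr_eq0.
apply: (scalerI kC); rewrite scaler0 scaler_sumr -[RHS](scaler0 _ (f k)) -[in RHS]e scaler_sumr.
rewrite big_seq [RHS]big_seq; apply: eq_bigr => x xs.
have [<-|ne] := eqVneq k x.1; first by rewrite !scalerA mulrC.
by rewrite vanish // !scaler0.
Qed.

Variable g : G.
Hypothesis g2 : g.2 = false.
Let q : C := phase R false g^-1%g.

Lemma q_neq0 : q != 0.
Proof. by apply/eqP => q0; have := phase_conj R m_gt0 false g^-1%g; rewrite -/q q0 mul0r => /esym/eqP; rewrite oner_eq0. Qed.

Lemma rot_wt e i x : wt e i x -> e = false -> hG c g * x = q ^ i *: (x * hG c g).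
Proof.
elim=> {e i x} [g'|e i k x _ IH|e i b x _ IH] e0.
- rewrite expr0z scale1r -!hGM; congr hG.
  by case: (g) (g') g2 e0 => [k ?] [k' ?] /= -> ->; congr pair; rewrite /= addrC.
- by rewrite palg_scaleAr IH // palg_scaleAl !scalerA mulrC.
rewrite mulrA hG_z // g2 addbF palg_scaleAl -[_ * hG c g * _]mulrA IH // palg_scaleAr scalerA mulrA.
congr (_ *: _); rewrite expfzDr ?q_neq0 // mulrC; congr (_ * _).
case: b => /=; last by rewrite expr1z.
rewrite exprN1; apply: (mulfI q_neq0); rewrite mulfV ?q_neq0 //.
exact: (phase_conj R m_gt0 false).
Qed.

Definition ad (x : Hc) : Hc := hG c g * x * hG c g^-1%g.

Lemma adD x y : ad (x + y) = ad x + ad y.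
Proof. by rewrite /ad mulrDr mulrDl. Qed.
Lemma adN x : ad (- x) = - ad x.
Proof. by rewrite /ad mulrN mulNr. Qed.
Lemma adZ k x : ad (k *: x) = k *: ad x.
Proof. by rewrite /ad palg_scaleAr palg_scaleAl. Qed.
Lemma adM x y : ad (x * y) = ad x * ad y.
Proof. by rewrite /ad !mulrA -[_ * hG c g^-1%g * hG c g]mulrA hGVK mulr1. Qed.
Lemma ad_ang : ad ang = ang.
Proof. by rewrite /ad -[ang in LHS]mulr1; have := ang_g m_gt0 c_conj g; rewrite g2 mulr1 => <-; rewrite -mulrA hGKV mulr1. Qed.
Lemma ad_ang_exp n : ad (ang ^+ n) = ang ^+ n.
Proof.
elim: n => [|n IH]; first by rewrite expr0 /ad mulr1 hGKV.
by rewrite exprS adM ad_ang IH.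
Qed.
Lemma nul_ad x : nul x -> nul (ad x).
Proof. by move=> h; apply/nul_r/nul_l. Qed.
Lemma F0_ad x : F0 x -> F0 (ad x).
Proof. by move=> h; apply: F0M; [apply: F0M => //|]; exact: (F0_fld (fld_g _ _)). Qed.
Lemma fil_ad n X : fil n X -> fil n (ad X).
Proof.
move=> [D hD ->]; exists (fun i => ad (D i)); first by move=> i; apply: F0_ad.
rewrite (big_morph ad adD (_ : ad 0 = 0)); last by rewrite /ad mulr0 mul0r.
by apply: eq_bigr => i _; rewrite adM ad_ang_exp.
Qed.

(** On M the j-th iterate of ad sends T to T + j (ad T - T), and the m-th iterate is the identity. *)
Lemma ad_unipotent T : nul (ad (ad T - T) - (ad T - T)) -> nul (ad T - T).
Proof.
set T' := ad T - T => h.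
have it j : nul (iter j ad T - (T + j%:R *: T')).
  elim: j => [|j IH]; first by rewrite scale0r addr0 subrr => p; rewrite scale0r.
  have := nulD (nul_ad IH) (nulZ j%:R h); congr nul.
  rewrite iterS adD adN adD adZ -natr1 scalerDl scale1r scalerBr.
  have -> : ad T = T + T' by rewrite /T' addrC subrK.
  zmod_ring.
have iad j x : iter j ad x = hG c (g ^+ j)%g * x * hG c (g ^+ j)^-1%g.
  elim: j => [|j IH]; first by rewrite expg0 invg1 !hG1 mul1r mulr1.
  by rewrite iterS IH /ad expgS invMg !hGM !mulrA.
have := it m; rewrite iad rot_expm // invg1 !hG1 mul1r mulr1 opprD addrA subrr add0r.
move=> /nulN; rewrite opprK; apply: nulZ_inv.
by rewrite pnatr_eq0 -lt0n.
Qed.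

(** Conjugation by the rotation g multiplies the part of weight i by q^i. *)
Lemma ad_even a : fld false a ->
  (forall (s : seq (int * Hc)), {in s, forall a, wt false a.1 a.2} -> a = \sum_(x <- s) x.2 ->
   nul (\sum_(x <- s) x.1%:~R *: x.2) -> nul (ad a - a)).
Proof.
move=> ha s hs ea /(weight_sep (f := fun i => q ^ i - 1) hs).
rewrite expr0z subrr => /(_ erefl) h.
have e : hG c g * a = (a + \sum_(x <- s) (q ^ x.1 - 1) *: x.2) * hG c g.
  rewrite ea -big_split mulr_suml mulr_sumr big_seq [RHS]big_seq; apply: eq_bigr => x xs /=.
  rewrite (rot_wt (hs x xs)) // scalerBl scale1r addrC subrK palg_scaleAl.
  by [].
rewrite /ad e -mulrA hGKV mulr1 addrC addrA addNr add0r; exact: h.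
Qed.

(** Here a' is the sum of the weight components of a, each multiplied by its weight. *)
Lemma ang_F0_comm a b : fld false a -> fld true b -> exists a' y z : Hc,
  [/\ ang * (a + b) - (a + b) * ang = - (b + b) * ang + (a' + y + z),
      fld true y, F0 z, nul b -> nul z & fld false a' /\ (nul a' -> nul (ad a - a))].
Proof.
move=> ha hb; have [s hs ea] := fld_wt ha; have [y hy ey] := ang_wts m_gt0 c_conj hs.
have [b' [y' [hb' hy' eb]]] := ang_fld m_gt0 c_conj hb.
exists (\sum_(x <- s) x.1%:~R *: x.2), y, (b' + y'); split=> //.
- rewrite mulrDr {1}ea ey -ea eb expr0 expr1 scale1r scaleN1r mulrDl mulNr mulrDl; zmod_ring.
- by apply: F0D; [exact: (F0_fld hb') | exact: (F0_fld hy')].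
- move=> nb; have -> : b' + y' = ang * b + b * ang.
    by rewrite eb expr1 scaleN1r; zmod_ring.
  by apply: nulD; [apply: nul_l | apply: nul_r].
split; last exact: (ad_even ha hs ea).
rewrite big_seq; apply: fld_sum => x xs.
by apply: fldZ; apply: (wt_fld (hs x xs)).
Qed.

End Rotations.

(** * Polynomials that commute with the angular operator *)

Section RotationsCommute.
Variables (R : realType) (m : nat) (c : dihedral m -> R[i]).
Local Notation C := R[i].
Local Notation G := (dihedral m).
Variables (d : nat) (tau : mx_representation C [set: G]%G d).
Hypothesis m_gt0 : (0 < m)%N.
Hypothesis c_conj : forall (j : nat) (g : G), c (refl m j ^ g)%g = c (refl m j).
Local Notation Hc := (cherednik c).
Local Notation ang := (ang c).
Local Notation fld := (@fld R m c).
Local Notation F0 := (@F0 R m c).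
Local Notation fil := (@fil R m c).
Local Notation nul := (@nul R m c d tau).

Section Rotation.
Variable g : G.
Hypothesis g2 : g.2 = false.
Local Notation ad := (@ad R m c g).

Lemma comm_split n (x Y : Hc) : ang * (x * ang ^+ n + Y) - (x * ang ^+ n + Y) * ang =
  (ang * x - x * ang) * ang ^+ n + (ang * Y - Y * ang).
Proof.
rewrite mulrDr mulrDl mulrBl -[x * ang ^+ n * ang]mulrA -exprSr -[x * ang * _]mulrA -exprS.
rewrite [ang * (x * _)]mulrA; zmod_ring.
Qed.

Lemma fil_comm n Y : fil n Y -> exists b Y',
  [/\ fld true b, fil n Y' & ang * Y - Y * ang = b * ang ^+ n + Y'].
Proof.
elim: n Y => [|n IH] Y.
  move=> /fil_0inv ->; exists 0, 0; split; [exact: fld0 | exact: fil0 |].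
  by rewrite mulr0 !mul0r subrr addr0.
move=> /fil_inv [x [Y0 [[a [b [ha hb ->]]] hY ->]]].
have [b1 [Y1 [hb1 hY1 e1]]] := IH _ hY.
have [a' [y [w [e2 hy hw _ [ha' _]]]]] := ang_F0_comm tau m_gt0 c_conj g2 ha hb.
exists (- (b + b)), ((a' + y + w + b1) * ang ^+ n + Y1); split.
- exact/fldN/fldD.
- apply: fil_top => //; apply: F0D; last exact: (F0_fld hb1).
  by apply: F0D => //; apply: F0D; [exact: (F0_fld ha') | exact: (F0_fld hy)].
by rewrite comm_split e1 e2 mulrDl -mulrA -exprS !mulrDl; zmod_ring.
Qed.

Lemma nul_cancel x y : nul (x + y) -> nul y -> nul x.
Proof.
by move=> h1 h2; rewrite -[x](addrK y); apply: nulD => //; apply: nulN.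
Qed.

(** The two top coefficients of [ang, X] vanish. The first one shows that the reflection part b of
    the top coefficient of X vanishes, the second one that its rotation part a has weight zero. So
    ad T - T has smaller degree; by induction it is fixed by ad, and [ad_unipotent] applies. *)
Lemma fil_rot n T X : fil n X -> nul (T - X) -> nul (ang * T - T * ang) ->
  nul (ad T - T).
Proof.
elim: n T X => [|n IH] T X.
  move=> /fil_0inv ->; rewrite subr0 => nT _.
  by apply: nulD; [apply: nul_ad | apply: nulN].
move=> hX nTX nT; have [x [Y [[a [b [ha hb ex]]] hY eX]]] := fil_inv hX.
have nX : nul (ang * X - X * ang).
  rewrite (_ : _ - _ = ang * T - T * ang + (- (ang * (T - X)) + (T - X) * ang)).
    by apply: nulD => //; apply: nulD; [exact/nulN/nul_l | exact: nul_r].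
  by rewrite mulrBr mulrBl; zmod_ring.
have [b1 [Y1 [hb1 hY1 e1]]] := fil_comm hY.
have [a' [y [w [e2 hy hw nw [ha' nad]]]]] := ang_F0_comm tau m_gt0 c_conj g2 ha hb.
have eC : ang * X - X * ang = - (b + b) * ang ^+ n.+1 + ((a' + y + w + b1) * ang ^+ n + Y1).
  by rewrite eX ex comm_split e1 e2 mulrDl -mulrA -exprS !mulrDl; zmod_ring.
have hx' : F0 (a' + y + w + b1).
  apply: F0D; last exact: (F0_fld hb1).
  by apply: F0D => //; apply: F0D; [exact: (F0_fld ha') | exact: (F0_fld hy)].
have nb : nul b.
  have two0 : 2 != 0 :> C by rewrite pnatr_eq0.
  have nbb : nul (- (b + b)).
    rewrite eC in nX; apply: (nul_top m_gt0 c_conj _ _ nX); last exact: fil_top.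
    by apply: F0N; apply: F0D; apply: (F0_fld hb).
  apply: (nulZ_inv two0); rewrite scalerDl scale1r -[b + b]opprK; exact: nulN.
have nx' : nul (a' + y + w + b1).
  rewrite eC addrC in nX; apply: (nul_top m_gt0 c_conj hx' hY1).
  apply: (nul_cancel nX); apply: nul_r; apply/nulN/nulD => //.
have na : nul (ad a - a).
  apply: nad; have [] // := nul_parity m_gt0 c_conj ha' (fldD hy hb1) (tau := tau).
  apply: (nul_cancel (y := w)); last exact: nw.
  by rewrite (_ : _ + w = a' + y + w + b1) //; zmod_ring.
have adX : ad X - X = (ad a - a + (ad b - b)) * ang ^+ n + (ad Y - Y).
  by rewrite eX ex adD adM ad_ang_exp // adD !mulrDl !mulNr; zmod_ring.
have nT' : nul (ad T - T - (ad Y - Y)).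
  rewrite (_ : _ - _ = ad (T - X) - (T - X) + (ad a - a + (ad b - b)) * ang ^+ n).
    apply: nulD; first by apply: nulD; [exact: nul_ad | exact: nulN].
    apply/nul_r/nulD => //; apply: nulD; [exact: nul_ad | exact: nulN].
  rewrite adD adN -[LHS]addr0 -[0](subrr (ad X - X)) {1}adX; zmod_ring.
apply: (ad_unipotent m_gt0 g2); apply: (IH _ (ad Y - Y)) => //.
  by apply: filD; [apply: fil_ad | apply: filN].
rewrite (_ : _ - _ = ad (ang * T - T * ang) - (ang * T - T * ang)).
  by apply: nulD; [exact: nul_ad | exact: nulN].
by rewrite adD adN !adM ad_ang // mulrBr mulrBl; zmod_ring.
Qed.
End Rotation.
End RotationsCommute.

(** * Operators that commute with z zbar *)

Section NormalForm.
Variables (R : realType) (m : nat) (c : dihedral m -> R[i]).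
Local Notation C := R[i].
Local Notation G := (dihedral m).
Variables (d : nat) (tau : mx_representation C [set: G]%G d).
Hypothesis m_gt0 : (0 < m)%N.
Hypothesis c_conj : forall (j : nat) (g : G), c (refl m j ^ g)%g = c (refl m j).
Variable N : C.
Hypothesis N_tau : sigma_scalar c tau N.
Local Notation M := (stdmod c tau).
Local Notation Hc := (cherednik c).
Local Notation kc := (palg_cst (cherednik_rel c)).
Local Notation z b := (hEd c (zrow R b)).
Local Notation t b := (hE c (zcol R b)).
Local Notation sg := (h_sigma c).
Local Notation deg := (std_deg (c:=c) (tau:=tau)).
Local Notation EE := (hEE c).
Local Notation hH := (hH c).
Local Notation lam := (lam N).
Local Notation ang := (ang c).
Local Notation fld := (@fld R m c).
Local Notation fil := (@fil R m c).
Local Notation nul := (@nul R m c d tau).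

(** The polynomials in the Euler and angular operators, with coefficients on the left. *)
Inductive nf : Hc -> Prop :=
| nf_fld e x : fld e x -> nf x
| nfD x y : nf x -> nf y -> nf (x + y)
| nf_H x : nf x -> nf (x * hH)
| nf_L x : nf x -> nf (x * ang).

Lemma nfZ k x : nf x -> nf (k *: x).
Proof.
elim=> {x} [e x hx|x y _ IHx _ IHy|x _ IH|x _ IH].
- exact: (nf_fld (fldZ k hx)).
- by rewrite scalerDr; apply: nfD.
- by rewrite -palg_scaleAl; apply: nf_H.
- by rewrite -palg_scaleAl; apply: nf_L.
Qed.
Lemma nfN x : nf x -> nf (- x).
Proof. by rewrite -scaleN1r; apply: nfZ. Qed.

Lemma nf_mull (u : Hc) : (forall e x, fld e x -> nf (u * x)) -> forall x, nf x -> nf (u * x).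
Proof.
move=> hu x; elim=> {x} [e x hx|x y _ IHx _ IHy|x _ IH|x _ IH].
- exact: (hu _ _ hx).
- by rewrite mulrDr; apply: nfD.
- by rewrite mulrA; apply: nf_H.
- by rewrite mulrA; apply: nf_L.
Qed.

Lemma nf_lz b x : nf x -> nf (z b * x).
Proof. by apply: nf_mull => e y hy; apply: (nf_fld (fld_z b hy)). Qed.
Lemma nf_lg g x : nf x -> nf (hG c g * x).
Proof. by apply: nf_mull => e y hy; apply: (nf_fld (fld_gl g hy)). Qed.
Lemma nf_lsg x : nf x -> nf (sg * x).
Proof. by apply: nf_mull => e y hy; apply: (nf_fld (fldM (fld_sg c m_gt0) hy)). Qed.
Lemma nf_lL x : nf x -> nf (ang * x).
Proof.
apply: nf_mull => e y hy; have [a [b [ha hb ->]]] := ang_fld m_gt0 c_conj hy.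
apply: nfD (nf_fld hb); apply: nfD (nf_fld ha).
exact/nfZ/nf_L/(nf_fld hy).
Qed.

Lemma hH_g g : hH * hG c g = hG c g * hH.
Proof.
rewrite {1}(hHb c false) (hHb c g.2) !mulrBl !mulrBr !mulrDl !mulrDr hG_sg // !zt_g //.
rewrite mulr1 mul1r; case: g.2; rewrite /=; zmod_ring.
Qed.

Lemma hH_fld e x : fld e x -> exists2 y, fld e y & hH * x = x * hH + y.
Proof.
elim=> {e x} [g|e x y _ [x' hx ex] _ [y' hy ey]|e k x _ [y hy ey]|e b x hx [y hy ey]].
- by exists 0; [apply: fld0 | rewrite hH_g addr0].
- by exists (x' + y'); [apply: fldD | rewrite mulrDr ex ey [(x + y) * hH]mulrDl; zmod_ring].
- by exists (k *: y); [apply: fldZ | rewrite palg_scaleAr ey scalerDr palg_scaleAl].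
exists (z b * y + z b * x); first by apply: fldD; apply: fld_z.
by rewrite mulrA hH_z // [(_ + z b) * x]mulrDl -mulrA ey [z b * (_ + y)]mulrDr mulrA; zmod_ring.
Qed.

Lemma nf_lH x : nf x -> nf (hH * x).
Proof.
apply: nf_mull => e y hy; have [y' hy' ->] := hH_fld hy.
apply: nfD (nf_fld hy'); exact/nf_H/(nf_fld hy).
Qed.

Lemma zt_H_ang b : z b * t b = 2^-1 *: (if b then hH - ang - 1 + (sg + sg) else hH + ang - 1).
Proof.
have h2 (x y : Hc) : y = x + x -> x = 2^-1 *: y.
  by move=> ->; rewrite -[x in x + x]scale1r -scalerDl scalerA -(natrD _ 1 1) mulVf ?scale1r // pnatr_eq0.
by apply: h2; rewrite /hH angE; case: b; zmod_ring.
Qed.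

Lemma nf_lzt b x : nf x -> nf (z b * t b * x).
Proof.
have dist (u v w : Hc) : (u - v - 1 + (w + w)) * x = u * x - v * x - x + (w * x + w * x).
  by rewrite !(mulrDl, mulNr) mul1r.
have dist' (u v : Hc) : (u + v - 1) * x = u * x + v * x - x.
  by rewrite !(mulrDl, mulNr) mul1r.
move=> hx; rewrite zt_H_ang palg_scaleAl; apply: nfZ; case: b.
  rewrite dist; apply: nfD; last by apply: nfD; apply: nf_lsg.
  apply: nfD; last exact: nfN.
  by apply: nfD; [exact: nf_lH | exact/nfN/nf_lL].
rewrite dist'; apply: nfD; last exact: nfN.
by apply: nfD; [exact: nf_lH | exact: nf_lL].
Qed.

Lemma nf_E x : nf x -> nf (EE * x).
Proof. by move=> hx; rewrite (hEE_b c false) -mulrA; do 2! apply: nf_lz. Qed.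

(** y is a polynomial in the Euler and angular operators, up to powers of z zbar. *)
Definition enf (y : Hc) := exists n, nf (EE ^+ n * y).

Lemma enf_up n k y : nf (EE ^+ n * y) -> nf (EE ^+ (k + n) * y).
Proof.
by move=> h; elim: k => [//|k IH]; rewrite addSn exprS -mulrA; apply: nf_E.
Qed.

Lemma enfD x y : enf x -> enf y -> enf (x + y).
Proof.
move=> [n hn] [k hk]; exists (k + n)%N; rewrite mulrDr; apply: nfD; first exact: enf_up.
by rewrite addnC; apply: enf_up.
Qed.

Lemma enfZ a x : enf x -> enf (a *: x).
Proof. by move=> [n hn]; exists n; rewrite palg_scaleAr; apply: nfZ. Qed.

Lemma En_comm (u : Hc) n : u * EE = EE * u -> u * EE ^+ n = EE ^+ n * u.
Proof. by move=> h; apply: commrX. Qed.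

Lemma enf_z b y : enf y -> enf (z b * y).
Proof. by move=> [n hn]; exists n; rewrite mulrA -En_comm ?E_z // -mulrA; apply: nf_lz. Qed.
Lemma enf_g g y : enf y -> enf (hG c g * y).
Proof. by move=> [n hn]; exists n; rewrite mulrA -En_comm ?E_g // -mulrA; apply: nf_lg. Qed.

Lemma enf_t b y : enf y -> enf (t b * y).
Proof.
move=> [n hn]; exists n.+1.
have := t_hev c m_gt0 b 'X^n; rewrite hevXn derivXn -scaler_nat hevZ hevXn palg_scaleAl.
move=> /(congr1 (fun x => EE * x)); rewrite mulrDr palg_scaleAr !mulrA -exprS => e.
have -> : EE ^+ n.+1 * t b * y = z (~~ b) * (z b * t b * (EE ^+ n * y)) - n%:R *: (z (~~ b) * (EE ^+ n * y)).
  rewrite !mulrA [z (~~ b) * z b](_ : _ = EE); last by rewrite (hEE_b c (~~ b)) negbK.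
  rewrite e mulrDl palg_scaleAl (_ : n%:R *: (EE * EE ^+ n.-1 * z (~~ b) * y) =
    n%:R *: (z (~~ b) * EE ^+ n * y)); first by rewrite addrK.
  case: (n) => [|n']; first by rewrite !scale0r.
  by rewrite -exprS -En_comm ?E_z.
by apply: nfD; [apply/nf_lz/nf_lzt | apply/nfN/nfZ/nf_lz].
Qed.

Lemma enf_all (h y : Hc) : enf y -> enf (h * y).
Proof.
rewrite -(palg_reprK h); elim: (palg_repr h) y => {h} [[g|u|a]|k|x IHx y IHy|x IHx y IHy] w hw.
- exact: enf_g.
- rewrite -[palg_of _ _]/(hE c u) hE_bool mulr_suml big_bool !palg_scaleAl.
  by apply: enfD; apply/enfZ/enf_t.
- rewrite -[palg_of _ _]/(hEd c a) hEd_bool mulr_suml big_bool !palg_scaleAl.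
  by apply: enfD; apply/enfZ/enf_z.
- by rewrite -[palg_of _ _]/(kc k) -palg_scaleE; apply: enfZ.
- by rewrite palg_ofD mulrDl; apply: enfD; [apply: IHx | apply: IHy].
by rewrite palg_ofM -mulrA; apply/IHx/IHy.
Qed.

Definition lfil X := exists n, fil n X.
Lemma lfil0 : lfil 0. Proof. by exists 0%N; apply: fil0. Qed.
Lemma lfilD X Y : lfil X -> lfil Y -> lfil (X + Y).
Proof.
move=> [n hX] [k hY]; exists (maxn n k); apply: filD.
  by apply: fil_mono hX; rewrite leq_maxl.
by apply: fil_mono hY; rewrite leq_maxr.
Qed.
Lemma lfil_fld e x : fld e x -> lfil x.
Proof.
move=> hx; exists 1%N; rewrite -[x]addr0 -[x]mulr1 -(expr0 ang); apply: fil_top; last exact: fil0.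
exact: F0_fld hx.
Qed.
Lemma lfil_ang X : lfil X -> lfil (X * ang).
Proof.
move=> [n [D hD ->]]; exists n.+1; exists (fun i => if i is i'.+1 then D i' else 0).
  by case=> //; apply: F00.
rewrite big_ord_recl mul0r add0r mulr_suml; apply: eq_bigr => i _.
by rewrite -mulrA -exprSr.
Qed.

Lemma lfil_E X : lfil X -> X * EE = EE * X.
Proof.
have fE e x : fld e x -> x * EE = EE * x.
  elim=> {e x} [g|e x y _ IHx _ IHy|e k x _ IH|e b x _ IH].
  - exact: E_g.
  - by rewrite mulrDl mulrDr IHx IHy.
  - by rewrite palg_scaleAl palg_scaleAr IH.
  by rewrite -mulrA IH !mulrA E_z.
move=> [n [D hD ->]]; rewrite mulr_suml mulr_sumr; apply: eq_bigr => i _.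
have [a [b [ha hb ->]]] := hD i.
rewrite -mulrA; have /commrX <- : GRing.comm EE ang by rewrite /GRing.comm ang_E.
by rewrite !mulrA; congr (_ * _); rewrite mulrDl mulrDr (fE _ _ ha) (fE _ _ hb).
Qed.

Lemma deg_sg k p : deg k p -> deg k (sg *: p).
Proof.
move=> hp; rewrite h_sigmaE // scaler_suml; apply: deg_sum => g _.
by rewrite scale_hc; apply/degZ/deg_g.
Qed.

Lemma degN k p : deg k p -> deg k (- p).
Proof. by rewrite -scaleN1r -(kcN1 c); apply: degZ. Qed.

Lemma deg_ang k p : deg k p -> deg k (ang *: p).
Proof.
elim: k p => [|k IH] p.
  move=> [v ->]; rewrite angE !scalerDl scaleNr -!scalerA !hE_gen !scaler0 subr0 add0r.
  by apply: deg_sg; exists v.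
move=> /degS [q0 [q1 [h0 h1 ->]]]; rewrite scalerDr !scalerA ang_z0 // ang_z1 //.
rewrite !scalerDl !scaleNr !scalerDl -!scalerA.
by repeat first [apply: degD | apply: degN | apply: deg_z | apply: IH | apply: deg_sg | apply: deg_tw].
Qed.

Lemma nf_deg x : nf x -> exists2 X : nat -> Hc, forall i, lfil (X i) &
  exists n, forall B, (n <= B)%N -> forall k p, deg k p ->
    x *: p = \sum_(i < B) kc (lam k ^+ i) *: (X i *: p).
Proof.
elim=> {x} [e x hx|x y _ [X hX [n en]] _ [Y hY [n' en']]|x _ [X hX [n en]]|x _ [X hX [n en]]].
- exists (fun i => if i is 0%N then x else 0).
    by case=> [|i]; [exact: (lfil_fld hx) | exact: lfil0].
  exists 1%N => -[//|B] _ k p _; rewrite big_ord_recl expr0 palg_cst1 scale1r big1 ?addr0 // => i _.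
  by rewrite /= scale0r scaler0.
- exists (fun i => X i + Y i); first by move=> i; apply: lfilD.
  exists (maxn n n') => B; rewrite geq_max => /andP[h h'] k p hp.
  rewrite scalerDl (en _ h k p hp) (en' _ h' k p hp) -big_split; apply: eq_bigr => i _ /=.
  by rewrite scalerDl scalerDr.
- exists (fun i => if i is i'.+1 then X i' else 0).
    by case=> [|i]; [exact: lfil0 | exact: hX].
  exists n.+1 => -[//|B] hB k p hp; rewrite big_ord_recl scale0r scaler0 add0r.
  rewrite -scalerA (hH_deg m_gt0 N_tau hp) kcZ_comm (en _ hB k p hp) scaler_sumr.
  by apply: eq_bigr => i _; rewrite scalerA -palg_cstM -exprS.
exists (fun i => X i * ang); first by move=> i; apply: lfil_ang.
exists n => B hB k p hp; rewrite -scalerA (en _ hB k _ (deg_ang hp)).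
by apply: eq_bigr => i _; rewrite scalerA.
Qed.

(** A polynomial that takes the value v infinitely often has constant term v. *)
Lemma poly_const B (a : nat -> C) (x : nat -> M) v : injective a ->
  (forall s, v = \sum_(i < B.+1) kc (a s ^+ i) *: x i) -> v = x 0%N.
Proof.
move=> a_inj e; apply/eqP; rewrite -subr_eq0; apply/eqP.
apply: (mcoord_eq0 m_gt0 c_conj) => i j; apply/rowP => l; rewrite !mxE.
pose P := \poly_(k < B.+1) (mcoord i j (x k)) 0 l - ((mcoord i j v) 0 l)%:P.
have rP s : root P (a s).
  apply/eqP; rewrite hornerD hornerN hornerC horner_poly [X in _ - (mcoord _ _ X) _ _](e s) mcoord_sum //.
  rewrite summxE; apply/eqP; rewrite subr_eq0; apply/eqP; apply: eq_bigr => k _.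
  by rewrite mcoordZ // mxE mulrC.
have P0 : P = 0.
  apply: (@roots_geq_poly_eq0 _ P [seq a s | s <- iota 0 (size P)]).
  - by apply/allP => _ /mapP[s _ ->].
  - by rewrite map_inj_uniq ?iota_uniq.
  - by rewrite size_map size_iota.
have := congr1 (fun P : {poly C} => P`_0) P0; rewrite coefD coefN coefC coef_poly coef0 /= => /eqP.
rewrite mcoordD // -[- x 0%N]scaleN1r -(kcN1 c) mcoordZ // scaleN1r !mxE => /eqP e0.
by rewrite -[RHS]oppr0 -e0 opprB.
Qed.

(** Applied to E^s q, a polynomial in H and ang becomes a polynomial in lam (k + 2 s); as h commutes
    with E, its values for all s agree. *)
Lemma commute_E_lfil (h : Hc) : (forall p : M, h *: (EE *: p) = EE *: (h *: p)) ->
  exists n X, lfil X /\ nul (EE ^+ n * h - X).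
Proof.
move=> hE; have [n hn] : enf (h * 1).
  by apply: enf_all; exists 0%N; rewrite mulr1 expr0; apply: (nf_fld (fld1 c)).
rewrite mulr1 in hn; have [X hX [B eB]] := nf_deg hn.
exists n, (X 0%N); split=> // p; rewrite scalerBl; apply/eqP; rewrite subr_eq0; apply/eqP.
have hom k q : deg k q -> (EE ^+ n * h) *: q = X 0%N *: q.
  move=> hq; apply: (@poly_const B (fun s => lam (k + s.*2)) (fun i => X i *: q)).
    by move=> s s' /lam_inj/addnI/double_inj.
  move=> s; apply/eqP; rewrite -subr_eq0; apply/eqP; apply: (En_inj m_gt0 c_conj (n := s)).
  have hEs r : h *: (EE ^+ s *: r) = EE ^+ s *: (h *: r :> M).
    elim: (s) r => [|s' IH] r; first by rewrite !expr0 !scale1r.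
    by rewrite exprS -!scalerA hE IH.
  rewrite scalerBr scalerA mulrA -exprD addnC exprD -mulrA -scalerA -[(EE ^+ s * h) *: q]scalerA -hEs.
  rewrite [EE ^+ n *: _]scalerA (eB B.+1 (leqnSn _) _ _ (deg_En s hq)) scaler_sumr -sumrB big1 // => i _.
  rewrite kcZ_comm; apply/eqP; rewrite subr_eq0; apply/eqP; congr (_ *: _).
  by rewrite !scalerA; congr (_ *: _); apply: commrX; apply: lfil_E.
have [ps ->] := stdmod_sum m_gt0 p; rewrite !scaler_sumr; apply: eq_bigr => x _.
by apply: hom; apply: deg_mon.
Qed.

(** E^n h is a polynomial in ang, and it commutes with ang; multiplication by E is injective. *)
Lemma rot_commutes (h : Hc) (g : G) : g.2 = false ->
  (forall p : M, h *: (EE *: p) = EE *: (h *: p)) ->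
  (forall p : M, h *: (ang *: p) = ang *: (h *: p)) ->
  forall p : M, h *: (hG c g *: p) = hG c g *: (h *: p).
Proof.
move=> g2 hE hL p; have [n [X [[k hX] nX]]] := commute_E_lfil hE.
have : nul (ad g (EE ^+ n * h) - EE ^+ n * h).
  apply: (fil_rot m_gt0 c_conj g2 hX nX) => q.
  rewrite mulrA (En_comm _ (ang_E c m_gt0)) scalerBl -!scalerA -hL.
  exact: subrr.
have Eg : hG c g * EE ^+ n = EE ^+ n * hG c g by apply: En_comm; apply: E_g.
rewrite /ad mulrA Eg => /(_ (hG c g *: p)) /eqP.
rewrite scalerBl subr_eq0 -!scalerA [hG c _ *: (hG c g *: p)]scalerA hGVK scale1r => /eqP e.
apply/esym/eqP; rewrite -subr_eq0; apply/eqP; apply: (En_inj m_gt0 c_conj (n := n)).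
by rewrite scalerBr e subrr.
Qed.

End NormalForm.

(** * The centraliser of u(2|1) *)

Section Centraliser.
Variables (R : realType) (m : nat) (c : dihedral m -> R[i]).
Local Notation C := R[i].
Local Notation G := (dihedral m).
Variables (d : nat) (tau : mx_representation C [set: G]%G d).
Hypothesis m_gt0 : (0 < m)%N.
Hypothesis c_conj : forall (j : nat) (g : G), c (refl m j ^ g)%g = c (refl m j).
Variable N : C.
Hypothesis N_tau : sigma_scalar c tau N.
Hypothesis N_lt1 : 0 < 1 - N.
Hypothesis d_gt0 : (0 < d)%N.
Local Notation M := (stdmod c tau).
Local Notation A := (HC c).
Local Notation K := (kmod c tau).
Local Notation Hc := (cherednik c).
Local Notation kc := (palg_cst (cherednik_rel c)).
Local Notation gen := (std_gen c tau).
Local Notation deg := (std_deg (c:=c) (tau:=tau)).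
Local Notation EE := (hEE c).
Local Notation hH := (hH c).
Local Notation lam := (lam N).
Local Notation ket := (ket (c:=c) (tau:=tau)).
Local Notation mono := (mono (c:=c) (tau:=tau)).
Local Notation ang := (ang c).

Lemma lspan_nth (s : seq A) i : (i < size s)%N -> lspan s s`_i.
Proof.
move=> hi; exists (fun j => (j == i)%:R).
rewrite (bigD1 (Ordinal hi)) //= eqxx scale1r big1 ?addr0 // => j.
by rewrite -val_eqE /= => /negPf ->; rewrite scale0r.
Qed.

Lemma u21_even i : (i < 5)%N -> u21 c [:: u_Ep c; u_Em c; u_H c; u_Z1 c; u_Z2 c]`_i.
Proof. by move=> hi; apply: (@part_u21 _ _ _ false); apply: lspan_nth. Qed.

Lemma clifford_blocks (a : A) : exists h : bool -> bool -> Hc, forall l p,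
  a *: ket l p = ket false (h l false *: p) + ket true (h l true *: p).
Proof.
rewrite -(palg_reprK a); elim: (palg_repr a) => {a} [[x|b]|k|x [h eh] y [h' eh']|x [h eh] y [h' eh']].
- exists (fun l l' => if l == l' then x else 0) => l p.
  by rewrite [LHS]ket_h; case: l; rewrite /= scale0r ket0 ?add0r ?addr0.
- exists (fun l l' => kc ((b *: spin_basis R l : spinor R) (if l' then 1 else 0) 0)) => l p.
  by rewrite [LHS]ktens_c spinor_ket.
- exists (fun l l' => if l == l' then kc k else 0) => l p.
  by rewrite [LHS]ket_cst; case: l; rewrite /= scale0r ket0 ?add0r ?addr0.
- exists (fun l l' => h l l' + h' l l') => l p.
  by rewrite palg_ofD scalerDl eh eh' !scalerDl !ketD; zmod_ring.
exists (fun l l' => h false l' * h' l false + h true l' * h' l true) => l p.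
rewrite palg_ofM -scalerA eh' scalerDr !eh !scalerDl !ketD !scalerA; zmod_ring.
Qed.

(** Commutation with Z_2 makes the off-diagonal blocks vanish. *)
Lemma cent_ket a l : u21_centraliser c a -> exists h : Hc, forall p, a *: ket l p = ket l (h *: p).
Proof.
move=> ha; have [h eh] := clifford_blocks a; exists (h l l) => p.
have eZ (u : K) : a *: (u_Z2 c *: u) = u_Z2 c *: (a *: u).
  by rewrite !scalerA (ha _ (u21_even (i := 4) isT)).
have := eZ (ket l p); rewrite Z2_ket -ket_cst scalerA -[a * _]palg_cstC -scalerA eh.
rewrite !scalerDr !ket_cst !Z2_ket => /eqP; rewrite -subr_eq0 opprD addrACA -!ketN -!ketD -!scalerBl -!kcB.
move=> /eqP/(@ket_sum_inj _ _ _ _ _ false) [e0 e1].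
case: l e0 e1 {eZ} => e0 e1.
  move: e0 => /kc_inj ->; first by rewrite ket0 add0r.
  by rewrite opprB addrA subrK subr0 oner_eq0.
move: e1 => /kc_inj ->; first by rewrite ket0 addr0.
by rewrite opprB addrA subrK sub0r oppr_eq0 oner_eq0.
Qed.

Lemma graded (p : M) : exists2 f : nat -> M, forall n, deg n (f n) &
  exists B0, forall B, (B0 <= B)%N -> p = \sum_(n < B) f n.
Proof.
have [s ->] := stdmod_sum m_gt0 p; elim: s => [|x s [f hf [B0 eB]]].
  exists (fun=> 0); first by move=> n; apply: deg0.
  by exists 0%N => B _; rewrite big_nil big1.
pose y := mon c x.1.1 x.1.2 *: gen x.2.
exists (fun n => (if n == (x.1.1 + x.1.2)%N then y else 0) + f n).
  by move=> n; apply: degD => //; case: eqP => [->|_]; [apply: deg_mon | apply: deg0].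
exists (maxn B0 (x.1.1 + x.1.2).+1) => B; rewrite geq_max => /andP[h1 h2].
rewrite big_cons (eB B h1) big_split /=; congr (_ + _).
rewrite (bigD1 (Ordinal h2)) //= eqxx big1 ?addr0 // => i.
by rewrite -val_eqE /= => /negPf ->.
Qed.

Lemma hH_eigen_deg k p : hH *: p = kc (lam k) *: p -> deg k p.
Proof.
move=> e; have [f hf [B0 eB]] := graded p.
have {}eB := eB _ (leq_maxl B0 k.+1); set B := maxn _ _ in eB.
have kB : (k < B)%N by rewrite leq_maxr.
have := @eigen_indep _ _ _ _ tau hH 'I_B (fun i => lam i)
  (fun i => if i == k :> nat then f i - p else f i) _ _ _ (Ordinal kB).
rewrite /= eqxx => h; have /eqP : f k - p = 0.
  apply: h => [i j|i|].
  - by move=> /lam_inj /val_inj.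
  - case: eqP => [ik|_]; last exact: (hH_deg m_gt0 N_tau (hf i)).
    by rewrite scalerBr (hH_deg m_gt0 N_tau (hf i)) e ik scalerBr.
  rewrite (bigD1 (Ordinal kB)) //= eqxx.
  rewrite (eq_bigr (fun i : 'I_B => f i)); last by move=> i; rewrite -val_eqE /= => /negPf ->.
  by move: eB; rewrite (bigD1 (Ordinal kB)) //= => {1}->; rewrite opprD addrA subrr add0r addNr.
by rewrite subr_eq0 => /eqP <-.
Qed.

(** The degree is preserved because H has different eigenvalues in different degrees. *)
Lemma cent_mono a l k (h : Hc) : u21_centraliser c a ->
  (forall p, a *: ket l p = ket l (h *: p)) -> forall p, mono l k p -> mono l k (h *: p).
Proof.
move=> ha eh p [hp tp]; split.
  apply: hH_eigen_deg; apply: (ket_inj (l := l)).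
  rewrite -H_ket -eh scalerA -(ha _ (u21_even (i := 2) isT)) -scalerA H_ket.
  by rewrite (hH_deg m_gt0 N_tau hp) eh kcZ_comm.
have : Fdown c l *: (a *: ket l p) = 0.
  rewrite scalerA -(ha _ (Fdown_u21 c l)) -scalerA Fdown_ket eqxx tp scaler0 ket0.
  exact: scaler0.
rewrite eh Fdown_ket eqxx -(ket0 c tau (~~ l)) => /ket_inj.
by move=> /(kc_inj (two_neq0 R)).
Qed.

Lemma monogenics_stable l k : stable_subspace (u21_centraliser c) (monogenics tau l k).
Proof.
split.
- by apply/monogenicsE => //; exists 0; [apply: mono0 | rewrite ket0].
- move=> u v /monogenicsE [p hp ->] /monogenicsE [q hq ->].
  by apply/monogenicsE => //; exists (p + q); [apply: monoD | rewrite ketD].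
move=> a u ha /monogenicsE [p hp ->]; have [h eh] := cent_ket l ha.
by rewrite eh; apply/monogenicsE => //; exists (h *: p) => //; apply: (cent_mono ha eh).
Qed.

Lemma hLE l : hL c l = if l then ang - (h_sigma c + h_sigma c) else ang.
Proof. by rewrite /hL angE; case: l => //; zmod_ring. Qed.

(** For l = true the angular operator is the conjugate of - ang under the reflection s0. *)
Lemma cent_rot a l (h : Hc) g : u21_centraliser c a ->
  (forall p, a *: ket l p = ket l (h *: p)) -> g.2 = false ->
  forall p : M, h *: (hG c g *: p) = hG c g *: (h *: p).
Proof.
move=> ha eh g2.
have hE p : h *: (EE *: p) = EE *: (h *: p) :> M.
  apply: (ket_inj (l := l)); have e2 : 2^-1 != 0 :> C by rewrite invr_eq0 two_neq0.
  have : a *: (u_Ep c *: ket l p) = u_Ep c *: (a *: ket l p).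
    by rewrite !scalerA (ha _ (u21_even (i := 0) isT)).
  rewrite Ep_ket !eh Ep_ket kcZ_comm => /ket_inj /eqP; rewrite -subr_eq0 -scalerBr => /eqP.
  by move=> /(kc_inj e2) /eqP; rewrite subr_eq0 => /eqP ->.
have hL' p : h *: (hL c l *: p) = hL c l *: (h *: p) :> M.
  have : a *: (u_Z1 c *: ket l p) = u_Z1 c *: (a *: ket l p).
    by rewrite !scalerA (ha _ (u21_even (i := 3) isT)).
  by rewrite Z1_ket !eh Z1_ket scalerN => /ket_inj /oppr_inj.
move: hL'; rewrite hLE; case: (l) => hL'; last exact: (rot_commutes m_gt0 c_conj N_tau g2 hE hL').
(* The reflection s0 exchanges the two angular operators. *)
pose s := hG c (s0 m).
have ss : s * s = 1 by rewrite /s -hGM (_ : (s0 m * s0 m)%g = 1%g) ?hG1 // -[LHS]/((0 - 0, false) : G) subr0.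
have ssM (p : M) : s *: (s *: p) = p by rewrite scalerA ss scale1r.
have angs (p : M) : ang *: (s *: p) = - (s *: ((ang - (h_sigma c + h_sigma c)) *: p)).
  rewrite !scalerA -scaleNr; congr (_ *: _).
  by rewrite /s ang_g //= mulrBr mulrDr hG_sg //; zmod_ring.
have := @rot_commutes _ _ _ _ tau m_gt0 c_conj N N_tau (s * h * s) (s0 m * g * s0 m)%g.
rewrite !dihM2 g2 => /(_ erefl) hrot p.
have := hrot _ _ (s *: p); rewrite !hGM -!scalerA !ssM -/s => e.
have {}e : s *: (h *: (hG c g *: p)) = s *: (hG c g *: (h *: p)).
  apply: e => q.
    have sE (r : M) : s *: (EE *: r) = EE *: (s *: r) by rewrite !scalerA E_g.
    by rewrite -!scalerA sE hE sE.
  have sang (r : M) : s *: (ang *: r) = - ((ang - (h_sigma c + h_sigma c)) *: (s *: r)).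
    by rewrite -{1}[r]ssM angs scalerN ssM.
  by rewrite -!scalerA sang !scalerN hL' angs.
by rewrite -[LHS]ssM e ssM.
Qed.

End Centraliser.

(** * Irreducibility of the monogenics *)

Section OneDimensional.
Variables (R : realType) (m : nat) (c : dihedral m -> R[i]).
Local Notation C := R[i].
Local Notation G := (dihedral m).
Variables (d : nat) (tau : mx_representation C [set: G]%G d).
Hypothesis m_gt0 : (0 < m)%N.
Hypothesis c_conj : forall (j : nat) (g : G), c (refl m j ^ g)%g = c (refl m j).
Variable N : C.
Hypothesis N_tau : sigma_scalar c tau N.
Hypothesis N_lt1 : 0 < 1 - N.
Hypothesis d_gt0 : (0 < d)%N.
Local Notation M := (stdmod c tau).
Local Notation Hc := (cherednik c).
Local Notation V := 'rV[C]_d.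
Local Notation kc := (palg_cst (cherednik_rel c)).
Local Notation t b := (hE c (zcol R b)).
Local Notation gen := (std_gen c tau).
Local Notation deg := (std_deg (c:=c) (tau:=tau)).
Local Notation ket := (ket (c:=c) (tau:=tau)).
Local Notation mono := (mono (c:=c) (tau:=tau)).

(** Apply the factors x - a one after the other, until the result is zero. *)
Lemma eigenvector (x : Hc) (S : M -> Prop) (s : seq C) p : (forall a q, S q -> S (x *: q - kc a *: q)) ->
  S p -> p <> 0 -> (pev x (\prod_(a <- s) ('X - a%:P)) : Hc) *: p = 0 ->
  exists a q, [/\ S q, q <> 0 & x *: q = kc a *: q].
Proof.
move=> hS; elim: s p => [|a s IH] p Sp p0.
  by rewrite big_nil pevC palg_cst1 scale1r.
rewrite big_cons mulrC pev_root -scalerA scalerBl => h.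
have [e|/eqP e] := eqVneq (x *: p) (kc a *: p); first by exists a, p.
by apply: (IH _ (hS a p Sp)) => // /eqP; rewrite subr_eq0 => /eqP.
Qed.
Lemma phase_neq0 b (g : G) : phase R b g != 0.
Proof.
by apply/eqP => h; have := phase_conj R m_gt0 b g; rewrite h mul0r => /esym/eqP; rewrite oner_eq0.
Qed.

Lemma mono_g l k (g : G) p : g.2 = false -> mono l k p -> mono l k (hG c g *: p).
Proof.
move=> g2 [hp tp]; split; first exact: deg_g.
apply: (kc_inj (phase_neq0 l g)); rewrite [t l *: _]scalerA -scale_hc.
by have := hG_t c g l; rewrite g2 addbF => <-; rewrite -scalerA tp scaler0.
Qed.

Lemma hG_exp (g : G) n : hG c g ^+ n = hG c (g ^+ n)%g.
Proof. by elim: n => [|n IH]; rewrite ?hG1 // exprS IH expgS hGM. Qed.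

(** A rotation is a zero of X^m - 1, which is a product of linear factors. *)
Lemma rot_eigen l k (g : G) : g.2 = false -> exists a p,
  [/\ mono l k p, p <> 0 & hG c g *: p = kc a *: p].
Proof.
move=> g2; have [p [hp p0]] := mono_ex m_gt0 c_conj N_tau N_lt1 d_gt0 l k.
have [s es] := closed_field_poly_normal ('X^m - 1 : {poly C}).
apply: (@eigenvector (hG c g) (mono l k) s p) => //.
  move=> a q hq; rewrite addrC -scaleNr -kcN; apply: mono_lin => //.
  exact: mono_g.
have lc : lead_coef ('X^m - 1 : {poly C}) = 1.
  by rewrite lead_coefDl ?lead_coefXn // size_polyXn size_polyN size_poly1 ltnS.
rewrite lc scale1r in es; rewrite -es -['X^m]scale1r pev_lin scale1r pevXn.
by rewrite -polyCN pevC kcN1 hG_exp rot_expm // hG1 subrr scale0r.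
Qed.

(** The eigenspaces of a rotation are stable under the centraliser. *)
Lemma rot_scalar l k (g : G) : g.2 = false ->
  irreducible_under (u21_centraliser c) (monogenics tau l k) ->
  exists a, forall p, mono l k p -> hG c g *: p = kc a *: p.
Proof.
move=> g2 [_ _ irr]; have [a [y [hy y0 ey]]] := rot_eigen l k g2.
exists a => p hp.
pose S : set (kmod c tau) :=
  [set u | exists q, [/\ mono l k q, hG c g *: q = kc a *: q & u = ket l q]].
have [||S0|SW] := irr S.
- split.
  + by exists 0; split; [apply: mono0 | rewrite !scaler0 | rewrite ket0].
  + move=> u v [q [hq eq ->]] [q' [hq' eq' ->]]; exists (q + q'); split.
    * exact: monoD.
    * by rewrite !scalerDr eq eq'.
    * by rewrite ketD.
  move=> b u hb [q [hq eq ->]]; have [h eh] := cent_ket tau l hb.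
  exists (h *: q); split; [exact: (cent_mono m_gt0 N_tau hb eh hq) | | exact: eh].
  by rewrite -(cent_rot m_gt0 c_conj N_tau hb eh g2) eq kcZ_comm.
- by move=> u [q [hq _ ->]]; apply/monogenicsE => //; exists q.
- have : S (ket l y) by exists y.
  by rewrite S0 /= -(ket0 c tau l) => /ket_inj.
have : S (ket l p) by rewrite SW; apply/monogenicsE => //; exists p.
by move=> [q [_ eq /ket_inj ->]].
Qed.

Lemma hG_mon (g : G) i j : g.2 = false -> hG c g * mon c i j =
  (phase R false g^-1%g ^+ i * phase R true g^-1%g ^+ j) *: (mon c i j * hG c g).
Proof.
move=> g2; rewrite /mon mulrA hG_zn g2 addbF palg_scaleAl -[_ * hG c g * _]mulrA hG_zn g2 addbF.
by rewrite palg_scaleAr scalerA mulrA.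
Qed.

Lemma mcoord_rot (g : G) i j (p : M) : g.2 = false -> mcoord i j (hG c g *: p) =
  (phase R false g^-1%g ^+ i * phase R true g^-1%g ^+ j) *: rep_act tau g (mcoord i j p).
Proof.
move=> g2; have [s ->] := stdmod_sum m_gt0 p.
rewrite scaler_sumr !mcoord_sum // /rep_act mulmx_suml scaler_sumr; apply: eq_bigr => x _.
rewrite scalerA hG_mon // scale_hc -scalerA hG_gen mcoordZ // !mcoord_mon //.
by case: andP => [[/eqP-> /eqP->]|_] //; rewrite mul0mx !scaler0.
Qed.

(** Every v is the coordinate, at the power of z_(~~ l), of some monogenic. *)
Lemma rot_scalar_V l k (g : G) : g.2 = false ->
  irreducible_under (u21_centraliser c) (monogenics tau l k) ->
  exists a, forall v : V, rep_act tau g v = a *: v.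
Proof.
move=> g2 /(rot_scalar g2) [a ha].
pose i := if l then k else 0%N; pose j := if l then 0%N else k.
set f := phase R false g^-1%g ^+ i * phase R true g^-1%g ^+ j.
have f0 : f != 0 by rewrite mulf_neq0 // expf_neq0 // phase_neq0.
exists (f^-1 * a) => v.
have hm : deg k (mon c i j *: gen v).
  by have := @deg_mon R m c d tau i j v; rewrite /i /j; case: (l); rewrite ?addn0 ?add0n.
have [p [hp tp ep]] := deg_decomp m_gt0 N_tau N_lt1 l hm.
have cp : mcoord i j p = v.
  have e := mcoord_mon tau m_gt0 c_conj i j i j v; rewrite !eqxx /= in e; rewrite -[RHS]e.
  case ek : k ep => [|k']; first by move=> ->.
  by move=> [q _ ->]; rewrite mcoordD // mcoord_z // /i /j ek; case: (l); rewrite addr0.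
have := congr1 (mcoord i j) (ha p (conj hp tp)); rewrite mcoord_rot // mcoordZ // cp => e.
by rewrite -scalerA -e scalerA mulVf // scale1r.
Qed.

Lemma tau_rot_scalar l k (g : G) : g.2 = false ->
  irreducible_under (u21_centraliser c) (monogenics tau l k) ->
  exists a, tau g = a%:M.
Proof.
move=> g2 irr; have [a ha] := @rot_scalar_V l k g^-1%g g2 irr.
exists a; apply/row_matrixP => i; rewrite !rowE; have := ha (delta_mx 0 i).
by rewrite /rep_act invgK mul_mx_scalar.
Qed.

(** As the rotations are scalar, every element of G is a scalar times 1 or the reflection s0, and an
    eigenvector of s0 spans a subrepresentation. *)
Lemma irreducible_dim1 l k : mx_irreducible tau ->
  irreducible_under (u21_centraliser c) (monogenics tau l k) -> d = 1%N.
Proof.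
move=> [_ _ simple] irr.
pose s := s0 m; have ss : (s * s)%g = 1%g by rewrite -[LHS]/((0 - 0, false) : G) subr0.
have tauM g h : tau (g * h)%g = tau g *m tau h by rewrite repr_mxM ?inE.
have TT : tau s *m tau s = 1%:M by rewrite -tauM ss repr_mx1.
(* As s0 is an involution, v + v s0 is an eigenvector unless it is zero, and then v is one. *)
have [e [w [w0 ew]]] : exists e (w : V), w != 0 /\ w *m tau s = e *: w.
  pose v : V := const_mx 1.
  have v0 : v != 0.
    by apply/eqP => /rowP/(_ (Ordinal d_gt0)); rewrite !mxE => /eqP; rewrite oner_eq0.
  have [h|h] := eqVneq (v + v *m tau s) 0.
    by exists (-1), v; split=> //; rewrite scaleN1r; apply/eqP; rewrite -addr_eq0 addrC h.
  by exists 1, (v + v *m tau s); split=> //; rewrite scale1r mulmxDl -mulmxA TT mulmx1 addrC.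
have stab g : exists a, w *m tau g = a *: w.
  case g2 : g.2; last first.
    by have [a ->] := tau_rot_scalar g2 irr; exists a; rewrite mul_mx_scalar.
  have [a ea] := tau_rot_scalar (g := (s * g)%g) (l := l) (k := k) ltac:(by rewrite dihM2 g2) irr.
  exists (e * a); rewrite -[g]mul1g -ss -mulgA tauM ea mulmxA ew.
  by rewrite mul_mx_scalar scalerA mulrC.
have := simple <<w>>%MS; rewrite submx1 -mxrank_eq0 genmxE mxrank_eq0 => h.
have : (1%:M <= <<w>>)%MS.
  apply: h => //; apply/mxmoduleP => g _.
  have [a ea] := stab g; rewrite (eqmxMr _ (genmxE w)) ea genmxE.
  exact: scalemx_sub.
move=> /mxrankS; rewrite mxrank1 genmxE => h1.
by apply/eqP; rewrite eqn_leq d_gt0 (leq_trans h1) // rank_leq_row.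
Qed.

End OneDimensional.

Theorem mainTheorem10 (R : realType) (m : nat) (m_gt0 : (0 < m)%N)
    (c : dihedral m -> R[i])
    (c_conj : forall (j : nat) (g : dihedral m),
       c (refl m j ^ g)%g = c (refl m j))
    (c_real : forall j : nat, c (refl m j) \is Num.real)
    (d : nat) (tau : mx_representation R[i] [set: dihedral m]%G d)
    (tau_irr : mx_irreducible tau)
    (N : R[i]) (N_tau : sigma_scalar c tau N)
    (M_irr : irreducible_under (M := stdmod c tau) setT setT)
    (M_unitarisable : unitarisable c tau) :
  (exists (L : bool -> nat -> u21_rep c) (Phi : dsum tau L -> kmod c tau),
     (forall (l : bool) (k : nat),
        is_irr_lowest_weight
          (k%:R + 1 - N) ((-1) ^+ l * (k%:R - N)) (l%:R - 2%:R^-1) (L l k)) /\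
     u21_iso Phi /\
     (forall (l : bool) (k : nat),
        exists v0 : rep_space (L l k),
          lowest_weight_vector
            (k%:R + 1 - N) ((-1) ^+ l * (k%:R - N)) (l%:R - 2%:R^-1) v0 /\
          (forall u, Phi (dtens u v0) = sval u))) /\
  (forall (l : bool) (k : nat),
     stable_subspace (u21_centraliser c) (monogenics tau l k) /\
     (irreducible_under (u21_centraliser c) (monogenics tau l k) ->
        d = 1%N)).
Proof.
have d_gt0 := irr_dim_gt0 tau_irr.
have N_lt1 := unitary_N_lt1 m_gt0 c_conj N_tau d_gt0 M_unitarisable.
split; last first.
  move=> l k; split; first exact: monogenics_stable.
  exact: (irreducible_dim1 m_gt0 c_conj N_tau N_lt1 d_gt0 tau_irr).
exists (lw_rep m_gt0 c_conj N_tau N_lt1 d_gt0), (@Phi _ _ _ _ tau m_gt0 c_conj N N_tau N_lt1 d_gt0).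
split; first by move=> l k; apply: lw_rep_irr.
split; first exact: Phi_iso.
move=> l k; exists (lw_v0 m_gt0 c_conj N_tau N_lt1 d_gt0 l k); split; first exact: lw_lowest.
by move=> u; apply: Phi_v0.
Qed.
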